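(* Suppose $\mathcal{E}$ is a symmetric sequence space not containing $c_0$. Then $\mathfrak{C}_{\mathcal{E}}$ is subprojective if and only if $\mathcal{E}$ is subprojective.
   Context: A symmetric sequence space $\mathcal{E}$ is an (infinite dimensional) Banach space of scalar sequences in which the unit vectors form a $1$-symmetric basis (the norm is invariant under permutations of the coordinates and under multiplying coordinates by unimodular scalars). ''Not containing $c_0$'' means that no subspace of $\mathcal{E}$ is isomorphic to $c_0$. $\mathfrak{C}_{\mathcal{E}}$ is the associated Schatten space: the compact operators $T$ on $\ell_2$ whose sequence of singular values $(s_j(T))_j$ lies in $\mathcal{E}$, with norm $\|T\|_{\mathcal{E}} = \|(s_j(T))_j\|_{\mathcal{E}}$. A Banach space $X$ is subprojective if every closed infinite dimensional subspace $Y \subset X$ contains a closed infinite dimensional subspace $Z \subset Y$ that is complemented in $X$. *)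

(* Defs.v *)
From HB Require Import structures.
From mathcomp Require Import all_boot all_order all_algebra.
From mathcomp Require Import all_classical all_reals all_analysis.
From mathcomp Require Import ring lra.
From mathcomp Require Import complex.

Set Implicit Arguments.
Unset Strict Implicit.
Unset Printing Implicit Defensive.

Import Order.TTheory GRing.Theory Num.Theory.
Import numFieldNormedType.Exports.

Local Open Scope classical_set_scope.
Local Open Scope ring_scope.

Variant scalar_kind := RealScalars | ComplexScalars.

Definition scalar_field (R : realType) (k : scalar_kind) : numFieldType :=
  match k with
  | RealScalars => R
  | ComplexScalars => (R[i] : numFieldType)
  end.

Section Scalars.
Context {R : realType} {k : scalar_kind}.
Implicit Types x y : scalar_field R k.

(* The norm of a numFieldType is valued in that field ([`|x| = of_real (modulus
   x)], lemma [normr_of_real]); sums, suprema and square roots are taken in R. *)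
Definition modulus : scalar_field R k -> R :=
  match k return scalar_field R k -> R with
  | RealScalars => fun x : R => `|x|
  | ComplexScalars => fun z : R[i] => ComplexField.Normc.normc z
  end.

Definition of_real : R -> scalar_field R k :=
  match k return R -> scalar_field R k with
  | RealScalars => fun x : R => x
  | ComplexScalars => fun x : R => Complex x 0
  end.

Definition scalar_conj : scalar_field R k -> scalar_field R k :=
  match k return scalar_field R k -> scalar_field R k with
  | RealScalars => fun x : R => x
  | ComplexScalars => fun z : R[i] => conjc z
  end.

End Scalars.

Section ScalarTheory.
Context {R : realType} {k : scalar_kind}.
Implicit Types x y : scalar_field R k.

Lemma normr_of_real x : `|x| = of_real (modulus x).
Proof. by case: k x. Qed.

Lemma ler_of_real (a b : R) : (of_real a <= of_real b :> scalar_field R k) = (a <= b).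
Proof. by case: k => //=; rewrite lecE /= eqxx. Qed.

Lemma of_realD (a b : R) :
  of_real (a + b) = of_real a + of_real b :> scalar_field R k.
Proof. by case: k => //=; rewrite -[LHS]/(real_complex R _) raddfD. Qed.

Lemma of_realM (a b : R) :
  of_real (a * b) = of_real a * of_real b :> scalar_field R k.
Proof. by case: k => //=; rewrite -[LHS]/(real_complex R _) rmorphM. Qed.

Lemma of_real0 : of_real 0 = 0 :> scalar_field R k.
Proof. by case: k. Qed.

Lemma of_real_inj : injective (of_real : R -> scalar_field R k).
Proof. by move=> a b ab; apply/eqP; rewrite eq_le -2!ler_of_real ab lexx. Qed.

Lemma modulus_ge0 x : 0 <= modulus x.
Proof. by rewrite -ler_of_real of_real0 -normr_of_real. Qed.

Lemma modulusM x y : modulus (x * y) = modulus x * modulus y.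
Proof. by apply: of_real_inj; rewrite of_realM -!normr_of_real normrM. Qed.

Lemma ler_modulusD x y : modulus (x + y) <= modulus x + modulus y.
Proof. by rewrite -ler_of_real of_realD -!normr_of_real ler_normD. Qed.

Lemma modulus0 : modulus (0 : scalar_field R k) = 0.
Proof. by apply: of_real_inj; rewrite -normr_of_real normr0 of_real0. Qed.

Lemma modulus_eq0 x : modulus x = 0 -> x = 0.
Proof. by move=> x0; apply/normr0_eq0; rewrite normr_of_real x0 of_real0. Qed.

End ScalarTheory.

Section Ell2.
Context (R : realType) (k : scalar_kind).
Local Notation K := (scalar_field R k).

Definition square_summable : {pred nat -> K} :=
  fun x => `[< cvgn (series (fun i => modulus (x i) ^+ 2)) >].

Lemma square_summableP (x : nat -> K) :
  reflect (cvgn (series (fun i => modulus (x i) ^+ 2))) (x \in square_summable).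
Proof. exact: asboolP. Qed.

Lemma sqr_modulusD (a b : K) (t : R) : 0 < t ->
  modulus (a + b) ^+ 2 <= (1 + t) * modulus a ^+ 2 + (1 + t^-1) * modulus b ^+ 2.
Proof.
move=> t0; have [a0 b0] := (modulus_ge0 a, modulus_ge0 b).
have := ler_modulusD a b; have := modulus_ge0 (a + b).
move: (modulus a) (modulus b) (modulus (a + b)) a0 b0 => u v w u0 v0 w0 wuv.
apply: (@le_trans _ _ ((u + v) ^+ 2)); first by rewrite ler_pXn2r ?nnegrE ?addr_ge0.
rewrite -subr_ge0.
have -> : (1 + t) * u ^+ 2 + (1 + t^-1) * v ^+ 2 - (u + v) ^+ 2
          = t^-1 * (t * u - v) ^+ 2 by field; exact: lt0r_neq0.
by rewrite mulr_ge0 ?sqr_ge0// invr_ge0 ltW.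
Qed.

Lemma cvg_sqrD (x y : nat -> K) :
  x \in square_summable -> y \in square_summable -> (x + y) \in square_summable.
Proof.
move=> /square_summableP xs /square_summableP ys; apply/square_summableP.
set f := (fun i => modulus (x i) ^+ 2); set g := (fun i => modulus (y i) ^+ 2).
apply: (@series_le_cvg R _ ((2 : R) *: f + (2 : R) *: g)).
- by move=> n; rewrite sqr_ge0.
- by move=> n; rewrite addr_ge0// mulr_ge0// sqr_ge0.
- by move=> n; have := sqr_modulusD (x n) (y n) (@ltr01 R); rewrite invr1.
- by apply: is_cvg_seriesD; apply: is_cvg_seriesZ.
Qed.

Lemma cvg_sqrZ (c : K) (x : nat -> K) :
  x \in square_summable -> (c *: x) \in square_summable.
Proof.
move=> /square_summableP xs; apply/square_summableP.
have -> : (fun i => modulus ((c *: x) i) ^+ 2)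
    = modulus c ^+ 2 *: (fun i => modulus (x i) ^+ 2).
  by apply/funext => i; rewrite /= modulusM exprMn.
exact: is_cvg_seriesZ.
Qed.

Lemma square_summable_submod : submod_closed square_summable.
Proof.
split; last by move=> c x y xs ys; apply: cvg_sqrD => //; exact: cvg_sqrZ.
apply/square_summableP.
have -> : series (fun i => modulus ((0 : nat -> K) i) ^+ 2) = cst 0.
  apply/funext => n; rewrite /series/= big1// => i _.
  by rewrite modulus0 expr0n.
exact: is_cvg_cst.
Qed.

HB.instance Definition _ :=
  GRing.isSubmodClosed.Build K (nat -> K) square_summable square_summable_submod.

Record ell2 := Ell2 { ell2_seq :> nat -> K; _ : ell2_seq \in square_summable }.

HB.instance Definition _ := [isSub for ell2_seq].
HB.instance Definition _ := [Choice of ell2 by <:].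
HB.instance Definition _ := [SubChoice_isSubLmodule of ell2 by <:].

Definition sqr_norm2 (x : ell2) : R :=
  limn (series (fun i => modulus (x i) ^+ 2)).

Lemma ell2_cvg (x : ell2) : cvgn (series (fun i => modulus (x i) ^+ 2)).
Proof. by apply/square_summableP; case: x. Qed.

Lemma sqr_norm2_ge (x : ell2) i : modulus (x i) ^+ 2 <= sqr_norm2 x.
Proof.
have nd : nondecreasing_seq (series (fun i => modulus (x i) ^+ 2)).
  by apply: nondecreasing_series => n _ _; rewrite sqr_ge0.
apply: le_trans (nondecreasing_cvgn_le nd (ell2_cvg (x := x)) i.+1).
rewrite /series /= big_nat_recr//= lerDr sumr_ge0// => j _.
by rewrite sqr_ge0.
Qed.

Lemma sqr_norm2_ge0 x : 0 <= sqr_norm2 x.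
Proof. by apply: le_trans (sqr_norm2_ge x 0); rewrite sqr_ge0. Qed.

Lemma sqr_norm2_eq0 x : sqr_norm2 x = 0 -> x = 0.
Proof.
move=> x0; apply/val_inj/funext => i; apply: modulus_eq0; apply/eqP.
by rewrite -sqrf_eq0 eq_le sqr_ge0 -{1}x0 sqr_norm2_ge.
Qed.

Lemma sqr_norm2D (x y : ell2) (t : R) : 0 < t ->
  sqr_norm2 (x + y) <= (1 + t) * sqr_norm2 x + (1 + t^-1) * sqr_norm2 y.
Proof.
move=> t0; rewrite /sqr_norm2.
set f := (fun i => modulus (x i) ^+ 2); set g := (fun i => modulus (y i) ^+ 2).
have cf : cvgn (series f) := ell2_cvg (x := x).
have cg : cvgn (series g) := ell2_cvg (x := y).
have -> : (1 + t) * limn (series f) + (1 + t^-1) * limn (series g)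
        = limn (series ((1 + t) *: f + (1 + t^-1) *: g)).
  have cf' : cvgn (series ((1 + t) *: f)) by exact: is_cvg_seriesZ.
  have cg' : cvgn (series ((1 + t^-1) *: g)) by exact: is_cvg_seriesZ.
  by rewrite lim_seriesD// !lim_seriesZ.
apply: lim_series_le; first exact: (ell2_cvg (x := x + y)).
  by apply: is_cvg_seriesD; apply: is_cvg_seriesZ.
by move=> n; exact: sqr_modulusD.
Qed.

Definition norm2 (x : ell2) : K := of_real (Num.sqrt (sqr_norm2 x)).

Lemma ler_norm2D x y : norm2 (x + y) <= norm2 x + norm2 y.
Proof.
rewrite /norm2 -of_realD ler_of_real.
have [x0|x0] := eqVneq (sqr_norm2 x) 0.
  by rewrite (sqr_norm2_eq0 x0) add0r lerDr sqrtr_ge0.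
have [y0|y0] := eqVneq (sqr_norm2 y) 0.
  by rewrite (sqr_norm2_eq0 y0) addr0 lerDl sqrtr_ge0.
have gx : 0 < sqr_norm2 x by rewrite lt_def x0 sqr_norm2_ge0.
have gy : 0 < sqr_norm2 y by rewrite lt_def y0 sqr_norm2_ge0.
set a := Num.sqrt (sqr_norm2 x); set b := Num.sqrt (sqr_norm2 y).
have a0 : 0 < a by rewrite sqrtr_gt0.
have b0 : 0 < b by rewrite sqrtr_gt0.
rewrite -[leRHS]ger0_norm ?addr_ge0 ?sqrtr_ge0// -sqrtr_sqr ler_wsqrtr//.
have := sqr_norm2D x y (divr_gt0 b0 a0).
rewrite -[sqr_norm2 x]sqr_sqrtr ?sqr_norm2_ge0// -/a.
rewrite -[sqr_norm2 y]sqr_sqrtr ?sqr_norm2_ge0// -/b.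
move=> /le_trans; apply; rewrite le_eqVlt; apply/orP; left; apply/eqP.
by field; rewrite !lt0r_neq0.
Qed.

Lemma norm2Z (c : K) x : norm2 (c *: x) = `|c| * norm2 x.
Proof.
rewrite /norm2 normr_of_real -of_realM; congr of_real.
have -> : sqr_norm2 (c *: x) = modulus c ^+ 2 * sqr_norm2 x.
  rewrite /sqr_norm2 -[RHS](lim_seriesZ _ (ell2_cvg (x := x))).
  by congr (limn (series _)); apply/funext => i; rewrite /= modulusM exprMn.
by rewrite sqrtrM ?sqr_ge0// sqrtr_sqr ger0_norm// modulus_ge0.
Qed.

Lemma norm2_eq0 x : norm2 x = 0 -> x = 0.
Proof.
rewrite -of_real0 => /of_real_inj/eqP; rewrite sqrtr_eq0 => x0.
by apply: sqr_norm2_eq0; apply/eqP; rewrite eq_le x0 sqr_norm2_ge0.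
Qed.

HB.instance Definition _ :=
  Lmodule_isNormed.Build K ell2 ler_norm2D norm2Z norm2_eq0.

Definition inner (x y : ell2) : K :=
  limn (series (fun i => x i * scalar_conj (y i))).

End Ell2.

(* A normed space is presented as a linear subspace [carrier] of an ambient
   vector space, with a norm that is meaningful on [carrier] only. This makes a
   sequence space a set of sequences and a Schatten space a set of operators.
   The record carries no axioms: see [is_banach]. *)
Record normed_space (R : realType) (k : scalar_kind)
    (V : lmodType (scalar_field R k)) := NormedSpace {
  carrier :> V -> Prop;
  nnorm : V -> R
}.

Section NormedSpaces.
Context {R : realType} {k : scalar_kind}.
Local Notation K := (scalar_field R k).
Implicit Types V W : lmodType K.

Definition linear_subspace V (Y : set V) : Prop := submod_closed [in Y].

Definition norm_cvg V (X : normed_space V) (u : nat -> V) (x : V) : Prop :=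
  nnorm X (u n - x) @[n --> \oo] --> (0 : R).

Definition norm_cauchy V (X : normed_space V) (u : nat -> V) : Prop :=
  forall e : R, 0 < e -> exists N : nat, forall m n : nat,
    (N <= m)%N -> (N <= n)%N -> nnorm X (u m - u n) < e.

Record is_banach V (X : normed_space V) : Prop := {
  banach_submod : linear_subspace (carrier X);
  banach_norm_ge0 : forall x, X x -> 0 <= nnorm X x;
  banach_norm_eq0 : forall x, X x -> nnorm X x = 0 -> x = 0;
  banach_normZ : forall (c : K) x, X x -> nnorm X (c *: x) = modulus c * nnorm X x;
  banach_normD : forall x y, X x -> X y -> nnorm X (x + y) <= nnorm X x + nnorm X y;
  banach_complete : forall u : nat -> V, (forall n, X (u n)) ->
    norm_cauchy X u -> exists2 x, X x & norm_cvg X u x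
}.

Definition closed_subspace V (X : normed_space V) (Y : set V) : Prop :=
  [/\ Y `<=` carrier X, linear_subspace Y &
      forall (u : nat -> V) x, (forall n, Y (u n)) -> X x -> norm_cvg X u x -> Y x].

Definition has_dim V (Y : set V) (n : nat) : Prop :=
  exists b : 'I_n -> V,
    set_bij [set: 'rV[K]_n] Y (fun a => \sum_(i < n) a ord0 i *: b i).

Definition infinite_dim V (Y : set V) : Prop := forall n, ~ has_dim Y n.

Definition linear_on V W (X : set V) (f : V -> W) : Prop :=
  forall (c : K) x y, X x -> X y -> f (c *: x + y) = c *: f x + f y.

Definition bounded_linear V W (X : normed_space V) (Y : normed_space W)
    (f : V -> W) : Prop :=
  [/\ {homo f : x / X x >-> Y x}, linear_on X f &
      exists C : R, forall x, X x -> nnorm Y (f x) <= C * nnorm X x].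

Definition complemented V (X : normed_space V) (Z : set V) : Prop :=
  exists P : V -> V, [/\ bounded_linear X X P,
    forall x, X x -> P (P x) = P x & P @` carrier X = Z].

Definition subprojective V (X : normed_space V) : Prop :=
  forall Y : set V, closed_subspace X Y -> infinite_dim Y ->
  exists Z : set V, [/\ Z `<=` Y, closed_subspace X Z, infinite_dim Z &
                        complemented X Z].

Definition isomorphic V W (X : normed_space V) (Y : normed_space W) : Prop :=
  exists (f : V -> W) (g : W -> V),
    [/\ bounded_linear X Y f, bounded_linear Y X g,
        forall x, X x -> g (f x) = x & forall y, Y y -> f (g y) = y].

Definition contains_copy V W (X : normed_space V) (Y : normed_space W) : Prop :=
  exists2 Z : set V, closed_subspace X Z &
    isomorphic (NormedSpace Z (nnorm X)) Y.

Definition c0 : normed_space (nat -> K) :=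
  NormedSpace [set x : nat -> K | modulus (x n) @[n --> \oo] --> (0 : R)]
              (fun x => sup (range (fun n => modulus (x n)))).

Definition unit_vector (n : nat) : nat -> K := fun i => (i == n)%:R.

Record symmetric_sequence_space (E : normed_space (nat -> K)) : Prop := {
  sss_banach : is_banach E;
  sss_infinite_dim : infinite_dim (carrier E);
  sss_unit_vector : forall n, E (unit_vector n);
  (* Every x in E has a unique expansion along the unit vectors, and the
     coefficients of this expansion are the terms of the sequence x. *)
  sss_basis : forall x, E x -> forall a : nat -> K,
    norm_cvg E (fun n => \sum_(i < n) a i *: unit_vector i) x <-> a = x;
  sss_perm : forall (p : nat -> nat) x, bijective p -> E x ->
    E (x \o p) /\ nnorm E (x \o p) = nnorm E x;
  sss_unimodular : forall (c : nat -> K) x, (forall i, modulus (c i) = 1) ->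
    E x -> E (fun i => c i * x i) /\ nnorm E (fun i => c i * x i) = nnorm E x
}.

End NormedSpaces.

Section Schatten.
Context {R : realType} {k : scalar_kind}.
Local Notation K := (scalar_field R k).
Local Notation ell2 := (ell2 R k).

Definition compact_operator (T : ell2 -> ell2) : Prop :=
  linear T /\ compact (closure (T @` [set x | `|x| <= 1])).

Definition is_adjoint (T S : ell2 -> ell2) : Prop :=
  forall x y, inner (T x) y = inner x (S y).

(* s lists the square roots of the eigenvalues of T^* T in nonincreasing order,
   repeated according to multiplicity; if only finitely many eigenvalues are
   nonzero, s is padded with zeros. For compact T exactly one s qualifies. *)
Definition is_singular_values (T : ell2 -> ell2) (s : nat -> R) : Prop :=
  [/\ forall j, 0 <= s j,
      forall j, s j.+1 <= s j &
      exists2 S : ell2 -> ell2, is_adjoint T S &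
        forall l : R, 0 < l -> exists2 n : nat,
          has_dim [set x | S (T x) = of_real (l ^+ 2) *: x] n &
          ([set j | s j = l] #= `I_n)%card].

Definition singular_values (T : ell2 -> ell2) : nat -> R :=
  xget (fun=> 0) [set s | is_singular_values T s].

Definition schatten (E : normed_space (nat -> K)) : normed_space (ell2 -> ell2) :=
  NormedSpace
    [set T | compact_operator T /\ E (fun j => of_real (singular_values T j))]
    (fun T => nnorm E (fun j => of_real (singular_values T j))).

End Schatten.

(* Main.v *)
Require Import Defs.
From mathcomp Require Import all_boot all_order all_algebra.
From mathcomp Require Import all_classical all_reals all_analysis.
From mathcomp Require Import ring lra.
From mathcomp Require Import complex.

(** Write [C] for the Schatten space of [E], and call a family partially
    orthonormal when it is orthogonal with vectors of norm one or zero. For two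
    such families [e], [f] and [a] in [E], [jop e f a] is the operator
    [\sum_i a_i <., e_i> f_i]; for an operator [T], [diag_of e f T] is the sequence
    [<T e_i, f_i>]. Two contraction properties carry everything:
    [jop_schatten] ([jop e f] maps [E] into [C]) and [diag_schatten] ([diag_of e f]
    maps [C] into [E]). Both follow from [diag_jop]: the matrix that turns [a] into
    [diag_of g h (jop e f a)] is doubly substochastic, and the norm of a
    symmetric sequence space is monotone for weak majorization
    ([E_majorization]). Since the singular values of an operator are its diagonal
    along its own singular vectors ([svals_diag], after the singular value
    decomposition [svd_op]), the triangle inequality and the completeness of [C]
    follow as well ([schatten_banach]).

    If [C] is subprojective, so is [E] ([subprojective_diagonal]): along the
    coordinate vectors, [jop] embeds [E] in [C] as the diagonal operators, and
    [diag_of] is a left inverse of norm one.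

    Conversely let [E] be subprojective and let [Y] be a closed infinite
    dimensional subspace of [C]. If for some [m] the first [m] rows and columns of
    an operator control its norm on [Y], then the norm of [Y] is equivalent to a
    Hilbert seminorm that is defined on all of [C], and the orthogonal projection shows
    that [Y] itself is complemented ([rows_columns_complemented]). Otherwise, for
    every [m] some operator of [Y] has almost nothing in its first [m] rows and
    columns. A gliding hump then gives operators [z n] of [Y] that are, up to
    relative errors [2 ^- n.+1], finite blocks [x n] supported on consecutive sets of rows
    and columns ([block_step], [gliding_hump]). All these blocks have a common form
    [x n = jop e f (al n)], where the [al n] are disjointly supported in [E].
    The closed span of the [al n] contains a complemented infinite dimensional
    subspace [W]. Replacing [x n] by [z n] for [n >= M] perturbs [jop e f] on
    [W] by a small amount, so that the perturbed copy of [W] is still complemented,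
    by a Neumann series ([perturbed_retraction]). The finitely many
    blocks that were not replaced are removed by intersecting with the kernels of
    [M] functionals ([complemented_kers]); what remains is contained in [Y]
    ([embed_sub], [block_sequence_complemented]). *)

Set Implicit Arguments.
Unset Strict Implicit.
Unset Printing Implicit Defensive.
Import Order.TTheory GRing.Theory Num.Theory.
Import numFieldNormedType.Exports.
Local Open Scope classical_set_scope.
Local Open Scope ring_scope.

#[local] Arguments ell2_seq : simpl never.

(** * Null sequences *)

(** An elementary form of convergence to zero, which for nonnegative sequences
    agrees with the limit of the topology ([nullP]). Only upper bounds are asked
    for, so that domination by a null sequence is a one-sided inequality. *)
Definition null (R : realType) (r : nat -> R) : Prop :=
  forall e : R, 0 < e -> exists N : nat, forall n, (N <= n)%N -> r n < e.

Section Null.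
Context {R : realType}.
Implicit Types r s : nat -> R.

Lemma nullP r : (forall n, 0 <= r n) -> (r n @[n --> \oo] --> (0 : R)) <-> null r.
Proof.
move=> r0; split.
  move=> /cvgrPdist_lt h e e0; have [N _ hN] := h e e0.
  by exists N => n Nn; have := hN n Nn; rewrite sub0r normrN ger0_norm.
move=> h; apply/cvgrPdist_lt => e e0; have [N hN] := h e e0.
by exists N => // n Nn; rewrite sub0r normrN ger0_norm// hN.
Qed.

Lemma null_le r s : (forall n, r n <= s n) -> null s -> null r.
Proof.
move=> rs hs e e0; have [N hN] := hs e e0.
by exists N => n /hN; exact: le_lt_trans.
Qed.

Lemma nullD r s : null r -> null s -> null (fun n => r n + s n).
Proof.
move=> hr hs e e0; have e2 : 0 < e / 2 by rewrite divr_gt0.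
have [N hN] := hr _ e2; have [M hM] := hs _ e2.
exists (maxn N M) => n; rewrite geq_max => /andP[/hN h1 /hM h2].
by rewrite (splitr e) ltrD.
Qed.

Lemma nullM (c : R) r : 0 <= c -> null r -> null (fun n => c * r n).
Proof.
rewrite le_eqVlt => /predU1P[<-|c0] hr e e0.
  by exists 0%N => n _; rewrite mul0r.
have [N hN] := hr _ (divr_gt0 e0 c0).
by exists N => n /hN; rewrite ltr_pdivlMr// mulrC.
Qed.

Lemma null_shift r p : null r -> null (fun n => r (n + p)%N).
Proof.
move=> hr e /hr[N hN]; exists N => n Nn; apply: hN.
by rewrite (leq_trans Nn)// leq_addr.
Qed.

Lemma null0 : null (fun=> 0 : R).
Proof. by move=> e e0; exists 0%N. Qed.

Lemma null_cst (a : R) : null (fun=> a) -> a <= 0.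
Proof.
move=> h; rewrite leNgt; apply/negP => /[dup] a0 /h[N /(_ N (leqnn _))].
by rewrite ltxx.
Qed.

Lemma null_sum (I : Type) (l : seq I) (r : I -> nat -> R) :
  (forall i, null (r i)) -> null (fun n => \sum_(i <- l) r i n).
Proof.
move=> h; elim: l => [|i l IH].
  by apply: null_le null0 => n; rewrite big_nil.
by apply: null_le (nullD (h i) IH) => n; rewrite big_cons.
Qed.

Lemma null_inv : null (fun n => n.+1%:R^-1 : R).
Proof.
move=> e e0; exists (Num.truncn e^-1) => n Nn.
rewrite invf_plt ?posrE//; apply: lt_le_trans (truncnS_gt _) _.
by rewrite ler_nat ltnS.
Qed.

Lemma le_null (a : R) (r : nat -> R) b : (forall n, a <= b + r n) -> null r -> a <= b.
Proof.
move=> h hr; rewrite -subr_le0; apply: null_cst; apply: null_le hr => n.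
by rewrite lerBlDl.
Qed.

(** The partial sums are nondecreasing and bounded, hence Cauchy. *)
Lemma series_tail (f : nat -> R) (C : R) :
  (forall i, 0 <= f i) -> (forall n, \sum_(i < n) f i <= C) ->
  forall e, 0 < e -> exists N : nat, forall m n, (N <= m <= n)%N ->
    \sum_(m <= i < n) f i < e.
Proof.
move=> f0 fC e e0.
have nd : nondecreasing_seq (series f).
  by apply: nondecreasing_series => n _ _; exact: f0.
have cv : cvgn (series f).
  apply: nondecreasing_is_cvgn => //; exists C => _ [n _ <-].
  by rewrite /series /= big_mkord.
have /cvgrPdist_lt /(_ e e0) [N _ hN] := cv.
exists N => m n /andP[Nm mn].
have := hN m Nm; have := nondecreasing_cvgn_le nd cv n.
have := nondecreasing_cvgn_le nd cv m.
move: (limn (series f)) => l lm ln; rewrite ger0_norm ?subr_ge0// => lt.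
have -> : \sum_(m <= i < n) f i = series f n - series f m.
  by rewrite sub_series_geq.
lra.
Qed.

End Null.

(** * Real and complex scalars, uniformly *)
Section Scalars.
Context {R : realType} {k : scalar_kind}.
Local Notation K := (scalar_field R k).
Implicit Types x y : K.

Lemma conjK x : scalar_conj (scalar_conj x) = x.
Proof. by case: k x => // -[a b] /=; rewrite opprK. Qed.

Lemma conjD x y : scalar_conj (x + y) = scalar_conj x + scalar_conj y.
Proof. by case: k x y => // x y /=; rewrite rmorphD. Qed.

Lemma conjM x y : scalar_conj (x * y) = scalar_conj x * scalar_conj y.
Proof. by case: k x y => // x y /=; rewrite rmorphM. Qed.

Lemma conj0 : scalar_conj (0 : K) = 0.
Proof. by case: k => //=; rewrite -[LHS]/(conjc 0) rmorph0. Qed.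

Lemma conjN x : scalar_conj (- x) = - scalar_conj x.
Proof. by apply/eqP; rewrite -addr_eq0 -conjD addNr conj0. Qed.

Lemma conj_sum (I : Type) (r : seq I) (P : pred I) (F : I -> K) :
  scalar_conj (\sum_(i <- r | P i) F i) = \sum_(i <- r | P i) scalar_conj (F i).
Proof. exact: (big_morph _ conjD conj0). Qed.

Lemma conj_of_real (r : R) : scalar_conj (of_real r : K) = of_real r.
Proof. by case: k => //=; rewrite oppr0. Qed.

Lemma of_real1 : of_real 1 = 1 :> K.
Proof. by case: k. Qed.

Lemma conj1 : scalar_conj (1 : K) = 1.
Proof. by rewrite -of_real1 conj_of_real. Qed.

Lemma of_realN (r : R) : of_real (- r) = - of_real r :> K.
Proof. by apply/eqP; rewrite -addr_eq0 -of_realD addNr of_real0. Qed.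

Lemma of_real_sum (I : Type) (r : seq I) (P : pred I) (F : I -> R) :
  of_real (\sum_(i <- r | P i) F i) = \sum_(i <- r | P i) of_real (F i) :> K.
Proof. exact: (big_morph _ (@of_realD R k) (@of_real0 R k)). Qed.

Lemma mul_conj x : x * scalar_conj x = of_real (modulus x ^+ 2).
Proof.
case: k x => /= [x|[a b]]; first by rewrite -normrX ger0_norm// sqr_ge0.
apply/eqP; rewrite eq_complex /= sqr_sqrtr ?addr_ge0 ?sqr_ge0//.
by apply/andP; split; apply/eqP; ring.
Qed.

Lemma modulus_of_real (r : R) : modulus (of_real r : K) = `|r|.
Proof.
case: k => //=; rewrite expr0n /= addr0 sqrtr_sqr//.
Qed.

Lemma modulus1 : modulus (1 : K) = 1.
Proof. by rewrite -of_real1 modulus_of_real normr1. Qed.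

Lemma modulus_conj x : modulus (scalar_conj x) = modulus x.
Proof. by case: k x => // -[a b] /=; rewrite sqrrN. Qed.

Lemma modulusN x : modulus (- x) = modulus x.
Proof.
by rewrite -mulN1r modulusM -of_real1 -of_realN modulus_of_real normrN1 mul1r.
Qed.

Lemma modulusB x y : modulus (x - y) = modulus (y - x).
Proof. by rewrite -modulusN opprB. Qed.

Lemma modulusV x : modulus x^-1 = (modulus x)^-1.
Proof.
have [->|x0] := eqVneq x 0; first by rewrite invr0 modulus0 invr0.
have mx : modulus x != 0 by apply: contra_neq x0 => /modulus_eq0.
by apply: (mulfI mx); rewrite -modulusM !mulfV ?modulus1.
Qed.

Lemma modulus_sum (I : Type) (r : seq I) (P : pred I) (F : I -> K) :
  modulus (\sum_(i <- r | P i) F i) <= \sum_(i <- r | P i) modulus (F i).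
Proof.
elim/big_rec2: _ => [|i y1 y2 _ h]; first by rewrite modulus0.
by apply: le_trans (ler_modulusD _ _) _; rewrite lerD2l.
Qed.

Definition re : K -> R :=
  match k return scalar_field R k -> R with
  | RealScalars => id | ComplexScalars => fun z : R[i] => complex.Re z end.
Definition im : K -> R :=
  match k return scalar_field R k -> R with
  | RealScalars => fun=> 0 | ComplexScalars => fun z : R[i] => complex.Im z end.
(** Zero for real scalars, so that [reimE] holds in both cases. *)
Definition ii : K :=
  match k return scalar_field R k with
  | RealScalars => 0 | ComplexScalars => Complex 0 1 end.

Lemma reimE x : x = of_real (re x) + ii * of_real (im x).
Proof.
rewrite /re /im /ii; case: k x => /= [x|[a b]]; first by rewrite mul0r addr0.
by apply/eqP; rewrite eq_complex /=; apply/andP; split; apply/eqP; ring.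
Qed.

Lemma reB x y : re (x - y) = re x - re y.
Proof. by rewrite /re; case: k x y => // -[a b] [c d]. Qed.

Lemma imB x y : im (x - y) = im x - im y.
Proof. by rewrite /im; case: k x y => [x y|[a b] [c d]] //; rewrite subr0. Qed.

Lemma re_le x : `|re x| <= modulus x.
Proof.
rewrite /re; case: k x => // -[a b] /=.
by rewrite -sqrtr_sqr ler_wsqrtr// lerDl sqr_ge0.
Qed.

Lemma im_le x : `|im x| <= modulus x.
Proof.
rewrite /im; case: k x => [x|[a b]] /=; first by rewrite normr0.
by rewrite -sqrtr_sqr ler_wsqrtr// lerDr sqr_ge0.
Qed.

Lemma modulus_reim (a b : R) : modulus (of_real a + ii * of_real b) <= `|a| + `|b|.
Proof.
apply: le_trans (ler_modulusD _ _) _; rewrite modulus_of_real lerD2l modulusM.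
rewrite modulus_of_real ler_piMl//.
by rewrite /ii; case: k => /=; rewrite ?normr0// expr0n expr1n add0r sqrtr1.
Qed.

(** The norm of [K] takes its values in [K]; measuring distances by [modulus]
    keeps all estimates in [R]. *)
Definition cvK (u : nat -> K) (l : K) := null (fun n => modulus (u n - l)).

Lemma cvKP (u : nat -> K) l : (u @ \oo --> l) <-> cvK u l.
Proof.
split.
  move=> /cvgrPdist_lt h e e0.
  have e0' : 0 < of_real e :> K by rewrite lt_def -{2}of_real0 ler_of_real ltW// andbT
    -of_real0; apply: contra_neq (lt0r_neq0 e0) => /of_real_inj.
  have [N _ hN] := h _ e0'; exists N => n /hN.
  rewrite normr_of_real modulusB lt_def ler_of_real => /andP[hne hle].
  by rewrite lt_def hle andbT; apply: contra_neq hne => ->.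
move=> h; apply/cvgrPdist_lt => e e0.
have eE : e = of_real (modulus e) by rewrite -normr_of_real gtr0_norm.
have e0' : 0 < modulus e.
  by rewrite lt_def modulus_ge0 andbT; apply: contra_neq (lt0r_neq0 e0) => /modulus_eq0.
have [N hN] := h _ e0'; exists N => // n /hN hn.
rewrite normr_of_real eE modulusB lt_def ler_of_real (ltW hn) andbT.
by apply/eqP => /of_real_inj hE; rewrite hE ltxx in hn.
Qed.

Lemma cvK_uniq u l l' : cvK u l -> cvK u l' -> l = l'.
Proof.
move=> h h'; apply/eqP; rewrite -subr_eq0; apply/eqP/modulus_eq0/eqP.
rewrite eq_le modulus_ge0 andbT; apply: null_cst; apply: null_le (nullD h h') => n.
rewrite [X in _ <= X + _]modulusB; apply: le_trans (ler_modulusD _ _).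
by rewrite le_eqVlt; apply/orP; left; apply/eqP; congr modulus; ring.
Qed.

Lemma cvK_lim u l : cvK u l -> limn u = l.
Proof.
move=> /[dup] h /cvKP h'.
have : cvgn u by apply/cvg_ex; exists l.
by move=> /cvKP h2; exact: cvK_uniq h2 h.
Qed.

Lemma cvKD u v l m : cvK u l -> cvK v m -> cvK (fun n => u n + v n) (l + m).
Proof.
move=> h h'; apply: null_le (nullD h h') => n; apply: le_trans (ler_modulusD _ _).
by rewrite le_eqVlt; apply/orP; left; apply/eqP; congr modulus; ring.
Qed.

Lemma cvKM c u l : cvK u l -> cvK (fun n => c * u n) (c * l).
Proof.
move=> h; apply: null_le (nullM (modulus_ge0 c) h) => n.
by rewrite -modulusM mulrBr.
Qed.

Lemma cvK_conj u l : cvK u l -> cvK (fun n => scalar_conj (u n)) (scalar_conj l).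
Proof. by apply: null_le => n; rewrite -conjN -conjD modulus_conj. Qed.

Lemma cvK_cst l : cvK (fun=> l) l.
Proof. by move=> e e0; exists 0%N => n _; rewrite subrr modulus0. Qed.

Lemma cvK_ext u v l : u =1 v -> cvK u l -> cvK v l.
Proof. by move=> uv; apply: null_le => n; rewrite uv. Qed.

(** Real and imaginary parts are Cauchy. *)
Lemma cvK_complete (u : nat -> K) :
  (forall e : R, 0 < e -> exists N : nat, forall m n, (N <= m)%N -> (N <= n)%N ->
     modulus (u m - u n) < e) -> exists l, cvK u l.
Proof.
have realcase (v : nat -> R) :
  (forall e : R, 0 < e -> exists N : nat, forall m n, (N <= m)%N -> (N <= n)%N ->
     `|v m - v n| < e) -> exists l, null (fun n => `|v n - l|).
  move=> h; have : cvgn v.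
    apply/cauchy_cvgP/cauchy_ballP => e e0; have [N hN] := h e e0.
    exists (v @` [set n | (N <= n)%N], v @` [set n | (N <= n)%N]) => /=.
      by split; exists N => // n /= Nn; exists n.
    by move=> [_ _] [/= [m Nm <-] [n Nn <-]]; exact: hN.
  move=> /cvgrPdist_lt hv; exists (limn v) => e e0.
  have [N _ hN] := hv e e0; exists N => n /hN; by rewrite distrC.
move=> h.
have [a ha] : exists l, null (fun n => `|re (u n) - l|).
  apply: realcase => e /h[N hN]; exists N => m n Nm Nn; rewrite -reB.
  exact: le_lt_trans (re_le _) (hN m n Nm Nn).
have [b hb] : exists l, null (fun n => `|im (u n) - l|).
  apply: realcase => e /h[N hN]; exists N => m n Nm Nn; rewrite -imB.
  exact: le_lt_trans (im_le _) (hN m n Nm Nn).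
exists (of_real a + ii * of_real b); apply: null_le (nullD ha hb) => n.
have -> : u n - (of_real a + ii * of_real b)
  = of_real (re (u n) - a) + ii * of_real (im (u n) - b).
  by rewrite {1}[u n]reimE !of_realD !of_realN; ring.
exact: modulus_reim.
Qed.

Lemma cvK_series (f : nat -> K) (g : nat -> R) (C : R) :
  (forall i, modulus (f i) <= g i) -> (forall n, \sum_(i < n) g i <= C) ->
  exists l, cvK (fun n => \sum_(i < n) f i) l.
Proof.
move=> fg gC; apply: cvK_complete => e e0.
have g0 i : 0 <= g i by apply: le_trans (fg i); exact: modulus_ge0.
have [N hN] := series_tail g0 gC e0.
have main m n : (N <= m <= n)%N -> modulus (\sum_(i < n) f i - \sum_(i < m) f i) < e.
  move=> /[dup] /andP[_ mn] /hN; apply: le_lt_trans.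
  rewrite -!(big_mkord xpredT) (big_cat_nat _ mn)//= [X in modulus X](_ : _ =
    \sum_(m <= i < n) f i); last by ring.
  by apply: le_trans (modulus_sum _ _ _) _; apply: ler_sum => i _.
exists N => m n Nm Nn; have [mn|nm] := leqP m n.
  by rewrite modulusB main ?Nm.
by rewrite main// Nn ltnW.
Qed.

End Scalars.

(** * The inner product of ell2 *)

Section Inner.
Context {R : realType} {k : scalar_kind}.
Local Notation K := (scalar_field R k).
Local Notation H := (ell2 R k).
Implicit Types x y z : H.

(** The norm of [ell2], as a real number: the norm [`|x|] has values in [K]. *)
Definition nr x : R := Num.sqrt (sqr_norm2 x).

Lemma nr_ge0 x : 0 <= nr x. Proof. exact: sqrtr_ge0. Qed.
#[local] Hint Extern 0 (is_true (Order.le (@Algebra.zero _) (nr _))) =>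
  solve [apply: nr_ge0] : core.

Lemma normrE x : `|x| = of_real (nr x) :> K. Proof. by []. Qed.

Lemma nrD x y : nr (x + y) <= nr x + nr y.
Proof. by rewrite -(@ler_of_real R k) of_realD -!normrE ler_normD. Qed.

Lemma nrZ (c : K) x : nr (c *: x) = modulus c * nr x.
Proof.
by apply: (@of_real_inj R k); rewrite of_realM -normr_of_real -!normrE normrZ.
Qed.

Lemma nr0_eq0 x : nr x = 0 -> x = 0.
Proof. by move=> h; apply/normr0_eq0; rewrite normrE h of_real0. Qed.

Lemma nr0 : nr 0 = 0.
Proof. by apply: (@of_real_inj R k); rewrite -normrE normr0 of_real0. Qed.

Lemma nrN x : nr (- x) = nr x.
Proof. by rewrite -scaleN1r nrZ modulusN modulus1 mul1r. Qed.

Lemma nrB x y : nr (x - y) = nr (y - x).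
Proof. by rewrite -nrN opprB. Qed.

Lemma nr_sum (I : Type) (r : seq I) (P : pred I) (F : I -> H) :
  nr (\sum_(i <- r | P i) F i) <= \sum_(i <- r | P i) nr (F i).
Proof.
elim/big_rec2: _ => [|i y1 y2 _ h]; first by rewrite nr0.
by apply: le_trans (nrD _ _) _; rewrite lerD2l.
Qed.

Lemma nr_sqr_sum x n : \sum_(i < n) modulus (x i) ^+ 2 <= nr x ^+ 2.
Proof.
rewrite sqr_sqrtr ?sqr_norm2_ge0// -(big_mkord xpredT (fun i => modulus (x i) ^+ 2)).
have nd : nondecreasing_seq (series (fun i => modulus (x i) ^+ 2)).
  by apply: nondecreasing_series => m _ _; rewrite sqr_ge0.
exact: nondecreasing_cvgn_le nd (ell2_cvg (x := x)) n.
Qed.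

Lemma nr_sqr_le x (C : R) :
  (forall n, \sum_(i < n) modulus (x i) ^+ 2 <= C) -> nr x ^+ 2 <= C.
Proof.
move=> h; rewrite sqr_sqrtr ?sqr_norm2_ge0//.
apply: limr_le; first exact: (ell2_cvg (x := x)).
by apply: nearW => n; rewrite /series /= big_mkord.
Qed.

Lemma ell2_of (x : nat -> K) (C : R) :
  (forall n, \sum_(i < n) modulus (x i) ^+ 2 <= C) -> exists y : H, y = x :> (nat -> K).
Proof.
move=> h; suff xs : x \in square_summable (k := k) by exists (Ell2 xs).
apply/square_summableP; apply: nondecreasing_is_cvgn.
  by apply: nondecreasing_series => m _ _; rewrite sqr_ge0.
by exists C => _ [n _ <-]; rewrite /series /= big_mkord.
Qed.

Lemma inner_cvK x y :
  cvK (fun n => \sum_(i < n) x i * scalar_conj (y i)) (inner x y).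
Proof.
have [l hl] : exists l : K, cvK (fun n => \sum_(i < n) x i * scalar_conj (y i)) l.
  apply: (cvK_series (f := fun i => x i * scalar_conj (y i)) (g := fun i =>
    modulus (x i) ^+ 2 + modulus (y i) ^+ 2)
           (C := nr x ^+ 2 + nr y ^+ 2)).
    move=> i; rewrite modulusM modulus_conj.
    have := sqr_ge0 (modulus (x i) - modulus (y i)).
    have := sqr_ge0 (modulus (x i)); have := sqr_ge0 (modulus (y i)).
    move: (modulus _) (modulus _) => a b; nra.
  by move=> n; rewrite big_split lerD ?nr_sqr_sum.
rewrite /inner (_ : series _ = (fun n => \sum_(i < n) x i * scalar_conj (y i))).
  by rewrite (cvK_lim hl).
by apply/funext => n; rewrite /series /= big_mkord.
Qed.

Lemma ell2_add x y i : (x + y) i = x i + y i. Proof. by []. Qed.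
Lemma ell2_scale (c : K) x i : (c *: x) i = c * x i. Proof. by []. Qed.
Lemma ell2_opp x i : (- x) i = - x i. Proof. by []. Qed.
Lemma ell2_sub x y i : (x - y) i = x i - y i. Proof. by []. Qed.
Lemma ell2_0 i : (0 : H) i = 0. Proof. by []. Qed.
Lemma ell2_sum (I : Type) (r : seq I) (P : pred I) (F : I -> H) j :
  (\sum_(i <- r | P i) F i) j = \sum_(i <- r | P i) F i j.
Proof. by elim/big_rec2: _ => [//|i y1 y2 _ <-]. Qed.
Lemma ell2_eq x y : (forall i, x i = y i) -> x = y.
Proof. by move=> h; apply/val_inj/funext. Qed.

Lemma innerDZl c x y z : inner (c *: x + y) z = c * inner x z + inner y z.
Proof.
apply: cvK_uniq (inner_cvK _ _) _.
apply: cvK_ext (cvKD (cvKM c (inner_cvK x z)) (inner_cvK y z)) => n.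
rewrite mulr_sumr -big_split /=; apply: eq_bigr => i _.
by rewrite ell2_add ell2_scale; ring.
Qed.

Lemma inner_conj x y : inner y x = scalar_conj (inner x y).
Proof.
apply: cvK_uniq (inner_cvK _ _) _.
apply: cvK_ext (cvK_conj (inner_cvK x y)) => n.
rewrite conj_sum; apply: eq_bigr => i _; by rewrite conjM conjK mulrC.
Qed.

Lemma inner_self x : inner x x = of_real (nr x ^+ 2).
Proof.
apply: cvK_uniq (inner_cvK _ _) _.
rewrite sqr_sqrtr ?sqr_norm2_ge0//.
have /cvgrPdist_lt h := ell2_cvg (x := x).
move=> e e0; have [N _ hN] := h e e0; exists N => n /hN.
rewrite distrC /series /= big_mkord; congr (_ < _).
rewrite -(@modulus_of_real R k) of_realD of_realN of_real_sum.
by congr (modulus (_ - _)); apply: eq_bigr => i _; rewrite mul_conj.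
Qed.

Lemma inner0l z : inner 0 z = 0.
Proof.
by have := innerDZl (-1) 0 0 z; rewrite scaler0 addr0 => ->; rewrite mulN1r addNr.
Qed.
Lemma innerDl x y z : inner (x + y) z = inner x z + inner y z.
Proof. by rewrite -[x]scale1r innerDZl mul1r scale1r. Qed.
Lemma innerZl c x z : inner (c *: x) z = c * inner x z.
Proof. by rewrite -[c *: x]addr0 innerDZl inner0l addr0. Qed.
Lemma innerNl x z : inner (- x) z = - inner x z.
Proof. by rewrite -scaleN1r innerZl mulN1r. Qed.
Lemma innerBl x y z : inner (x - y) z = inner x z - inner y z.
Proof. by rewrite innerDl innerNl. Qed.
Lemma inner0r z : inner z 0 = 0.
Proof. by rewrite inner_conj inner0l conj0. Qed.
Lemma innerDr x y z : inner z (x + y) = inner z x + inner z y.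
Proof. by rewrite inner_conj innerDl conjD -!inner_conj. Qed.
Lemma innerZr c x z : inner z (c *: x) = scalar_conj c * inner z x.
Proof. by rewrite inner_conj innerZl conjM -inner_conj. Qed.
Lemma innerNr x z : inner z (- x) = - inner z x.
Proof. by rewrite inner_conj innerNl conjN -inner_conj. Qed.
Lemma innerBr x y z : inner z (x - y) = inner z x - inner z y.
Proof. by rewrite innerDr innerNr. Qed.
Lemma inner_suml (I : Type) (r : seq I) (P : pred I) (F : I -> H) z :
  inner (\sum_(i <- r | P i) F i) z = \sum_(i <- r | P i) inner (F i) z.
Proof. exact: (big_morph (fun x => inner x z) (fun a b => innerDl a b z) (inner0l z)). Qed.
Lemma inner_sumr (I : Type) (r : seq I) (P : pred I) (F : I -> H) z :
  inner z (\sum_(i <- r | P i) F i) = \sum_(i <- r | P i) inner z (F i).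
Proof. exact: (big_morph (inner z) (fun a b => innerDr a b z) (inner0r z)). Qed.

Lemma nr_le_sqr x (C : R) : 0 <= C -> nr x ^+ 2 <= C ^+ 2 -> nr x <= C.
Proof. by move=> C0; rewrite ler_pXn2r ?nnegrE. Qed.

Lemma nr_of_self x (r : R) : 0 <= r -> inner x x = of_real (r ^+ 2) -> nr x = r.
Proof.
rewrite inner_self => r0 /of_real_inj /eqP; rewrite eqrXn2 ?nr_ge0//.
by move=> /eqP.
Qed.

Lemma cauchy_schwarz x y : modulus (inner x y) <= nr x * nr y.
Proof.
have [y0|y0] := eqVneq (nr y) 0.
  by rewrite (nr0_eq0 y0) inner0r modulus0 nr0 mulr0.
have yp : 0 < nr y by rewrite lt_def y0 nr_ge0.
set c := inner x y.
set t : K := c * of_real (nr y ^- 2).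
have h : inner (x - t *: y) (x - t *: y) = of_real (nr x ^+ 2 - modulus c ^+ 2 / nr y ^+ 2).
  rewrite innerBl !innerBr !innerZl !innerZr (inner_conj x y) -/c !inner_self.
  rewrite /t conjM conj_of_real of_realD of_realN of_realM -mul_conj.
  have e : (of_real (nr y ^+ 2) : K) * of_real (nr y ^- 2) = 1.
    by rewrite -of_realM mulfV ?of_real1// expf_neq0.
  transitivity (of_real (nr x ^+ 2) - scalar_conj c * of_real (nr y ^- 2) * c
    - c * of_real (nr y ^- 2) * scalar_conj c + c * scalar_conj c * of_real (nr y ^- 2)
     * (of_real (nr y ^+ 2) * of_real (nr y ^- 2))); first by ring.
  by rewrite e; ring.
move: h; rewrite inner_self => /of_real_inj h.
have : 0 <= nr x ^+ 2 - modulus c ^+ 2 / nr y ^+ 2 by rewrite -h sqr_ge0.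
rewrite subr_ge0 ler_pdivrMr ?exprn_gt0// -exprMn.
by rewrite ler_pXn2r ?nnegrE ?mulr_ge0 ?modulus_ge0.
Qed.

Lemma inner_inj x y : (forall z, inner x z = inner y z) -> x = y.
Proof.
move=> h; apply/eqP; rewrite -subr_eq0; apply/eqP/nr0_eq0/eqP.
rewrite -sqrf_eq0; apply/eqP/(@of_real_inj R k).
by rewrite -inner_self innerBl h subrr of_real0.
Qed.

Lemma pythagoras x y : inner x y = 0 -> nr (x + y) ^+ 2 = nr x ^+ 2 + nr y ^+ 2.
Proof.
move=> h; apply: (@of_real_inj R k); rewrite of_realD -!inner_self.
by rewrite innerDl !innerDr h (inner_conj x y) h conj0 addr0 add0r.
Qed.

Definition cvH (u : nat -> H) x := null (fun n => nr (u n - x)).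

Lemma cvH_uniq u x y : cvH u x -> cvH u y -> x = y.
Proof.
move=> h h'; apply/eqP; rewrite -subr_eq0; apply/eqP/nr0_eq0/eqP.
rewrite eq_le nr_ge0 andbT; apply: null_cst; apply: null_le (nullD h h') => n.
by rewrite [nr (u n - x)]nrB; apply: le_trans (nrD _ _); rewrite addrA subrK.
Qed.
Lemma cvH_ext u v x : u =1 v -> cvH u x -> cvH v x.
Proof. by move=> uv; apply: null_le => n; rewrite uv. Qed.
Lemma cvH_cst x : cvH (fun=> x) x.
Proof. by move=> e e0; exists 0%N => n _; rewrite subrr nr0. Qed.
Lemma cvHD u v x y : cvH u x -> cvH v y -> cvH (fun n => u n + v n) (x + y).
Proof.
move=> h h'; apply: null_le (nullD h h') => n; apply: le_trans (nrD _ _).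
by rewrite addrACA opprD.
Qed.
Lemma cvHZ c u x : cvH u x -> cvH (fun n => c *: u n) (c *: x).
Proof.
move=> h; apply: null_le (nullM (modulus_ge0 c) h) => n.
by rewrite -nrZ scalerBr.
Qed.
Lemma cvH_inner u x y : cvH u x -> cvK (fun n => inner (u n) y) (inner x y).
Proof.
move=> h; apply: null_le (nullM (nr_ge0 y) h) => n.
by rewrite -innerBl mulrC cauchy_schwarz.
Qed.
Lemma cvH_nr_le u x (C : R) : cvH u x -> (forall n, nr (u n) <= C) -> nr x <= C.
Proof.
move=> h hC; apply: le_null h => n; rewrite -{1}[x](subrK (u n)) addrC nrB.
by apply: le_trans (nrD _ _) _; rewrite lerD2r.
Qed.

Lemma coord_le x i : modulus (x i) <= nr x.
Proof.
rewrite -(@ler_pXn2r _ 2) ?nnegrE ?modulus_ge0//.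
apply: le_trans (nr_sqr_sum x i.+1); rewrite big_ord_recr /= lerDr.
by apply: sumr_ge0 => j _; rewrite sqr_ge0.
Qed.

(** Total version of the constructor of [ell2]: it spares the proofs of square
    summability inside terms, and [mk_ell2E] requires them only where the value
    matters. *)
Definition mk_ell2 (x : nat -> K) : H := xget 0 [set y : H | ell2_seq y = x].

Lemma mk_ell2E (x : nat -> K) (C : R) :
  (forall n, \sum_(i < n) modulus (x i) ^+ 2 <= C) -> mk_ell2 x = x :> (nat -> K).
Proof. by move=> /ell2_of[y yx]; rewrite /mk_ell2; case: xgetP => [z _ //|/(_ y)]. Qed.

(** Defined for every sequence, since truncations are used to prove that a
    sequence is square summable. *)
Definition fin (p : nat) (x : nat -> K) : H := mk_ell2 (fun i => if (i < p)%N then x i else 0).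

Lemma finE p (x : nat -> K) i : fin p x i = if (i < p)%N then x i else 0.
Proof.
rewrite /fin (@mk_ell2E _ (\sum_(i < p) modulus (x i) ^+ 2))// => n.
rewrite -(big_mkord xpredT (fun i => modulus (if (i < p)%N then x i else 0) ^+ 2)).
rewrite -(big_mkord xpredT (fun i => modulus (x i) ^+ 2)).
have [np|/ltnW pn] := leqP n p.
  rewrite (big_cat_nat (leq0n n) np) /= big_nat [X in _ <= X + _]big_nat.
  rewrite (eq_bigr (fun i => modulus (x i) ^+ 2)); last first.
    by move=> j /andP[_ jp]; rewrite (leq_trans jp np).
  by rewrite lerDl sumr_ge0// => j _; rewrite sqr_ge0.
rewrite (big_cat_nat (leq0n p) pn) /= big_nat [X in _ + X <= _]big_nat.
rewrite [X in _ + X]big1 ?addr0; last first.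
  by move=> j /andP[pj _]; rewrite ltnNge pj /= modulus0 expr0n.
by rewrite [leRHS]big_nat; apply: ler_sum => j /andP[_ ->].
Qed.

Lemma nr_fin p (x : nat -> K) : nr (fin p x) ^+ 2 = \sum_(i < p) modulus (x i) ^+ 2.
Proof.
apply/eqP; rewrite eq_le; apply/andP; split.
  apply: nr_sqr_le => n; rewrite -(big_mkord xpredT (fun i => modulus (fin p x i) ^+ 2)).
  rewrite -(big_mkord xpredT (fun i => modulus (x i) ^+ 2)).
  have [np|/ltnW pn] := leqP n p.
    rewrite (big_cat_nat (leq0n n) np) /= big_nat [X in _ <= X + _]big_nat.
    rewrite (eq_bigr (fun i => modulus (x i) ^+ 2)); last first.
      by move=> i /andP[_ ip]; rewrite finE (leq_trans ip np).
    by rewrite lerDl sumr_ge0// => j _; rewrite sqr_ge0.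
  rewrite (big_cat_nat (leq0n p) pn) /= big_nat [X in _ + X <= _]big_nat.
  rewrite [X in _ + X]big1 ?addr0; last first.
    by move=> i /andP[pi _]; rewrite finE ltnNge pi /= modulus0 expr0n.
  by rewrite [leRHS]big_nat; apply: ler_sum => i /andP[_ ip]; rewrite finE ip.
apply: le_trans (nr_sqr_sum _ p); apply: ler_sum => i _.
by rewrite finE ltn_ord.
Qed.

Lemma finB p (x y : nat -> K) : fin p x - fin p y = fin p (fun i => x i - y i).
Proof.
apply: ell2_eq => i; rewrite ell2_sub !finE.
by case: ifP; rewrite ?subrr.
Qed.

Lemma fin_le p (x : H) : nr (fin p x) <= nr x.
Proof. by apply: nr_le_sqr => //; rewrite nr_fin nr_sqr_sum. Qed.

Lemma fin_bound x (C : R) : 0 <= C -> (forall p, nr (fin p x) <= C) -> nr x <= C.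
Proof.
move=> C0 h; apply: nr_le_sqr => //; apply: nr_sqr_le => n; rewrite -nr_fin.
by rewrite ler_pXn2r ?nnegrE.
Qed.

Definition delta (i : nat) : H := fin i.+1 (fun j => (j == i)%:R).

Lemma deltaE i j : delta i j = (j == i)%:R.
Proof. by rewrite /delta finE ltnS; case: ltngtP. Qed.

Lemma inner_delta x i : inner x (delta i) = x i.
Proof.
apply: cvK_uniq (inner_cvK _ _) _ => e e0; exists i.+1 => n hi.
rewrite (bigD1 (Ordinal hi)) //= deltaE eqxx conj1 mulr1.
rewrite big1 ?addr0 ?subrr ?modulus0// => j.
by rewrite -val_eqE /= deltaE => /negbTE ->; rewrite conj0 mulr0.
Qed.

Lemma nr_delta i : nr (delta i) = 1.
Proof.
by apply: nr_of_self => //; rewrite inner_delta deltaE eqxx expr1n of_real1.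
Qed.

Lemma fin_sum p (x : nat -> K) : fin p x = \sum_(i < p) x i *: delta i.
Proof.
apply: ell2_eq => j; rewrite finE ell2_sum; case: ifP => jp.
  rewrite (bigD1 (Ordinal jp)) //= ell2_scale deltaE eqxx mulr1.
  rewrite big1 ?addr0// => i; rewrite -val_eqE /= ell2_scale deltaE eq_sym.
  by move=> /negbTE ->; rewrite mulr0.
rewrite big1// => i _; rewrite ell2_scale deltaE.
by rewrite [_ == _](_ : _ = false) ?mulr0//; apply/negP => /eqP ji; rewrite ji ltn_ord in jp.
Qed.

Lemma nr_fin_le p (x : nat -> K) : nr (fin p x) <= \sum_(i < p) modulus (x i).
Proof.
rewrite fin_sum; apply: le_trans (nr_sum _ _ _) _.
by apply: ler_sum => i _; rewrite nrZ nr_delta mulr1.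
Qed.

(** The coordinates converge; the estimate of the differences passes to the limit
    on each truncation, with a bound that does not depend on the truncation. *)
Lemma cvH_complete (u : nat -> H) :
  (forall e : R, 0 < e -> exists N : nat, forall m n, (N <= m)%N -> (N <= n)%N ->
     nr (u m - u n) < e) -> exists x, cvH u x.
Proof.
move=> h.
have /choice[l hl] : forall i, exists l : K, cvK (fun n => u n i) l.
  move=> i; apply: cvK_complete => e /h[N hN]; exists N => m n Nm Nn.
  apply: le_lt_trans (hN m n Nm Nn).
  by rewrite -ell2_sub coord_le.
have key e N : 0 < e -> (forall m n, (N <= m)%N -> (N <= n)%N -> nr (u m - u n) < e) ->
    forall n, (N <= n)%N -> forall p, nr (fin p (fun i => u n i - l i)) <= e.
  move=> e0 hN n Nn p.
  have nb : null (fun m => \sum_(i < p) modulus (u m i - l i)).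
    by apply: null_sum => i; exact: hl.
  apply: le_null (null_shift N nb) => m.
  have -> : fin p (fun i => u n i - l i) =
      fin p (u n - u (m + N)%N) + fin p (fun i => u (m + N)%N i - l i).
    rewrite (_ : fin p (u n - u (m + N)%N) = fin p (fun i => u n i - u (m + N)%N i)).
      by rewrite -!finB addrA subrK.
    by congr fin; apply/funext => i; rewrite ell2_sub.
  apply: le_trans (nrD _ _) _; apply: lerD; last exact: nr_fin_le.
  by apply: le_trans (fin_le _ _) _; rewrite ltW// hN// leq_addl.
have [N hN] := h 1 ltr01.
have [d dE] : exists d : H, d = (fun i => u N i - l i) :> (nat -> K).
  apply: (@ell2_of _ 1) => n; rewrite -(nr_fin n (fun i => u N i - l i)).
  by rewrite expr_le1//; apply: key hN _ (leqnn _) _.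
exists (u N - d) => e e0; have e2 : 0 < e / 2 by rewrite divr_gt0.
have [M hM] := h _ e2; exists M => n Mn.
apply: le_lt_trans (_ : e / 2 < e); last lra.
apply: fin_bound => [|p]; first exact: ltW.
rewrite (_ : fin p _ = fin p (fun i => u n i - l i)); first exact: key hM _ Mn _.
congr fin; apply/funext => i.
by rewrite !ell2_sub dE; ring.
Qed.

Lemma fin_cvH x : cvH (fun n => fin n x) x.
Proof.
move=> e e0; have e2 : 0 < e / 2 by rewrite divr_gt0.
have e22 : 0 < (e / 2) ^+ 2 by rewrite exprn_gt0.
have [N hN] := series_tail (fun i => sqr_ge0 (modulus (x i))) (nr_sqr_sum x) e22.
exists N => n Nn; apply: le_lt_trans (_ : e / 2 < e); last lra.
apply: nr_le_sqr; first exact: ltW.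
apply: nr_sqr_le => m; have [mn|/ltnW nm] := leqP m n.
  rewrite big1 ?ltW// => i _; rewrite ell2_sub finE.
  by rewrite (leq_trans (ltn_ord i) mn) subrr modulus0 expr0n.
apply: le_trans (ltW (hN n m _)); last by rewrite Nn nm.
rewrite -(big_mkord xpredT (fun i => modulus ((fin n x - x) i) ^+ 2)).
rewrite (big_cat_nat (leq0n n) nm) /= big_nat big1 ?add0r; last first.
  move=> i /andP[_ hi]; rewrite ell2_sub finE hi.
  by rewrite subrr modulus0 expr0n.
rewrite big_nat [leRHS]big_nat; apply: ler_sum => i /andP[ni _].
by rewrite ell2_sub finE ltnNge ni /= sub0r modulusN.
Qed.

End Inner.
#[global] Hint Extern 0 (is_true (Order.le (@Algebra.zero _) (nr _))) =>
  solve [apply: nr_ge0] : core.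
#[global] Hint Extern 0 (is_true (Order.le (@Algebra.zero _) (modulus _))) =>
  solve [apply: modulus_ge0] : core.

(** * Operators given by two partially orthonormal families *)

Section Operators.
Context {R : realType} {k : scalar_kind}.
Local Notation K := (scalar_field R k).
Local Notation H := (ell2 R k).
Implicit Types (x y z : H) (e f g h : nat -> H) (a b c : nat -> K) (T S : H -> H).

(** Orthogonal families of vectors of norm one or zero. Allowing zero vectors
    spares the reindexing of the nonzero terms of a family. *)
Definition pon e : Prop :=
  (forall i j, i != j -> inner (e i) (e j) = 0) /\
  (forall i, nr (e i) = 1 \/ e i = 0).

Lemma pon_inner e i : pon e -> forall x, inner x (e i) * of_real (nr (e i) ^+ 2) = inner x (e i).
Proof.
move=> [_ /(_ i)[->|->]] x; first by rewrite expr1n of_real1 mulr1.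
by rewrite inner0r mul0r.
Qed.

Lemma pon_nr_le1 e i : pon e -> nr (e i) <= 1.
Proof. by move=> [_ /(_ i)[->|->]]; rewrite ?nr0. Qed.

Lemma pon_sum e c (s : seq nat) : pon e -> uniq s ->
  nr (\sum_(i <- s) c i *: e i) ^+ 2 <= \sum_(i <- s) modulus (c i) ^+ 2.
Proof.
move=> pe; elim: s => [|i s IH] /=; first by rewrite !big_nil nr0 expr0n.
move=> /andP[hi us]; rewrite !big_cons pythagoras.
  apply: lerD (IH us); rewrite nrZ exprMn ler_piMr ?sqr_ge0//.
  by rewrite expr_le1// pon_nr_le1.
rewrite inner_sumr big_seq big1// => j js.
rewrite innerZl innerZr pe.1 ?mulr0//.
by apply: contraNneq hi => ->.
Qed.

(** The vector [x - y], where [y] is the partial sum of the expansion of [x], is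
    orthogonal to [y]. *)
Lemma bessel e (s : seq nat) x : pon e -> uniq s ->
  \sum_(i <- s) modulus (inner x (e i)) ^+ 2 <= nr x ^+ 2.
Proof.
move=> pe us; set y := \sum_(i <- s) inner x (e i) *: e i.
have hj j : j \in s -> inner y (e j) = inner x (e j).
  move=> js; rewrite inner_suml (bigD1_seq j)//= innerZl inner_self pon_inner//.
  rewrite big1 ?addr0// => i ij.
  by rewrite innerZl pe.1 ?mulr0.
have hy : inner y y = of_real (\sum_(i <- s) modulus (inner x (e i)) ^+ 2).
  rewrite {2}/y inner_sumr of_real_sum big_seq [RHS]big_seq; apply: eq_bigr => j js.
  by rewrite innerZr hj// mulrC mul_conj.
have hxy : inner (x - y) y = 0.
  rewrite {2}/y inner_sumr big_seq big1// => j js.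
  by rewrite innerZr innerBl hj// subrr mulr0.
have := pythagoras hxy; rewrite subrK => ->.
move: hy; rewrite inner_self => /of_real_inj <-.
by rewrite lerDr sqr_ge0.
Qed.

Definition bounded_seq a (M : R) : Prop := forall i, modulus (a i) <= M.

Lemma bounded_seq_ge0 a M : bounded_seq a M -> 0 <= M.
Proof. by move=> /(_ 0%N); apply: le_trans; exact: modulus_ge0. Qed.

(** The operator [\sum_i a_i <., e_i> f_i]. Every compact operator has this form
    ([svd_op]); for bounded [a] and partially orthonormal families the series
    converges everywhere ([jop_cvH]), so the default value of [xget] is never
    taken. *)
Definition jop e f a x : H :=
  xget 0 [set y | cvH (fun n => \sum_(i < n) (a i * inner x (e i)) *: f i) y].

Section Jop.
Variables (e f : nat -> H).
Hypotheses (pe : pon e) (pf : pon f).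

Lemma jop_tail a M x (m n : nat) : bounded_seq a M ->
  nr (\sum_(m <= i < n) (a i * inner x (e i)) *: f i) ^+ 2 <=
  M ^+ 2 * \sum_(m <= i < n) modulus (inner x (e i)) ^+ 2.
Proof.
move=> aM; apply: le_trans (pon_sum _ pf (iota_uniq _ _)) _.
rewrite mulr_sumr; apply: ler_sum => i _.
by rewrite modulusM exprMn ler_wpM2r ?sqr_ge0// ler_pXn2r ?nnegrE ?modulus_ge0//
  (bounded_seq_ge0 aM).
Qed.

Lemma jop_cvH a M x : bounded_seq a M ->
  cvH (fun n => \sum_(i < n) (a i * inner x (e i)) *: f i) (jop e f a x).
Proof.
move=> aM; rewrite /jop; case: xgetP => [y _ //|] hno.
have [y hy] : exists y, cvH (fun n => \sum_(i < n) (a i * inner x (e i)) *: f i) y.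
  apply: cvH_complete => d d0.
  have M1 : 0 < M + 1 by rewrite ltr_wpDl ?(bounded_seq_ge0 aM).
  have d1 : 0 < (d / (M + 1)) ^+ 2 by rewrite exprn_gt0// divr_gt0.
  have hb n : \sum_(i < n) modulus (inner x (e i)) ^+ 2 <= nr x ^+ 2.
    by rewrite -(big_mkord xpredT (fun i => modulus (inner x (e i)) ^+ 2)) bessel// iota_uniq.
  have [N hN] := series_tail (fun i => sqr_ge0 (modulus (inner x (e i)))) hb d1.
  have main m n : (N <= m <= n)%N -> nr (\sum_(i < n) (a i * inner x (e i)) *: f i -
      \sum_(i < m) (a i * inner x (e i)) *: f i) < d.
    move=> /[dup] /andP[_ mn] /hN h.
    rewrite -!(big_mkord xpredT (fun i => (a i * inner x (e i)) *: f i)).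
    rewrite (big_cat_nat (leq0n m) mn) /= addrAC subrr add0r.
    rewrite -(@ltr_pXn2r _ 2) ?nnegrE ?(ltW d0)//.
    apply: le_lt_trans (jop_tail _ _ _ aM) _.
    apply: (@le_lt_trans _ _ ((M + 1) ^+ 2 * \sum_(m <= i < n) modulus (inner x (e i)) ^+ 2)).
      rewrite ler_wpM2r ?sumr_ge0// => [i _|]; first by rewrite sqr_ge0.
      by rewrite ler_pXn2r ?nnegrE ?(ltW M1) ?(bounded_seq_ge0 aM)// lerDl.
    by move: h; rewrite expr_div_n ltr_pdivlMr ?exprn_gt0// mulrC.
  exists N => m n Nm Nn; have [mn|nm] := leqP m n; first by rewrite nrB main ?Nm.
  by rewrite main// Nn ltnW.
by have := hno y.
Qed.

Lemma jop_linear a M : bounded_seq a M -> linear (jop e f a).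
Proof.
move=> aM c x y; apply: cvH_uniq (jop_cvH _ aM) _.
apply: cvH_ext (cvHD (cvHZ c (jop_cvH x aM)) (jop_cvH y aM)) => n.
rewrite scaler_sumr -big_split /=; apply: eq_bigr => i _.
transitivity ((c * (a i * inner x (e i)) + a i * inner y (e i)) *: f i).
  by rewrite scalerDl scalerA.
by rewrite innerDZl; congr (_ *: _); ring.
Qed.

Lemma nr_jop a M x : bounded_seq a M -> nr (jop e f a x) <= M * nr x.
Proof.
move=> aM; apply: cvH_nr_le (jop_cvH x aM) _ => n.
apply: nr_le_sqr; first by rewrite mulr_ge0 ?(bounded_seq_ge0 aM).
rewrite -(big_mkord xpredT (fun i => (a i * inner x (e i)) *: f i)).
apply: le_trans (jop_tail _ _ _ aM) _; rewrite exprMn ler_wpM2l ?sqr_ge0//.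
exact: bessel (iota_uniq _ _).
Qed.

Lemma jop_inner a M x y : bounded_seq a M ->
  cvK (fun n => \sum_(i < n) a i * inner x (e i) * inner (f i) y) (inner (jop e f a x) y).
Proof.
move=> aM; apply: cvK_ext (cvH_inner y (jop_cvH x aM)) => n.
by rewrite inner_suml; apply: eq_bigr => i _; rewrite innerZl.
Qed.

Lemma jop_lin a b M N x : bounded_seq a M -> bounded_seq b N -> forall d : K,
  jop e f (fun i => d * a i + b i) x = d *: jop e f a x + jop e f b x.
Proof.
move=> aM bN d.
have h : bounded_seq (fun i => d * a i + b i) (modulus d * M + N).
  move=> i; apply: le_trans (ler_modulusD _ _) _.
  by rewrite modulusM lerD ?ler_wpM2l ?modulus_ge0.
apply: cvH_uniq (jop_cvH x h) _.
apply: cvH_ext (cvHD (cvHZ d (jop_cvH x aM)) (jop_cvH x bN)) => n.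
rewrite scaler_sumr -big_split /=; apply: eq_bigr => i _.
transitivity ((d * (a i * inner x (e i)) + b i * inner x (e i)) *: f i).
  by rewrite scalerDl scalerA.
by congr (_ *: _); ring.
Qed.

Lemma jop_fin a p x : (forall i, (p <= i)%N -> a i = 0) ->
  jop e f a x = \sum_(i < p) (a i * inner x (e i)) *: f i.
Proof.
move=> ap; have aM : bounded_seq a (\sum_(i < p) modulus (a i)).
  move=> i; have [ip|pi] := ltnP i p.
    rewrite (bigD1 (Ordinal ip))//= lerDl.
    by apply: sumr_ge0 => j _; exact: modulus_ge0.
  by rewrite ap// modulus0; apply: sumr_ge0 => j _; exact: modulus_ge0.
apply: cvH_uniq (jop_cvH x aM) _ => d d0; exists p => n pn.
rewrite -!(big_mkord xpredT (fun i => (a i * inner x (e i)) *: f i)).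
rewrite (big_cat_nat (leq0n p) pn) /= addrAC subrr add0r.
by rewrite big_nat big1 ?nr0// => i /andP[/ap -> _]; rewrite mul0r scale0r.
Qed.

Lemma jop_basis a M j : bounded_seq a M -> jop e f a (e j) = (a j * of_real (nr (e j) ^+ 2)) *: f j.
Proof.
move=> aM; apply: cvH_uniq (jop_cvH _ aM) _ => d d0; exists j.+1 => n jn.
rewrite (bigD1 (Ordinal jn))//= inner_self big1 ?addr0 ?subrr ?nr0// => i.
by rewrite -val_eqE /= => ij; rewrite pe.1 1?eq_sym// mulr0 scale0r.
Qed.

Lemma jop_eq0 a x : (forall i, a i * inner x (e i) = 0) -> jop e f a x = 0.
Proof.
move=> h; rewrite /jop; case: xgetP => [y _ hy|//].
apply: cvH_uniq hy _; apply: cvH_ext (cvH_cst 0) => n.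
by rewrite big1// => i _; rewrite h scale0r.
Qed.

End Jop.

Lemma jop_adj e f a M x y : pon e -> pon f -> bounded_seq a M ->
  inner (jop e f a x) y = inner x (jop f e (fun i => scalar_conj (a i)) y).
Proof.
move=> pe pf aM.
have aM' : bounded_seq (fun i => scalar_conj (a i)) M by move=> i; rewrite modulus_conj.
apply: cvK_uniq (jop_inner pe pf x y aM) _.
rewrite inner_conj; apply: cvK_ext (cvK_conj (jop_inner pf pe y x aM')) => n.
rewrite conj_sum; apply: eq_bigr => i _.
by rewrite !conjM conjK -!inner_conj; ring.
Qed.

Lemma jop_adj_ext e f a b M x y : pon e -> pon f -> bounded_seq a M ->
  (forall i, b i = scalar_conj (a i)) ->
  inner (jop e f a x) y = inner x (jop f e b y).
Proof. by move=> pe pf aM /funext ->; exact: jop_adj aM. Qed.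

(** * Bounded operators and adjoints *)
Definition bounded_op T : Prop := exists C : R, forall x, nr (T x) <= C * nr x.

Lemma bounded_opP T : bounded_op T -> exists2 C : R, 0 <= C & forall x, nr (T x) <= C * nr x.
Proof.
move=> [C h]; exists (Num.max C 0); first by rewrite le_max lexx orbT.
by move=> x; apply: le_trans (h x) _; rewrite ler_wpM2r// le_max lexx.
Qed.

Section LinearOp.
Variable T : H -> H.
Hypothesis lT : linear T.
Lemma lin0 : T 0 = 0.
Proof. by have := lT (-1) 0 0; rewrite scaler0 addr0 => ->; rewrite scaleN1r addNr. Qed.
Lemma linD x y : T (x + y) = T x + T y.
Proof. by rewrite -[x]scale1r lT !scale1r. Qed.
Lemma linZ (c : K) x : T (c *: x) = c *: T x.
Proof. by rewrite -[c *: x]addr0 lT lin0 addr0. Qed.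
Lemma linN x : T (- x) = - T x.
Proof. by rewrite -scaleN1r linZ scaleN1r. Qed.
Lemma linB x y : T (x - y) = T x - T y.
Proof. by rewrite linD linN. Qed.
Lemma lin_sum (I : Type) (r : seq I) (P : pred I) (F : I -> H) :
  T (\sum_(i <- r | P i) F i) = \sum_(i <- r | P i) T (F i).
Proof. exact: (big_morph T linD lin0). Qed.
Lemma bounded_cvH u x : bounded_op T -> cvH u x -> cvH (fun n => T (u n)) (T x).
Proof.
move=> /bounded_opP[C C0 hC] h; apply: null_le (nullM C0 h) => n.
by rewrite -linB.
Qed.
End LinearOp.

Lemma adj_uniq T S S' : is_adjoint T S -> is_adjoint T S' -> S = S'.
Proof.
move=> h h'; apply/funext => y; apply: inner_inj => z.
by rewrite inner_conj -h h' -inner_conj.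
Qed.

Lemma adj_sym T S : is_adjoint T S -> is_adjoint S T.
Proof. by move=> h x y; rewrite inner_conj -h -inner_conj. Qed.

Lemma adj_linear T S : is_adjoint T S -> linear S.
Proof.
move=> h c x y; apply: inner_inj => z.
by rewrite innerDZl !(adj_sym h) innerDZl.
Qed.

Lemma adj_bounded T S C : 0 <= C -> (forall x, nr (T x) <= C * nr x) -> is_adjoint T S ->
  forall x, nr (S x) <= C * nr x.
Proof.
move=> C0 hC h x; have [->|n0] := eqVneq (nr (S x)) 0; first by rewrite mulr_ge0.
have n1 : 0 < nr (S x) by rewrite lt_def n0 nr_ge0.
rewrite -(ler_pM2l n1) -expr2.
have -> : nr (S x) ^+ 2 = modulus (inner (T (S x)) x).
  by rewrite h inner_self modulus_of_real ger0_norm// sqr_ge0.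
apply: le_trans (cauchy_schwarz _ _) _.
by apply: le_trans (ler_wpM2r (nr_ge0 x) (hC _)) _; rewrite mulrAC mulrC mulrA.
Qed.

(** The coordinates of the adjoint at [y] have to be the conjugates of the numbers
    [<T (delta i), y>]. The bound on [T] makes them square summable. *)
Lemma adj_exists T : linear T -> bounded_op T -> exists S, is_adjoint T S.
Proof.
move=> lT bT; have [C C0 hC] := bounded_opP bT.
have /choice[S hS] : forall y, exists s : H, s = (fun i =>
  scalar_conj (inner (T (delta i)) y)) :> (nat -> K).
  move=> y; apply: (@ell2_of _ _ _ ((C * nr y) ^+ 2)) => n.
  set c := fun i => scalar_conj (inner (T (delta i)) y).
  have -> : \sum_(i < n) modulus (scalar_conj (inner (T (delta i)) y)) ^+ 2 = nr (fin n c) ^+ 2.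
    by rewrite nr_fin.
  have [->|n0] := eqVneq (nr (fin n c)) 0; first by rewrite expr0n sqr_ge0.
  have n1 : 0 < nr (fin n c) by rewrite lt_def n0 nr_ge0.
  rewrite ler_pXn2r ?nnegrE ?mulr_ge0// -(ler_pM2l n1) -expr2.
  have -> : nr (fin n c) ^+ 2 = modulus (inner (T (fin n c)) y).
    rewrite fin_sum lin_sum// inner_suml -fin_sum nr_fin.
    rewrite -[LHS]ger0_norm; last by apply: sumr_ge0 => i _; rewrite sqr_ge0.
    rewrite -(@modulus_of_real R k) of_real_sum; congr modulus; apply: eq_bigr => i _.
    by rewrite linZ// innerZl -mul_conj /c conjK.
  apply: le_trans (cauchy_schwarz _ _) _.
  apply: le_trans (ler_wpM2r (nr_ge0 y) (hC _)) _.
  by rewrite mulrAC mulrC mulrA.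
exists S => x y.
apply: cvK_uniq (cvH_inner y (bounded_cvH lT bT (fin_cvH x))) _.
apply: cvK_ext (inner_cvK x (S y)) => n.
rewrite fin_sum lin_sum// inner_suml; apply: eq_bigr => i _.
by rewrite linZ// innerZl hS conjK.
Qed.

End Operators.

(** * Compactness and coordinate tails *)

Section Compact.
Context {R : realType} {k : scalar_kind}.
Local Notation K := (scalar_field R k).
Local Notation H := (ell2 R k).
Implicit Types (x y z : H) (T S : H -> H).

Lemma ltr_of_real (a b : R) : (of_real a < of_real b :> K) = (a < b).
Proof.
by rewrite !lt_def ler_of_real; congr (~~ _ && _); apply/eqP/eqP => [/of_real_inj|->].
Qed.

Lemma nbhs_nr x (e : R) : 0 < e -> nbhs x [set y | nr (y - x) < e].
Proof.
move=> e0; apply/nbhs_normP; exists (of_real e : K).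
  by rewrite /= -(of_real0 (k := k)) ltr_of_real.
move=> y hy; have {hy} : of_real (nr (x - y)) < of_real e :> K := hy.
by rewrite ltr_of_real nrB.
Qed.

Lemma nbhs_nrP x (P : set H) : nbhs x P ->
  exists2 e : R, 0 < e & forall y, nr (y - x) < e -> P y.
Proof.
move=> /nbhs_normP[e /= e0 h]; exists (modulus e).
  by rewrite -(@ltr_of_real 0) of_real0 -normr_of_real gtr0_norm.
move=> y hy; apply: h; suff : of_real (nr (x - y)) < e by [].
by rewrite -(gtr0_norm e0) normr_of_real ltr_of_real nrB.
Qed.

Lemma closure_nr (A : set H) y (e : R) : 0 < e -> closure A y ->
  exists2 z, A z & nr (z - y) < e.
Proof. by move=> e0 /(_ _ (nbhs_nr y e0))[z [Az hz]]; exists z. Qed.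

(** A bounded subset of [ell2] is relatively compact exactly when its coordinate
    tails are uniformly small; this is the condition on tails for the image of the
    unit ball. *)
Definition small_tails T : Prop :=
  forall e : R, 0 < e -> exists m, forall x, nr x <= 1 -> nr (T x - fin m (T x)) <= e.

Lemma fin_add m x y : fin m (x + y) = fin m x + fin m y.
Proof.
by apply: ell2_eq => i; rewrite ell2_add !finE; case: ifP; rewrite ?addr0.
Qed.

Lemma fin_scale m (c : K) x : fin m (c *: x) = c *: fin m x.
Proof.
by apply: ell2_eq => i; rewrite ell2_scale !finE; case: ifP; rewrite ?mulr0.
Qed.

Lemma fin_linear m : linear (fun x : H => fin m x).
Proof. by move=> c x y; rewrite fin_add fin_scale. Qed.

Lemma tail_le m x : nr (x - fin m x) <= nr x.
Proof.
apply: nr_le_sqr => //; apply: nr_sqr_le => n; apply: le_trans (nr_sqr_sum x n).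
apply: ler_sum => i _; rewrite ell2_sub finE.
by case: ifP; rewrite ?subr0// subrr modulus0 expr0n sqr_ge0.
Qed.

Lemma tail_triangle m x y : nr (x - fin m x) <= nr (y - fin m y) + nr (y - x).
Proof.
have -> : x - fin m x = (y - fin m y) - ((y - x) - fin m (y - x)).
  by rewrite (linB (fin_linear m)) !opprB !addrA; apply/eqP; rewrite -subr_eq0;
    apply/eqP/ell2_eq => i; rewrite !(ell2_add, ell2_opp) ell2_0; ring.
apply: le_trans (nrD _ _) _; rewrite nrN lerD2l; exact: tail_le.
Qed.

Definition unit_image T : set H := T @` [set x | `|x| <= 1].

Lemma unit_imageP T y : unit_image T y <-> exists2 x, nr x <= 1 & T x = y.
Proof.
split=> -[x hx <-]; exists x => //.
  have {hx} : of_real (nr x) <= 1 :> K := hx; by rewrite -of_real1 ler_of_real.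
suff : of_real (nr x) <= 1 :> K by []; by rewrite -of_real1 ler_of_real.
Qed.

Lemma compact_small_tails T : linear T -> compact (closure (unit_image T)) ->
  bounded_op T /\ small_tails T.
Proof.
move=> lT /compact_near_coveringP cT; split.
  have [|N _ hN] := cT nat \oo (fun n y => nr y < n%:R).
    move=> y _; exists ([set z | nr (z - y) < 1], [set n | (Num.truncn (nr y + 1)).+1 <= n]%N).
      by split => /=; [exact: nbhs_nr|exists (Num.truncn (nr y + 1)).+1].
    move=> [z n] [/= hz hn]; rewrite -[z](subrK y).
    apply: le_lt_trans (nrD _ _) _; apply: lt_le_trans (_ : (Num.truncn (nr y + 1)).+1%:R <= _);
      last by rewrite ler_nat.
    apply: lt_trans (truncnS_gt _); lra.
  exists N%:R => x; have [x0|n0] := eqVneq (nr x) 0.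
    by rewrite x0 mulr0 (nr0_eq0 x0) lin0// nr0.
  have n1 : 0 < nr x by rewrite lt_def n0 nr_ge0.
  have := hN N (leqnn _) (T (of_real (nr x)^-1 *: x)).
  rewrite linZ// nrZ modulus_of_real ger0_norm ?invr_ge0//.
  rewrite [X in X < _]mulrC ltr_pdivrMr// => h; apply/ltW/h.
  apply: subset_closure; apply/unit_imageP.
  exists (of_real (nr x)^-1 *: x); rewrite ?linZ// nrZ modulus_of_real.
  by rewrite ger0_norm ?invr_ge0// mulVf.
move=> e e0; have e2 : 0 < e / 2 by rewrite divr_gt0.
have [|N _ hN] := cT nat \oo (fun m y => nr (y - fin m y) < e).
  move=> y _; have [N hN] := fin_cvH y e2.
  exists ([set z | nr (z - y) < e / 2], [set n | N <= n]%N).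
    by split => /=; [exact: nbhs_nr|exists N].
  move=> [z n] [/= hz hn].
  apply: le_lt_trans (tail_triangle n z y) _; rewrite [nr (y - fin n y)]nrB.
  rewrite nrB in hz; have := hN n hn; lra.
exists N => x x1; apply/ltW/(hN N (leqnn _)); apply: subset_closure.
by apply/unit_imageP; exists x.
Qed.

(** A bounded interval is compact, and an ultrafilter converges to each of its
    cluster points. *)
Lemma ultra_real_cluster (X : Type) (F : set_system X) (g : X -> R) (C : R) :
  UltraFilter F -> F [set y | `|g y| <= C] ->
  exists a, forall e, 0 < e -> F [set y | `|g y - a| < e].
Proof.
move=> uF hC; have cC : compact `[- C, C] by exact: segment_compact.
have pF : ProperFilter F by exact: ultra_proper.
have [|a [_ ha]] := cC (g @ F) _.
  rewrite /nbhs /=; apply: filterS hC => y /=; by rewrite ler_norml in_itv.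
exists a => e e0.
have [//|hn] := @in_ultra_setVsetC _ F [set y | `|g y - a| < e] uF.
have [] := ha (~` [set r | `|r - a| < e]) [set r | `|r - a| < e].
- exact: hn.
- apply/nbhs_ballP; exists e => // r; by rewrite /ball /= distrC.
by move=> r [].
Qed.

(** An ultrafilter on the closure of the image of the unit ball converges in each
    coordinate, because the scalars are locally compact; uniformly small tails
    turn this into convergence in norm. *)
Lemma small_tails_compact T : linear T -> bounded_op T -> small_tails T ->
  compact (closure (unit_image T)).
Proof.
move=> lT /bounded_opP[C C0 hC] sT; rewrite compact_ultra => F uF FA.
have pF : ProperFilter F by exact: ultra_proper.
have clC y : closure (unit_image T) y -> nr y <= C.
  move=> cy; apply/ler_addgt0Pr => e e0.
  have [z /unit_imageP[x x1 <-] hz] := closure_nr e0 cy.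
  rewrite -[y](subrK (T x)) addrC; apply: le_trans (nrD _ _) _.
  rewrite nrB; apply: lerD (ltW hz); apply: le_trans (hC _) _.
  by rewrite ler_piMr.
have clT e : 0 < e -> exists m, forall y, closure (unit_image T) y -> nr (y - fin m y) <= e.
  move=> e0; have [m hm] := sT _ e0; exists m => y cy.
  apply/ler_addgt0Pr => d d0; have [z /unit_imageP[x x1 <-] hz] := closure_nr d0 cy.
  apply: le_trans (tail_triangle m y (T x)) _.
  by apply: lerD; [exact: hm|exact: ltW].
have lim (g : K -> R) : (forall c, `|g c| <= modulus c) ->
  forall i, exists a, forall e, 0 < e -> F [set y : H | `|g (y i) - a| < e].
  move=> hg i.
  have hgC : F [set y : H | `|g (y i)| <= C].
    by apply: filterS FA => y cy; apply: le_trans (hg _) (le_trans (coord_le _ _) (clC _ cy)).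
  have h := @ultra_real_cluster H F (fun y => g (y i)) C uF.
  exact: h hgC.
have /choice[a ha] := lim _ (@re_le R k).
have /choice[b hb] := lim _ (@im_le R k).
pose l i : K := of_real (a i) + ii * of_real (b i).
have hl i e : 0 < e -> F [set y : H | modulus (y i - l i) < e].
  move=> e0; have e2 : 0 < e / 2 by rewrite divr_gt0.
  apply: filterS (filterI (ha i _ e2) (hb i _ e2)) => y [/= h1 h2].
  have -> : y i - l i = of_real (re (y i) - a i) + ii * of_real (im (y i) - b i).
    by rewrite {1}[y i]reimE /l !of_realD !of_realN; ring.
  by apply: le_lt_trans (modulus_reim _ _) _; rewrite (splitr e) ltrD.
have hsum n e : 0 < e -> F [set y : H | nr (fin n (fun i => y i - l i)) < e].
  move=> e0; have en : 0 < e / n.+1%:R by rewrite divr_gt0.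
  have : F [set y : H | forall i, (i < n)%N -> modulus (y i - l i) < e / n.+1%:R].
    move: (e / n.+1%:R) en => d d0; elim: n => [|n IH]; first by apply: filterS filterT => y.
    apply: filterS (filterI IH (hl n d d0)) => y [/= h1 h2] i.
    by rewrite ltnS leq_eqVlt => /predU1P[->|/h1].
  apply: filterS => y hy; apply: le_lt_trans (nr_fin_le _ _) _.
  apply: (@le_lt_trans _ _ (\sum_(i < n) e / n.+1%:R)).
    by apply: ler_sum => i _; rewrite ltW// hy.
  rewrite sumr_const card_ord -[ltLHS]mulr_natl mulrA ltr_pdivrMr// mulrC ltr_pM2l//.
  by rewrite ltr_nat.
have FE (A B : set H) : F A -> F B -> exists y, A y /\ B y.
  by move=> A' B'; have [y [? ?]] := @filter_ex _ F pF _ (filterI A' B'); exists y.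
have [w wE] : exists w : H, w = l :> (nat -> K).
  apply: (@ell2_of _ _ _ ((C + 1) ^+ 2)) => n; rewrite -nr_fin.
  rewrite ler_pXn2r ?nnegrE ?addr_ge0//.
  have [y [/= cy hy]] := FE _ _ FA (hsum n 1 ltr01).
  have -> : fin n l = fin n y - fin n (fun i => y i - l i).
    by rewrite -finB opprB addrCA subrr addr0.
  apply: le_trans (nrD _ _) _; rewrite nrN lerD ?(ltW hy)//.
  exact: le_trans (fin_le _ _) (clC _ cy).
have Fw : F --> w.
  move=> P /nbhs_nrP[e e0 hP].
  have e4 : 0 < e / 4 by rewrite divr_gt0.
  have [m hm] := clT _ e4.
  have wm : nr (w - fin m w) <= e / 4 + e / 4.
    apply: fin_bound => [|p]; first by rewrite addr_ge0// ltW.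
    have [y [/= cy hy]] := FE _ _ FA (hsum p _ e4).
    have h1 : nr (fin p (y - w)) <= e / 4.
      rewrite (_ : fin p _ = fin p (fun i => y i - l i)) ?ltW//.
      by congr fin; apply/funext => i; rewrite ell2_sub wE.
    have -> : fin p (w - fin m w) = fin p (y - fin m y) - (fin p (y - w) - fin m (fin p (y - w))).
      apply: ell2_eq => i; rewrite !(ell2_sub,finE,ell2_opp,ell2_add).
      by case: ifP => _; case: ifP => _; ring.
    apply: le_trans (nrD _ _) _; rewrite nrN; apply: lerD.
      exact: le_trans (fin_le _ _) (hm _ cy).
    exact: le_trans (tail_le _ _) h1.
  apply: filterS (filterI FA (hsum m _ e4)) => y [/= cy hy]; apply: hP.
  have -> : y - w = (y - fin m y) + (fin m (fun i => y i - l i) - (w - fin m w)).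
    apply: ell2_eq => i; rewrite !(ell2_sub,finE,ell2_opp,ell2_add) wE.
    by case: ifP => _; ring.
  apply: le_lt_trans (nrD _ _) _; have := nrD (fin m (fun i => y i - l i)) (- (w - fin m w)).
  rewrite nrN; have := hm _ cy; move: hy wm; lra.
exists w; split => //.
apply: (@closed_cvg _ _ F _ id (closure (unit_image T))) => //; exact: closed_closure.
Qed.

Lemma compactP T : compact_operator T <-> [/\ linear T, bounded_op T & small_tails T].
Proof.
split=> [[lT cT]|[lT bT sT]]; last by split; last exact: small_tails_compact.
by have [] := compact_small_tails lT cT.
Qed.

End Compact.

(** * Compact operators *)

Section SVD.
Context {R : realType} {k : scalar_kind}.
Local Notation K := (scalar_field R k).
Local Notation H := (ell2 R k).
Implicit Types (x y z : H) (e f g h : nat -> H) (a b c : nat -> K) (T S : H -> H).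

Lemma tail_mono m n x : (m <= n)%N -> nr (x - fin n x) <= nr (x - fin m x).
Proof.
move=> mn; have -> : x - fin n x = (x - fin m x) - fin n (x - fin m x).
  apply: ell2_eq => i; rewrite !(ell2_sub, finE, ell2_add, ell2_opp).
  case: (ltnP i m) => hm; case: (ltnP i n) => hn; try ring.
  by have := leq_trans (leq_trans hm mn) hn; rewrite ltnn.
exact: tail_le.
Qed.

Lemma compactD T S (c : K) : compact_operator T -> compact_operator S ->
  compact_operator (c *: T + S).
Proof.
move=> /compactP[lT /bounded_opP[C C0 hC] sT] /compactP[lS /bounded_opP[D D0 hD] sS].
apply/compactP; split.
- move=> d x y; rewrite -[LHS]/(c *: T (d *: x + y) + S (d *: x + y)).
  rewrite -[(c *: T + S) x]/(c *: T x + S x) -[(c *: T + S) y]/(c *: T y + S y).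
  by rewrite lT lS !scalerDr !scalerA mulrC addrACA.
- exists (modulus c * C + D) => x; rewrite -[(c *: T + S) x]/(c *: T x + S x).
  apply: le_trans (nrD _ _) _; rewrite mulrDl nrZ -mulrA.
  apply: lerD; [exact: ler_wpM2l|exact: hD].
move=> d d0; have d1 : 0 < d / (2 * (modulus c + 1)).
  by rewrite divr_gt0 ?mulr_gt0 ?ltr_wpDl.
have d2 : 0 < d / 2 by rewrite divr_gt0.
have [m hm] := sT _ d1; have [n hn] := sS _ d2.
exists (maxn m n) => x x1; rewrite -[(c *: T + S) x]/(c *: T x + S x).
rewrite fin_add fin_scale opprD addrACA -scalerBr.
apply: le_trans (nrD _ _) _; rewrite nrZ.
have h1 := le_trans (tail_mono (T x) (leq_maxl m n)) (hm x x1).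
have h2 := le_trans (tail_mono (S x) (leq_maxr m n)) (hn x x1).
have h3 : modulus c * nr (T x - fin (maxn m n) (T x)) <= d / 2.
  apply: le_trans (ler_wpM2l (modulus_ge0 c) h1) _.
  have c1 : 0 < modulus c + 1 by rewrite ltr_wpDl.
  have -> : modulus c * (d / (2 * (modulus c + 1))) = (d / 2) * (modulus c / (modulus c + 1)).
    by field; rewrite lt0r_neq0.
  by rewrite ler_piMr ?(ltW d2)// ler_pdivrMr// mul1r lerDl.
by rewrite (splitr d); apply: lerD.
Qed.

(** Tails of [T x] are bounded by tails of [Tn n x] plus the distance, so
    [small_tails] survives uniform limits. *)
Lemma compact_limit (Tn : nat -> H -> H) T :
  linear T -> (forall n, compact_operator (Tn n)) ->
  (forall d : R, 0 < d -> exists n, forall x, nr (Tn n x - T x) <= d * nr x) ->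
  compact_operator T.
Proof.
move=> lT cT h; apply/compactP; split => //.
  have [n hn] := h 1 ltr01; have /compactP[_ /bounded_opP[C C0 hC] _] := cT n.
  exists (C + 1) => x; rewrite -[T x](subrK (Tn n x)) addrC.
  apply: le_trans (nrD _ _) _; rewrite mulrDl nrB; exact: lerD.
move=> d d0; have d2 : 0 < d / 2 by rewrite divr_gt0.
have [n hn] := h _ d2; have /compactP[_ _ sT] := cT n.
have [m hm] := sT _ d2; exists m => x x1.
apply: le_trans (tail_triangle m (T x) (Tn n x)) _.
have := hm x x1; have := hn x; have : d / 2 * nr x <= d / 2 by rewrite ler_piMr// ltW.
lra.
Qed.

(** The operators with finitely many nonzero coefficients have small tails, and
    they approximate [jop e f a] uniformly on the unit ball. *)
Lemma jop_compact e f a : pon e -> pon f -> null (fun i => modulus (a i)) ->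
  compact_operator (jop e f a).
Proof.
move=> pe pf na.
have [M aM] : exists M, bounded_seq a M.
  have [N hN] := na 1 ltr01; exists (1 + \sum_(i < N) modulus (a i)) => i.
  have [iN|Ni] := ltnP i N.
    rewrite (bigD1 (Ordinal iN))//= addrCA lerDl addr_ge0//.
    by apply: sumr_ge0 => j _.
  by apply: le_trans (ltW (hN i Ni)) _; rewrite lerDl; apply: sumr_ge0.
have bf n : bounded_seq (fun i => if (i < n)%N then a i else 0) M.
  by move=> i; case: ifP => _; rewrite ?modulus0 ?(bounded_seq_ge0 aM).
apply: (@compact_limit (fun n => jop e f (fun i => if (i < n)%N then a i else 0))).
- exact: jop_linear aM.
- move=> n; apply/compactP; split; [exact: jop_linear (bf n)|by exists M => x; apply: nr_jop|].
  move=> d d0.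
  have nf : null (fun m => \sum_(i < n) modulus (a i) * nr (fin m (f i) - f i)).
    by apply: null_sum => i; apply: nullM => //; exact: fin_cvH.
  have [m hm] := nf d d0; exists m => x x1.
  rewrite (jop_fin pe pf (p := n)); last by move=> i; case: ltnP.
  rewrite (lin_sum (fin_linear m)) -sumrB; apply: le_trans (nr_sum _ _ _) _.
  apply: le_trans (ltW (hm m (leqnn _))); apply: ler_sum => i _.
  rewrite fin_scale -scalerBr nrZ nrB ltn_ord; apply: ler_wpM2r => //.
  rewrite modulusM ler_piMr//; apply: le_trans (cauchy_schwarz _ _) _.
  by rewrite mulr_ile1// pon_nr_le1.
move=> d d0; have [N hN] := na d d0; exists N => x.
have hb : bounded_seq (fun i => - 1 * a i + (if (i < N)%N then a i else 0)) d.
  move=> i; case: ltnP => [_|Ni]; first by rewrite mulN1r addNr modulus0 ltW.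
  by rewrite mulN1r addr0 modulusN ltW// hN.
have := nr_jop pe pf x hb; rewrite (jop_lin pe pf x aM (bf N)).
by rewrite scaleN1r addrC.
Qed.

(** * Singular value decomposition *)

Definition perp e x : Prop := forall i, inner x (e i) = 0.

Definition proj n e x : H := x - \sum_(i < n) inner x (e i) *: e i.

Section Proj.
Variables (e : nat -> H) (n : nat).
Hypotheses (pe : pon e) (en : forall i, (n <= i)%N -> e i = 0).

Lemma perp_proj x : perp e (proj n e x).
Proof.
move=> j; have [jn|nj] := ltnP j n; last by rewrite en ?inner0r.
rewrite innerBl inner_suml (bigD1 (Ordinal jn))//= innerZl inner_self pon_inner//.
rewrite big1 ?addr0 ?subrr// => i; rewrite -val_eqE /= => ij.
by rewrite innerZl pe.1 ?mulr0.
Qed.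

Lemma proj_inner x y : perp e y -> inner x y = inner (proj n e x) y.
Proof.
move=> py; rewrite innerBl inner_suml big1 ?subr0// => i _.
by rewrite innerZl (inner_conj y) py conj0 mulr0.
Qed.

Lemma nr_proj x : nr (proj n e x) <= nr x.
Proof.
set s := \sum_(i < n) inner x (e i) *: e i.
have h : inner (proj n e x) s = 0.
  by rewrite inner_sumr big1// => i _; rewrite innerZr perp_proj mulr0.
apply: nr_le_sqr => //; have := pythagoras h; rewrite subrK => ->.
by rewrite lerDl sqr_ge0.
Qed.

(** Otherwise each of [n.+1] coordinate vectors is a combination of the [n]
    vectors [e i], and counting squared coefficients gives [n.+1 <= n]. *)
Lemma unit_perp : exists2 v, nr v = 1 & perp e v.
Proof.
have [i hi] : exists i, nr (proj n e (delta i)) != 0.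
  apply: contrapT => hno.
  have h1 (i : nat) : 1 <= \sum_(j < n) modulus (inner (delta i) (e j)) ^+ 2.
    have h0 : proj n e (delta i) = 0.
      by apply: nr0_eq0; apply/eqP; apply: contrapT => h; apply: hno; exists i; apply/negP.
    have -> : 1 = nr (delta i : H) ^+ 2 by rewrite nr_delta expr1n.
    have {1}-> : delta i = \sum_(0 <= j < n) inner (delta i) (e j) *: e j.
      by apply/eqP; rewrite -subr_eq0 big_mkord -/(proj n e _) h0.
    by rewrite -(big_mkord xpredT (fun j =>
      modulus (inner (delta i) (e j)) ^+ 2)) pon_sum// iota_uniq.
  have : n.+1%:R <= n%:R :> R; last by rewrite ler_nat ltnn.
  apply: (@le_trans _ _ (\sum_(i < n.+1) \sum_(j < n) modulus (inner (delta i) (e j)) ^+ 2)).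
    by rewrite -[n.+1 in leLHS]card_ord -sumr_const; apply: ler_sum => i _.
  rewrite exchange_big /= -[n in leRHS]card_ord -sumr_const; apply: ler_sum => j _.
  apply: le_trans (_ : nr (e j) ^+ 2 <= 1); last by rewrite expr_le1// pon_nr_le1.
  apply: le_trans (nr_sqr_sum _ n.+1); apply: ler_sum => i _.
  by rewrite inner_conj modulus_conj inner_delta.
have hi' : 0 < nr (proj n e (delta i)) by rewrite lt_def hi nr_ge0.
exists (of_real (nr (proj n e (delta i)))^-1 *: proj n e (delta i)).
  by rewrite nrZ modulus_of_real ger0_norm ?invr_ge0// mulVf.
by move=> j; rewrite innerZl perp_proj mulr0.
Qed.

Lemma nr_continuous : continuous (nr : H -> R).
Proof.
move=> x B /nbhs_ballP[d /= d0 hB].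
apply: (@filterS _ _ (nbhs_filter x) _ _ _ (nbhs_nr x d0)) => y /= hy; apply: hB.
have h1 := nrD (x - y) y; have h2 := nrD (y - x) x.
rewrite !subrK in h1 h2; rewrite nrB in h1.
rewrite /ball /= ltr_norml; apply/andP; split; lra.
Qed.

(** On the closure of the image of the unit ball of the orthogonal complement of
    [e], which is compact, the norm attains its maximum at some [y]. This [y] need
    not be a value of [T]; but with [S] the adjoint of [T], the normalized
    projection of [S y] to the orthogonal complement is a vector at which [T]
    attains that maximum. *)
Lemma norm_attained_perp T : compact_operator T -> exists v, [/\ nr v = 1, perp e v &
  forall x, perp e x -> nr (T x) <= nr (T v) * nr x].
Proof.
move=> [lT cT].
have /compactP[_ /bounded_opP[C C0 hC] _] : compact_operator T by [].
pose A := T @` [set x | nr x <= 1 /\ perp e x].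
have cA : compact (closure A).
  apply: subclosed_compact cT _; first exact: closed_closure.
  apply: closureS => _ [x [x1 _] <-]; apply/(unit_imageP T); by exists x.
have A0 : closure A 0.
  apply: subset_closure; exists 0; last exact: lin0.
  by split; [rewrite nr0|move=> i; rewrite inner0l].
have [||y yA hy] := @compact_EVT_max _ _ nr (closure A) _ cA; first by exists 0.
  by apply: continuous_subspaceT; exact: nr_continuous.
have {}hy z : closure A z -> nr z <= nr y by move=> hz; apply: hy; rewrite inE.
have {yA} yA : closure A y by rewrite inE in yA.
have bT x : perp e x -> nr (T x) <= nr y * nr x.
  move=> px; have [x0|n0] := eqVneq (nr x) 0.
    by rewrite x0 mulr0 (nr0_eq0 x0) lin0// nr0.
  have n1 : 0 < nr x by rewrite lt_def n0 nr_ge0.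
  have : nr (T (of_real (nr x)^-1 *: x)) <= nr y.
    apply: hy; apply: subset_closure; exists (of_real (nr x)^-1 *: x) => //; split.
      by rewrite nrZ modulus_of_real ger0_norm ?invr_ge0// mulVf.
    by move=> i; rewrite innerZl px mulr0.
  by rewrite linZ// nrZ modulus_of_real ger0_norm ?invr_ge0// [leLHS]mulrC ler_pdivrMr.
have [y0|y0] := eqVneq (nr y) 0.
  have [v v1 pv] := unit_perp; exists v; split => // x px.
  have := bT x px; rewrite y0 mul0r => h; apply: le_trans h _.
  by rewrite mulr_ge0.
have y1 : 0 < nr y by rewrite lt_def y0 nr_ge0.
have [|S hS] := adj_exists lT; first by exists C.
set w := proj n e (S y).
have pw : perp e w := perp_proj _.
have w1 : nr w ^+ 2 = modulus (inner (T w) y).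
  rewrite hS inner_conj (proj_inner (S y) pw) -/w modulus_conj inner_self.
  by rewrite modulus_of_real ger0_norm// sqr_ge0.
have wle : nr w <= nr y ^+ 2.
  have [w0|w0] := eqVneq (nr w) 0; first by rewrite w0 sqr_ge0.
  have w2 : 0 < nr w by rewrite lt_def w0 nr_ge0.
  rewrite -(ler_pM2l w2) -expr2 w1; apply: le_trans (cauchy_schwarz _ _) _.
  have := bT w pw; rewrite -(ler_pM2r y1) => h; apply: le_trans h _.
  by rewrite mulrAC -expr2 mulrC.
(* [y] is a limit of values [T x], and [<T x, y> = <x, S y>] sees only [w]. *)
have wge : nr y ^+ 2 <= nr w.
  rewrite -subr_le0; apply: le_trans (_ : nr y * 0 <= 0); last by rewrite mulr0.
  rewrite lerBlDr; apply/ler_addgt0Pr => d d0.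
  have d1 : 0 < d / nr y by rewrite divr_gt0.
  have [_ [x [x1 px] <-] hx] := closure_nr d1 yA.
  have -> : nr y ^+ 2 = modulus (inner y y) by rewrite inner_self modulus_of_real ger0_norm//
    sqr_ge0.
  have -> : inner y y = inner (T x) y + inner (y - T x) y by rewrite -innerDl addrC subrK.
  apply: le_trans (ler_modulusD _ _) _; rewrite mulr0 add0r; apply: lerD.
    rewrite hS inner_conj (proj_inner (S y) px) -/w modulus_conj.
    apply: le_trans (cauchy_schwarz _ _) _; by rewrite ler_piMr.
  apply: le_trans (cauchy_schwarz _ _) _; rewrite nrB -ler_pdivlMr//; exact: ltW.
have wE : nr w = nr y ^+ 2 by apply/eqP; rewrite eq_le wle wge.
have w2 : 0 < nr w by rewrite wE exprn_gt0.
exists (of_real (nr w)^-1 *: w); split.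
- by rewrite nrZ modulus_of_real ger0_norm ?invr_ge0// mulVf// lt0r_neq0.
- by move=> i; rewrite innerZl pw mulr0.
move=> x px; apply: le_trans (bT x px) _; apply: ler_wpM2r => //.
rewrite linZ// nrZ modulus_of_real ger0_norm ?invr_ge0// mulrC ler_pdivlMr//.
rewrite -(ler_pM2r y1); apply: le_trans (cauchy_schwarz _ _).
by rewrite -w1 mulrAC -expr2 -wE expr2.
Qed.

End Proj.

Section Greedy.
Variable T : H -> H.
Hypothesis cT : compact_operator T.

Definition maximizer e : H := xget 0 [set v | [/\ nr v = 1, perp e v &
  forall x, perp e x -> nr (T x) <= nr (T v) * nr x]].

(** The finite family of the first [n] maximizers, continued by zeros: then [pon]
    and [perp], which speak of sequences, apply to it. *)
Fixpoint greedy n : nat -> H :=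
  if n is m.+1 then fun i => if (i < m)%N then greedy m i else
    if i == m then maximizer (greedy m) else 0
  else fun=> 0.

Definition rsv n : H := maximizer (greedy n).

Lemma greedyE n i : greedy n i = if (i < n)%N then rsv i else 0.
Proof.
elim: n => [|n IH] //=; rewrite IH ltnS.
by case: ltngtP => // ->.
Qed.

Lemma greedy_pon n : pon (greedy n).
Proof.
elim: n => [|n [IH1 IH2]]; first by split => *; rewrite ?inner0l//; right.
have hn i : (n <= i)%N -> greedy n i = 0 by rewrite greedyE leqNgt => /negbTE ->.
have [v vP] := norm_attained_perp (conj IH1 IH2) hn cT.
have [r1 r2 _] : [/\ nr (rsv n) = 1, perp (greedy n) (rsv n) &
    forall x, perp (greedy n) x -> nr (T x) <= nr (T (rsv n)) * nr x].
  by rewrite /rsv /maximizer; case: xgetP => [z _ //|/(_ v)].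
have r3 i : (i < n)%N -> inner (rsv n) (rsv i) = 0.
  by move=> hi; have := r2 i; rewrite greedyE hi.
split=> [i j ij|i]; rewrite !greedyE !ltnS.
  case: (ltngtP i n) => [hi|hi|hi]; case: (ltngtP j n) => [hj|hj|hj]; rewrite ?inner0l ?inner0r//.
  - by have := IH1 i j ij; rewrite !greedyE hi hj.
  - by rewrite hj inner_conj r3// conj0.
  - by rewrite hi r3.
  - by rewrite hi hj eqxx in ij.
case: (ltngtP i n) => [hi|hi|->]; [|by right|by left].
by have := IH2 i; rewrite greedyE hi.
Qed.

Lemma rsvP n : [/\ nr (rsv n) = 1, forall i, (i < n)%N -> inner (rsv n) (rsv i) = 0 &
  forall x, (forall i, (i < n)%N -> inner x (rsv i) = 0) -> nr (T x) <= nr (T (rsv n)) * nr x].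
Proof.
have hn i : (n <= i)%N -> greedy n i = 0 by rewrite greedyE leqNgt => /negbTE ->.
have [v vP] := norm_attained_perp (greedy_pon n) hn cT.
have [r1 r2 r3] : [/\ nr (rsv n) = 1, perp (greedy n) (rsv n) &
    forall x, perp (greedy n) x -> nr (T x) <= nr (T (rsv n)) * nr x].
  by rewrite /rsv /maximizer; case: xgetP => [z _ //|/(_ v)].
split => // [i hi|x hx]; first by have := r2 i; rewrite greedyE hi.
by apply: r3 => i; rewrite greedyE; case: ifP => [/hx//|_]; rewrite inner0r.
Qed.

Lemma rsv_pon : pon rsv.
Proof.
split=> [i j ij|i]; last by left; have [] := rsvP i.
have [ij'|ji|ij'] := ltngtP i j; last by rewrite ij' eqxx in ij.
  by have [_ h _] := rsvP j; rewrite inner_conj h// conj0.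
by have [_ h _] := rsvP i; rewrite h.
Qed.

(** First order condition for a maximum: if [<T (rsv n), T x>] did not vanish,
    moving [rsv n] slightly in the direction of [x] would increase the ratio of
    [nr (T v)] to [nr v]. *)
Lemma rsv_orth n x : (forall i, (i <= n)%N -> inner x (rsv i) = 0) ->
  inner (T (rsv n)) (T x) = 0.
Proof.
have lT : linear T by case: cT.
move=> hx; set c := inner _ _; set s := nr (T (rsv n)).
have s0 : 0 <= s by exact: nr_ge0.
have key (t : R) : 0 < t ->
    2 * t * modulus c ^+ 2 <= s ^+ 2 * (t ^+ 2 * modulus c ^+ 2 * nr x ^+ 2).
  move=> t0; have [r1 r2 r3] := rsvP n.
  pose d : K := of_real t * c.
  have h := r3 (rsv n + d *: x) _.
  have {}h : nr (T (rsv n + d *: x)) <= s * nr (rsv n + d *: x).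
    apply: h => i hi; rewrite innerDl r2// innerZl hx ?mulr0 ?addr0//; exact: ltnW.
  have h1 : nr (T (rsv n + d *: x)) ^+ 2 <= s ^+ 2 * nr (rsv n + d *: x) ^+ 2.
    by rewrite -exprMn ler_pXn2r ?nnegrE ?mulr_ge0.
  move: h1; rewrite (pythagoras (x := rsv n)); last first.
    by rewrite innerZr inner_conj hx// conj0 mulr0.
  rewrite r1 expr1n mulrDr mulr1 nrZ !exprMn {1}/d modulusM modulus_of_real (gtr0_norm t0) exprMn.
  move=> h2; have h3 : nr (T (rsv n + d *: x)) ^+ 2 = s ^+ 2 + 2 * t * modulus c ^+ 2
       + t ^+ 2 * modulus c ^+ 2 * nr (T x) ^+ 2.
    apply: (@of_real_inj R k); rewrite -inner_self linD// linZ//.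
    rewrite innerDl !innerDr !innerZl !innerZr (inner_conj (T (rsv n)) (T x)) -/c !inner_self.
    rewrite /d conjM conj_of_real !of_realD !of_realM -/s.
    have e1 : of_real (modulus c) * of_real (modulus c) = c * scalar_conj c.
      by rewrite -of_realM -expr2 mul_conj.
    have e2 : of_real 2 = 1 + 1 :> K by rewrite -of_real1 -of_realD.
    by rewrite e1 e2; ring.
  have : 0 <= t ^+ 2 * modulus c ^+ 2 * nr (T x) ^+ 2.
    by apply: mulr_ge0; [apply: mulr_ge0|]; exact: sqr_ge0.
  by move: h2; rewrite -/d h3; lra.
apply: modulus_eq0; apply/eqP; rewrite -sqrf_eq0; apply/eqP.
set B := s ^+ 2 * nr x ^+ 2; have B0 : 0 <= B by apply: mulr_ge0; exact: sqr_ge0.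
have B1 : 0 < B + 1 by rewrite ltr_wpDl.
(* For this step the second order term is at most half of the first order term. *)
have := key (B + 1)^-1; rewrite invr_gt0 => /(_ B1).
have -> : s ^+ 2 * ((B + 1)^-1 ^+ 2 * modulus c ^+ 2 * nr x ^+ 2) =
   (B + 1)^-1 * modulus c ^+ 2 * (B / (B + 1)) by rewrite /B; ring.
have -> : 2 * (B + 1)^-1 * modulus c ^+ 2 = (B + 1)^-1 * modulus c ^+ 2 * 2 by ring.
have q0 : 0 <= (B + 1)^-1 * modulus c ^+ 2 by apply: mulr_ge0;
  [rewrite invr_ge0 ltW|exact: sqr_ge0].
have : B / (B + 1) <= 1 by rewrite ler_pdivrMr// mul1r lerDl.
move=> hB hh; have : (B + 1)^-1 * modulus c ^+ 2 <= 0.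
  have := ler_wpM2l q0 hB; move: hh q0; move: (_ * _ ^+ 2) => q; lra.
rewrite mulrC pmulr_lle0 ?invr_gt0// => h; apply/eqP; by rewrite eq_le h sqr_ge0.
Qed.

Lemma rsv_noninc n : nr (T (rsv n.+1)) <= nr (T (rsv n)).
Proof.
have [r1 r2 r3] := rsvP n; have [q1 q2 q3] := rsvP n.+1.
by have := r3 (rsv n.+1); rewrite q1 mulr1; apply => i hi; apply: q2; exact: ltnW.
Qed.

Lemma rsv_image_orth i j : i != j -> inner (T (rsv i)) (T (rsv j)) = 0.
Proof.
have [po _] := rsv_pon.
move=> ij; have [h|h|h] := ltngtP i j; last by rewrite h eqxx in ij.
  by apply: rsv_orth => l hl; apply: po; rewrite neq_ltn (leq_ltn_trans hl h) orbT.
rewrite inner_conj rsv_orth ?conj0// => l hl; apply: po.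
by rewrite neq_ltn (leq_ltn_trans hl h) orbT.
Qed.

Definition lsv n : H := of_real (nr (T (rsv n)))^-1 *: T (rsv n).

Lemma lsvE n : T (rsv n) = of_real (nr (T (rsv n))) *: lsv n.
Proof.
have [h|h] := eqVneq (nr (T (rsv n))) 0.
  by rewrite h of_real0 scale0r; exact: nr0_eq0.
by rewrite scalerA -of_realM mulfV// of_real1 scale1r.
Qed.

Lemma lsv_pon : pon lsv.
Proof.
split=> [i j ij|i]; first by rewrite innerZl innerZr rsv_image_orth// !mulr0.
have [h|h] := eqVneq (nr (T (rsv i))) 0.
  by right; rewrite /lsv (nr0_eq0 h) scaler0.
by left; rewrite nrZ modulus_of_real ger0_norm ?invr_ge0// mulVf.
Qed.

(** If infinitely many singular values were at least [d], the corresponding left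
    singular vectors would have a fixed part of their mass in the first [m]
    coordinates. By the inequality of Bessel for the vectors [delta i] with [i <
    m], only boundedly many orthonormal vectors can do so. *)
Lemma rsv_null : null (fun n => nr (T (rsv n))).
Proof.
have noninc m n : (m <= n)%N -> nr (T (rsv n)) <= nr (T (rsv m)).
  elim: n => [|n IH]; first by rewrite leqn0 => /eqP ->.
  rewrite leq_eqVlt ltnS => /predU1P[->//|/IH]; apply: le_trans; exact: rsv_noninc.
have /compactP[lT bT sT] := cT.
move=> d d0; apply: contrapT => hno.
have hd n : d <= nr (T (rsv n)).
  rewrite leNgt; apply/negP => h; apply: hno; exists n => m nm.
  exact: le_lt_trans (noninc _ _ nm) h.
have d2 : 0 < d / 2 by rewrite divr_gt0.
have [m hm] := sT _ d2.
have hl n : 4^-1 <= \sum_(i < m) modulus (inner (delta i) (lsv n)) ^+ 2.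
  have -> : \sum_(i < m) modulus (inner (delta i) (lsv n)) ^+ 2 = nr (fin m (lsv n)) ^+ 2.
    rewrite nr_fin; apply: eq_bigr => i _.
    by rewrite inner_conj modulus_conj inner_delta.
  have [r1 _ _] := rsvP n.
  have s0 : 0 < nr (T (rsv n)) by exact: lt_le_trans (hd n).
  have h1 : nr (lsv n) = 1.
    by rewrite nrZ modulus_of_real ger0_norm ?invr_ge0// mulVf// lt0r_neq0.
  have h2 : nr (lsv n - fin m (lsv n)) <= 2^-1.
    rewrite /lsv fin_scale -scalerBr nrZ modulus_of_real ger0_norm ?invr_ge0//.
    rewrite mulrC ler_pdivrMr//; have := hm (rsv n); rewrite r1 => /(_ (lexx _)).
    have := hd n; lra.
  have := nrD (lsv n - fin m (lsv n)) (fin m (lsv n)); rewrite subrK h1 => h3.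
  have h4 : 2^-1 <= nr (fin m (lsv n)) by lra.
  have -> : 4^-1 = 2^-1 ^+ 2 :> R by field.
  by rewrite ler_pXn2r ?nnegrE.
(* Each left singular vector has squared mass at least 1/4 in the first [m]
   coordinates, so there cannot be more than [4 * m] of them. *)
have : (4 * m).+1%:R * 4^-1 <= m%:R :> R; last first.
  rewrite ler_pdivrMr// -natrM ler_nat mulnC ltnn//.
apply: (@le_trans _ _ (\sum_(n < (4 * m).+1) \sum_(i < m) modulus (inner (delta i) (lsv n)) ^+ 2)).
  rewrite mulr_natl -[X in _ *+ X]card_ord -sumr_const; exact: ler_sum.
rewrite exchange_big /= -[m in leRHS]card_ord -sumr_const; apply: ler_sum => i _.
rewrite -(big_mkord xpredT (fun n => modulus (inner (delta i) (lsv n)) ^+ 2)).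
by apply: le_trans (bessel _ lsv_pon (iota_uniq _ _)) _; rewrite nr_delta expr1n.
Qed.

(** The error after [n] terms is [T] at the projection of [x] to the orthogonal
    complement of the first [n] right singular vectors, hence at most the [n]-th
    singular value times [nr x]. *)
Lemma svd_op : T = jop rsv lsv (fun i => of_real (nr (T (rsv i)))).
Proof.
have /compactP[lT bT sT] := cT.
have bs : bounded_seq (fun i => of_real (nr (T (rsv i))) : K) (nr (T (rsv 0))).
  move=> i; rewrite modulus_of_real (ger0_norm (nr_ge0 _)).
  elim: i => [|i IH]; [exact: lexx|exact: le_trans (rsv_noninc i) IH].
apply/funext => x; apply: cvH_uniq (jop_cvH rsv_pon lsv_pon x bs).
have hn : null (fun n => nr x * nr (T (rsv n))) by apply: nullM; [|exact: rsv_null].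
apply: null_le hn => n.
have -> : \sum_(i < n) (of_real (nr (T (rsv i))) * inner x (rsv i)) *: lsv i =
    T (\sum_(i < n) inner x (greedy n i) *: greedy n i).
  rewrite lin_sum//; apply: eq_bigr => i _; rewrite greedyE ltn_ord linZ//.
  by rewrite [in RHS]lsvE scalerA mulrC.
have hn0 i : (n <= i)%N -> greedy n i = 0 by rewrite greedyE leqNgt => /negbTE ->.
rewrite nrB -linB// -/(proj n (greedy n) x) mulrC.
have [_ _ r3] := rsvP n.
apply: le_trans (r3 _ _) _; last by apply: ler_wpM2l => //; apply: nr_proj (greedy_pon n) hn0 x.
by move=> i hi; have := perp_proj (greedy_pon n) hn0 x i; rewrite greedyE hi.
Qed.

End Greedy.
End SVD.

(** * Singular values *)

(** A finite set has more elements than its proper subsets. *)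
Lemma card_proper_neq (A B : set nat) (n : nat) (j : nat) :
  A `<=` B -> B j -> ~ A j -> (A #= `I_n)%card -> (B #= `I_n)%card -> False.
Proof.
move=> AB Bj Aj cA cB.
have fA : finite_set A by apply/finite_setP; exists n.
have fB : finite_set B by apply/finite_setP; exists n.
have sub : finmap.fsubset (fset_set A) (fset_set B).
  by apply/finmap.fsubsetP => x; rewrite !in_fset_set// !inE; exact: AB.
have := finmap.fsubset_leqif_cards sub; rewrite (card_fset_set cA) (card_fset_set cB) => -[_].
rewrite eqxx => /esym/eqP AB'.
have hA := in_fset_set fA; rewrite AB' in hA.
by apply: Aj; rewrite -inE -hA in_fset_set// inE.
Qed.

(** The coordinates of a free family of [m] vectors form a matrix of rank [m] with
    [n] columns. *)
Lemma has_dim_leq (R : realType) (k : scalar_kind) (V : lmodType (scalar_field R k))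
    (Y : set V) (n m : nat) (v : 'I_m -> V) :
  has_dim Y n -> (forall i, Y (v i)) ->
  (forall u : 'rV[scalar_field R k]_m, \sum_i u ord0 i *: v i = 0 -> u = 0) -> (m <= n)%N.
Proof.
move=> [b [bY bI bS]] vY vfree.
have /choice[c hc] : forall i, exists a : 'rV[scalar_field R k]_n, \sum_j a ord0 j *: b j = v i.
  by move=> i; have [a _ <-] := bS _ (vY i); exists a.
pose M := \matrix_(i, j) c i ord0 j.
have /inj_row_free : forall u : 'rV_m, u *m M = 0 -> u = 0.
  move=> u uM; apply: vfree.
  transitivity (\sum_j (u *m M) ord0 j *: b j); last first.
    by rewrite uM big1// => j _; rewrite mxE scale0r.
  under [RHS]eq_bigr => j _ do rewrite mxE scaler_suml.
  rewrite exchange_big /=; apply: eq_bigr => i _.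
  by rewrite -hc scaler_sumr; apply: eq_bigr => j _; rewrite scalerA mxE.
by rewrite /row_free => /eqP <-; exact: rank_leq_col.
Qed.

Lemma has_dim_free (R : realType) (k : scalar_kind) (V : lmodType (scalar_field R k))
    (Y : set V) (n : nat) : has_dim Y n -> Y 0 -> exists v : 'I_n -> V,
  (forall i, Y (v i)) /\
  (forall u : 'rV[scalar_field R k]_n, \sum_i u ord0 i *: v i = 0 -> u = 0).
Proof.
move=> [b [bY bI bS]] Y0; exists b; split => [i|u hu].
  have := bY (delta_mx ord0 i) I; rewrite (bigD1 i)//= mxE !eqxx scale1r big1 ?addr0//.
  by move=> j ji; rewrite mxE (negbTE ji) andbF scale0r.
apply: bI; rewrite ?inE// hu big1// => i _; by rewrite mxE scale0r.
Qed.

Lemma has_dim_uniq (R : realType) (k : scalar_kind) (V : lmodType (scalar_field R k))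
    (Y : set V) (n m : nat) : has_dim Y n -> has_dim Y m -> Y 0 -> n = m.
Proof.
move=> hn hm Y0; apply/eqP; rewrite eqn_leq; apply/andP; split.
  by have [v [vY vf]] := has_dim_free hn Y0; exact: has_dim_leq hm vY vf.
by have [v [vY vf]] := has_dim_free hm Y0; exact: has_dim_leq hn vY vf.
Qed.

Section SingularValues.
Context {R : realType} {k : scalar_kind}.
Local Notation K := (scalar_field R k).
Local Notation H := (ell2 R k).
Implicit Types (x y z : H) (T S : H -> H) (s : nat -> R).

Lemma noninc_le s : (forall j, s j.+1 <= s j) -> forall i j, (i <= j)%N -> s j <= s i.
Proof.
move=> h i j; elim: j => [|j IH]; first by rewrite leqn0 => /eqP ->.
by rewrite leq_eqVlt ltnS => /predU1P[->//|/IH]; apply: le_trans; exact: h.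
Qed.

(** The multiplicity of each positive value is the dimension of an eigenspace,
    hence the same for both sequences. At the first index where they differ, the
    larger of the two values would occur more often in one sequence than in the
    other. *)
Lemma singular_values_uniq T s s' : linear T -> is_singular_values T s ->
  is_singular_values T s' -> s = s'.
Proof.
move=> lT [s0 sd [S hS sm]] [s0' sd' [S' hS' sm']].
have lS := adj_linear hS.
have eS : S' = S := adj_uniq hS' hS.
have main (p q : nat -> R) : (forall j, 0 <= p j) -> (forall j, 0 <= q j) ->
    (forall j, p j.+1 <= p j) -> (forall j, q j.+1 <= q j) ->
    (forall l : R, 0 < l -> exists2 n : nat,
      ([set j | p j = l] #= `I_n)%card & ([set j | q j = l] #= `I_n)%card) ->
    forall j, (forall i, (i < j)%N -> p i = q i) -> q j <= p j.
  move=> p0 q0 pd qd h j hj; rewrite leNgt; apply/negP => hlt.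
  have l0 : 0 < q j by exact: le_lt_trans (p0 j) hlt.
  have [n hp hq] := h _ l0.
  apply: (card_proper_neq (j := j) _ _ _ hp hq) => //=; last first.
    by move=> e; rewrite e ltxx in hlt.
  move=> i /= pi; have [ij|ji] := ltnP i j; first by rewrite -hj.
  by have := noninc_le pd ji; rewrite pi leNgt hlt.
have mult l : 0 < l -> exists2 n : nat,
  ([set j | s j = l] #= `I_n)%card & ([set j | s' j = l] #= `I_n)%card.
  move=> l0; have [n hn cn] := sm _ l0; have [n' hn' cn'] := sm' _ l0.
  rewrite eS in hn'; exists n => //; rewrite (has_dim_uniq hn hn')//=.
  by rewrite (lin0 lT) (lin0 lS) scaler0.
apply/funext => j; elim/ltn_ind: j => j IH; apply/eqP; rewrite eq_le; apply/andP; split.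
  apply: main => // [l l0|i /IH ->//]; have [n h h'] := mult l l0; by exists n.
by apply: main.
Qed.

(** The eigenspace for [l ^+ 2] is spanned by the [e j] with [s j = l]. These [j]
    form an interval. An eigenvector orthogonal to them is orthogonal to the other
    [e j] as well, since eigenvectors for different eigenvalues are orthogonal,
    hence is mapped to zero. *)
Lemma jop_is_singular_values T (e f : nat -> H) s : linear T ->
  pon e -> (forall j, nr (e j) = 1) -> pon f -> (forall j, s j != 0 -> nr (f j) = 1) ->
  (forall j, 0 <= s j) -> (forall j, s j.+1 <= s j) -> null s ->
  (forall j, T (e j) = of_real (s j) *: f j) -> T = jop e f (fun i => of_real (s i)) ->
  is_singular_values T s.
Proof.
move=> lT pe e1 pf f1 s0 sd sn Te TE.
have bs : bounded_seq (fun i => of_real (s i) : K) (s 0%N).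
  by move=> i; rewrite modulus_of_real (ger0_norm (s0 i)); exact: noninc_le.
split => [//|//|].
set S := jop f e (fun i => of_real (s i)).
have hS : is_adjoint T S.
  rewrite TE => x y; apply: (jop_adj_ext x y pe pf bs) => i.
  by rewrite conj_of_real.
exists S => // l l0.
have lS := adj_linear hS.
have STe j : S (T (e j)) = of_real (s j ^+ 2) *: e j.
  rewrite Te linZ// {1}/S (jop_basis pf pe _ bs) scalerA.
  have [sj|sj] := eqVneq (s j) 0; first by rewrite sj expr0n of_real0 !mul0r.
  by rewrite f1// expr1n of_real1 mulr1 -of_realM expr2.
have ex_lt : exists j, s j < l.
  by have [N hN] := sn _ l0; exists N; exact: hN.
have ex_le : exists j, s j <= l by have [j /ltW] := ex_lt; exists j.
pose b := ex_minn ex_lt; pose a := ex_minn ex_le.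
have bP j : (s j < l) = (b <= j)%N.
  rewrite /b; case: ex_minnP => m hm hmin; apply/idP/idP; first exact: hmin.
  by move=> /(noninc_le sd) h; exact: le_lt_trans hm.
have aP j : (s j <= l) = (a <= j)%N.
  rewrite /a; case: ex_minnP => m hm hmin; apply/idP/idP; first exact: hmin.
  by move=> /(noninc_le sd) h; exact: le_trans hm.
have eqP' j : s j = l <-> (a <= j < b)%N.
  rewrite -aP ltnNge -bP -leNgt; split => [->|/andP[h1 h2]]; first by rewrite lexx.
  by apply/eqP; rewrite eq_le h1.
have inj_e i j : (a + i == a + j)%N = (i == j) by rewrite eqn_add2l.
exists (b - a)%N; last first.
  have -> : [set j | s j = l] = (addn a) @` `I_(b - a).
    apply/seteqP; split => [j /eqP'/andP[h1 h2]|_ [j /= hj <-]].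
      exists (j - a)%N; last by rewrite subnKC.
      by rewrite /= ltn_sub2r// (leq_ltn_trans h1).
    by apply/eqP'; rewrite leq_addr -ltn_subRL.
  by apply: inj_card_eq => i j _ _ /addnI.
have coef (u : 'rV[K]_(b - a)) (i : 'I_(b - a)) :
    inner (\sum_(j < b - a) u ord0 j *: e (a + j)%N) (e (a + i)%N) = u ord0 i.
  rewrite inner_suml (bigD1 i)//= innerZl inner_self.
  rewrite e1 expr1n of_real1 mulr1 big1 ?addr0// => j ji.
  by rewrite innerZl pe.1 ?mulr0// inj_e.
have eig (i : 'I_(b - a)) : s (a + i)%N = l.
  by apply/eqP'; rewrite leq_addr -ltn_subRL ltn_ord.
exists (fun i => e (a + i)%N); split.
- move=> u _ /=; rewrite (lin_sum lT) (lin_sum lS) scaler_sumr; apply: eq_bigr => i _.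
  by rewrite (linZ lT) (linZ lS) STe eig !scalerA mulrC.
- by move=> u v _ _ huv; apply/rowP => i; rewrite -!coef huv.
move=> y /= hy; pose u : 'rV[K]_(b - a) := \row_i inner y (e (a + i)%N).
exists u => //; set w := \sum_(i < _) _.
have STw : S (T w) = of_real (l ^+ 2) *: w.
  rewrite (lin_sum lT) (lin_sum lS) scaler_sumr; apply: eq_bigr => i _.
  by rewrite (linZ lT) (linZ lS) STe eig !scalerA mulrC.
have l2 : of_real (l ^+ 2) != 0 :> K.
  rewrite -of_real0; apply/eqP => /of_real_inj/eqP; rewrite sqrf_eq0 => /eqP h.
  by rewrite h ltxx in l0.
set z := y - w.
have STz : S (T z) = of_real (l ^+ 2) *: z by rewrite (linB lT) (linB lS) hy STw scalerBr.
have zp j : inner z (e j) = 0.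
  have [/eqP'/andP[aj jb]|nj] := pselect (s j = l).
    have hj : (j - a < b - a)%N by rewrite ltn_sub2r// (leq_ltn_trans aj).
    have h := coef u (Ordinal hj).
    by rewrite mxE /= subnKC// in h; rewrite innerBl h subrr.
  have h1 : of_real (l ^+ 2) * inner z (e j) = of_real (s j ^+ 2) * inner z (e j).
    rewrite -innerZl -STz (adj_sym hS) hS STe innerZr conj_of_real //.
  apply/eqP; apply: contrapT => /negP zj; apply: nj.
  have /mulIf/(_ _ _ h1)/of_real_inj/eqP : inner z (e j) != 0 by [].
  by rewrite eqrXn2 ?(ltW l0)// => /eqP.
have Tz : T z = 0 by rewrite TE; apply: jop_eq0 => // i; rewrite zp mulr0.
move: STz; rewrite Tz lin0// => /esym/eqP; rewrite scaler_eq0 (negbTE l2) /= => /eqP.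
by move/eqP; rewrite subr_eq0 => /eqP.
Qed.

Lemma rsv_is_singular_values T : compact_operator T ->
  is_singular_values T (fun n => nr (T (rsv T n))).
Proof.
move=> cT; have [lT _ _] := (compactP T).1 cT.
apply: jop_is_singular_values lT (rsv_pon cT) _ (lsv_pon cT) _ _ _ (rsv_null cT) _ (svd_op cT).
- by move=> j; have [] := rsvP cT j.
- move=> j hj; have [//|h] := (lsv_pon cT).2 j.
  by move: hj; rewrite {1}lsvE h scaler0 nr0 eqxx.
- by move=> j; exact: nr_ge0.
- exact: rsv_noninc.
- by move=> j; exact: lsvE.
Qed.

Lemma singular_valuesE T : compact_operator T ->
  singular_values T = (fun n => nr (T (rsv T n))).
Proof.
move=> cT; apply: xget_unique; first exact: rsv_is_singular_values.
move=> s hs; apply: singular_values_uniq hs _; first by case: cT.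
exact: rsv_is_singular_values.
Qed.

End SingularValues.

(** * Banach spaces and symmetric sequence spaces *)

Section Banach.
Context {R : realType} {k : scalar_kind}.
Local Notation K := (scalar_field R k).
Context {V : lmodType K}.

Lemma linear_subspaceP (Y : set V) :
  linear_subspace Y <-> Y 0 /\ forall (c : K) x y, Y x -> Y y -> Y (c *: x + y).
Proof.
split=> [[Y0 YL]|[Y0 YL]].
  split=> [|c x y hx hy]; first by rewrite -inE.
  by rewrite -inE; apply: YL; rewrite inE.
by split=> [|c x y]; rewrite ?inE//; exact: YL.
Qed.

Lemma subspace0 (Y : set V) : linear_subspace Y -> Y 0.
Proof. by move=> /linear_subspaceP[]. Qed.
Lemma subspaceL (Y : set V) (c : K) x y : linear_subspace Y -> Y x -> Y y -> Y (c *: x + y).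
Proof. by move=> /linear_subspaceP[_ h]; exact: h. Qed.
Lemma subspaceD (Y : set V) x y : linear_subspace Y -> Y x -> Y y -> Y (x + y).
Proof. by move=> hY hx hy; rewrite -[x]scale1r; exact: subspaceL. Qed.
Lemma subspaceZ (Y : set V) (c : K) x : linear_subspace Y -> Y x -> Y (c *: x).
Proof. by move=> hY hx; rewrite -[_ *: _]addr0; apply: subspaceL => //; exact: subspace0. Qed.
Lemma subspaceN (Y : set V) x : linear_subspace Y -> Y x -> Y (- x).
Proof. by move=> hY hx; rewrite -scaleN1r; exact: subspaceZ. Qed.
Lemma subspaceB (Y : set V) x y : linear_subspace Y -> Y x -> Y y -> Y (x - y).
Proof. by move=> hY hx hy; apply: subspaceD => //; exact: subspaceN. Qed.
Lemma subspace_sum (Y : set V) (I : Type) (r : seq I) (F : I -> V) : linear_subspace Y ->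
  (forall i, Y (F i)) -> Y (\sum_(i <- r) F i).
Proof.
move=> hY hF; elim: r => [|i r IH]; first by rewrite big_nil; exact: subspace0.
by rewrite big_cons; apply: subspaceD.
Qed.

Variable X : normed_space V.
Hypothesis bX : is_banach X.
Let lX : linear_subspace (carrier X) := banach_submod bX.
Local Notation nX := (nnorm X).

Lemma nnorm0 : nX 0 = 0.
Proof.
have X0 : X 0 := subspace0 lX.
by have := banach_normZ bX 0 X0; rewrite scaler0 modulus0 mul0r.
Qed.

Lemma nnormN x : X x -> nX (- x) = nX x.
Proof. by move=> hx; rewrite -scaleN1r (banach_normZ bX)// modulusN modulus1 mul1r. Qed.

Lemma nnormB x y : X x -> X y -> nX (x - y) = nX (y - x).
Proof. by move=> hx hy; rewrite -nnormN ?opprB//; exact: subspaceB. Qed.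

Lemma nnorm_sum (I : Type) (r : seq I) (F : I -> V) : (forall i, X (F i)) ->
  nX (\sum_(i <- r) F i) <= \sum_(i <- r) nX (F i).
Proof.
move=> hF; elim: r => [|i r IH]; first by rewrite !big_nil nnorm0.
rewrite !big_cons; apply: le_trans (banach_normD bX _ _) _ => //; last by rewrite lerD2l.
exact: subspace_sum.
Qed.

Lemma nnorm_tri x y z : X x -> X y -> X z -> nX (x - z) <= nX (x - y) + nX (y - z).
Proof.
move=> hx hy hz; have -> : x - z = (x - y) + (y - z) by rewrite addrA subrK.
by apply: banach_normD => //; exact: subspaceB.
Qed.

(** On a Banach space this is [norm_cvg], without the topology of [R]. *)
Definition ncv (u : nat -> V) x := null (fun n => nX (u n - x)).

Lemma norm_cvgP (u : nat -> V) x : (forall n, X (u n)) -> X x -> norm_cvg X u x <-> ncv u x.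
Proof.
move=> hu hx; apply: nullP => n; apply: (banach_norm_ge0 bX); exact: subspaceB.
Qed.

Lemma ncv_uniq u x y : (forall n, X (u n)) -> X x -> X y -> ncv u x -> ncv u y -> x = y.
Proof.
move=> hu hx hy h h'; apply/eqP; rewrite -subr_eq0; apply/eqP/(banach_norm_eq0 bX).
  exact: subspaceB.
apply/eqP; rewrite eq_le (banach_norm_ge0 bX) ?andbT; last exact: subspaceB.
apply: null_cst; apply: null_le (nullD h h') => n.
by rewrite [X in _ <= X + _]nnormB//; exact: nnorm_tri.
Qed.

Lemma ncvD u v x y : (forall n, X (u n)) -> (forall n, X (v n)) -> X x -> X y ->
  ncv u x -> ncv v y -> ncv (fun n => u n + v n) (x + y).
Proof.
move=> hu hv hx hy h h'; apply: null_le (nullD h h') => n.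
by rewrite opprD addrACA; apply: banach_normD => //; exact: subspaceB.
Qed.

Lemma ncvZ u x (c : K) : (forall n, X (u n)) -> X x ->
  ncv u x -> ncv (fun n => c *: u n) (c *: x).
Proof.
move=> hu hx h; apply: null_le (nullM (modulus_ge0 c) h) => n.
by rewrite -scalerBr banach_normZ//; exact: subspaceB.
Qed.

Lemma ncv_norm_le u x (C : R) : (forall n, X (u n)) -> X x -> ncv u x ->
  (forall n, nX (u n) <= C) -> nX x <= C.
Proof.
move=> hu hx h hC; apply: le_null h => n.
rewrite -[in leLHS](subrK (u n) x) addrC; apply: le_trans (banach_normD bX _ _) _ => //.
  exact: subspaceB.
by rewrite nnormB// lerD.
Qed.

Lemma banach_cauchy (u : nat -> V) : (forall n, X (u n)) -> norm_cauchy X u ->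
  exists2 x, X x & ncv u x.
Proof.
move=> hu /(banach_complete bX hu)[x hx h]; exists x => //.
by apply/norm_cvgP.
Qed.

End Banach.

(** * Symmetric sequence spaces are lattices *)
Section SequenceSpace.
Context {R : realType} {k : scalar_kind}.
Local Notation K := (scalar_field R k).
Variable E : normed_space (nat -> K).
Hypothesis hE : symmetric_sequence_space E.
Local Notation nE := (nnorm E).
Implicit Types (x y z a b : nat -> K) (r s : nat -> R).

Let bE : is_banach E := sss_banach hE.
Let lE : linear_subspace (carrier E) := banach_submod bE.

Definition trunc n x : nat -> K := fun i => if (i < n)%N then x i else 0.

Lemma truncE n x : trunc n x = \sum_(i < n) x i *: unit_vector i.
Proof.
apply/funext => j; rewrite /trunc.
have -> : (\sum_(i < n) x i *: unit_vector i) j = \sum_(i < n) x i * (j == i)%:R.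
  by elim/big_rec2: _ => // i y1 y2 _ <-.
case: ltnP => jn.
  rewrite (bigD1 (Ordinal jn))//= eqxx mulr1 big1 ?addr0// => i.
  by rewrite -val_eqE /= eq_sym => /negbTE ->; rewrite mulr0.
rewrite big1// => i _; rewrite [_ == _](_ : _ = false) ?mulr0//.
by apply/negP => /eqP ji; rewrite ji leqNgt ltn_ord in jn.
Qed.

Lemma E_trunc n x : E (trunc n x).
Proof.
rewrite truncE; apply: subspace_sum => // i; apply: subspaceZ => //; exact: sss_unit_vector.
Qed.

Lemma E_basis x : E x -> null (fun n => nE (trunc n x - x)).
Proof.
move=> hx; apply/(norm_cvgP bE) => //; first by move=> n; exact: E_trunc.
have := (sss_basis hE hx x).2 erefl.
by congr (norm_cvg _ _ _); apply/funext => n; rewrite truncE.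
Qed.

(** The truncations converge to some element of [E], and the uniqueness of basis
    expansions identifies it with [a]. *)
Lemma E_cauchy a : norm_cauchy E (fun n => trunc n a) -> E a.
Proof.
move=> /(banach_complete bE (fun n => E_trunc n a))[x hx h].
rewrite ((sss_basis hE hx a).1 _)//; move: h; congr (norm_cvg _ _ _).
by apply/funext => n; rewrite truncE.
Qed.

(** Scaling one coordinate by [t] in [[0, 1]] is an average of the identity and
    of a sign change. *)
Lemma E_shrink_coord j (t : R) x : 0 <= t -> t <= 1 -> E x ->
  E (fun i => if i == j then of_real t * x i else x i) /\
  nE (fun i => if i == j then of_real t * x i else x i) <= nE x.
Proof.
move=> t0 t1 hx.
have [hy ny] : E (fun i => (if i == j then -1 else 1) * x i) /\
   nE (fun i => (if i == j then -1 else 1) * x i) = nE x.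
  by apply: (sss_unimodular hE) => // i; case: ifP; rewrite ?modulusN modulus1.
set y := (fun i => _ * x i) in hy ny.
pose p := (1 + t) / 2; pose q := (1 - t) / 2.
have p0 : 0 <= p by rewrite divr_ge0// addr_ge0.
have q0 : 0 <= q by rewrite divr_ge0// subr_ge0.
have -> : (fun i => if i == j then of_real t * x i else x i) = of_real p *: x + of_real q *: y.
  apply/funext => i; rewrite -[RHS]/(of_real p * x i + of_real q * y i) /y.
  case: ifP => _.
    by rewrite mulN1r mulrN -mulrBl -of_realN -of_realD; congr (of_real _ * _); rewrite /p /q;
      field.
  by rewrite mul1r -mulrDl -of_realD (_ : p + q = 1) ?of_real1 ?mul1r// /p /q; field.
split; first by apply: subspaceL => //; apply: subspaceZ.
apply: le_trans (banach_normD bE _ _) _; try by apply: subspaceZ.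
rewrite !(banach_normZ bE)// ny !modulus_of_real !ger0_norm// -mulrDl.
by rewrite (_ : p + q = 1) ?mul1r// /p /q; field.
Qed.

Lemma E_le_coord j (c : K) x : modulus c <= modulus (x j) -> E x ->
  E (fun i => if i == j then c else x i) /\ nE (fun i => if i == j then c else x i) <= nE x.
Proof.
move=> hc hx; have [c0|c0] := eqVneq c 0.
  have -> : (fun i => if i == j then c else x i) = (fun i =>
    if i == j then of_real 0 * x i else x i).
    by apply/funext => i; rewrite c0 of_real0 mul0r.
  exact: E_shrink_coord.
have m0 : 0 < modulus c by rewrite lt_def modulus_ge0 andbT; apply: contra_neq c0 => /modulus_eq0.
have mx : 0 < modulus (x j) by exact: lt_le_trans hc.
have x0 : x j != 0 by apply: contraTneq mx => ->; rewrite modulus0 ltxx.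
pose t := modulus c / modulus (x j).
have t0 : t != 0 by rewrite mulf_neq0 ?invr_eq0// lt0r_neq0.
have tK : of_real t != 0 :> K by rewrite -of_real0; apply: contra_neq t0 => /of_real_inj.
have [h1 n1] : E (fun i => if i == j then of_real t * x i else x i) /\
  nE (fun i => if i == j then of_real t * x i else x i) <= nE x.
  by apply: E_shrink_coord => //; rewrite ?divr_ge0// ler_pdivrMr// mul1r.
have [|h2 n2] := sss_unimodular hE (c := fun i => if i == j then c / (of_real t * x j) else 1) _ h1.
  move=> i; case: ifP => _; last exact: modulus1.
  rewrite modulusM modulusV modulusM modulus_of_real ger0_norm ?divr_ge0//.
  by rewrite /t divfK ?lt0r_neq0// mulfV// lt0r_neq0.
have e : (fun i => if i == j then c else x i) = (fun i =>
  (if i == j then c / (of_real t * x j) else 1) *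
    (if i == j then of_real t * x i else x i)).
  apply/funext => i; case: eqP => [->|_]; last by rewrite mul1r.
  by rewrite divfK// mulf_neq0.
by rewrite e; split => //; rewrite n2.
Qed.

(** The first [n] coordinates are shrunk one after the other. *)
Lemma E_le_finite n x y : E x -> (forall i, modulus (y i) <= modulus (x i)) ->
  E (fun i => if (i < n)%N then y i else x i) /\
  nE (fun i => if (i < n)%N then y i else x i) <= nE x.
Proof.
move=> hx hy; elim: n => [|n [IH1 IH2]]; first by split.
have e : (fun i => if (i < n.+1)%N then y i else x i) =
    (fun i => if i == n then y n else if (i < n)%N then y i else x i).
  apply/funext => i; rewrite ltnS; case: ltngtP => // ->//.
have [h1 h2] : E (fun i => if i == n then y n else if (i < n)%N then y i else x i) /\
  nE (fun i => if i == n then y n else if (i < n)%N then y i else x i) <=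
  nE (fun i => if (i < n)%N then y i else x i).
  by apply: (@E_le_coord n (y n) (fun i => if (i < n)%N then y i else x i)) => //; rewrite ltnn.
by rewrite e; split => //; exact: le_trans h2 IH2.
Qed.

Lemma E_le_trunc n x y : (forall i, modulus (y i) <= modulus (x i)) ->
  nE (trunc n y) <= nE (trunc n x).
Proof.
move=> h; have [|h1 h2] := @E_le_finite n (trunc n x) (trunc n y) (E_trunc n x).
  by move=> i; rewrite /trunc; case: ifP => _ //; rewrite modulus0.
rewrite (_ : trunc n y = (fun i => if (i < n)%N then trunc n y i else trunc n x i))//.
by apply/funext => i; rewrite /trunc; case: ifP.
Qed.

Lemma E_trunc_mono m n x : (m <= n)%N -> nE (trunc m x) <= nE (trunc n x).
Proof.
move=> mn; have [|h1 h2] := @E_le_finite n (trunc n x) (trunc m x) (E_trunc n x).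
  move=> i; rewrite /trunc; case: (ltnP i m) => im; last by rewrite modulus0.
  by rewrite (leq_trans im mn).
rewrite (_ : trunc m x = (fun i => if (i < n)%N then trunc m x i else trunc n x i))//.
apply/funext => i; rewrite /trunc; case: (ltnP i n) => // ni.
by rewrite ltnNge (leq_trans mn ni).
Qed.

Lemma E_trunc_le n x : E x -> nE (trunc n x) <= nE x.
Proof.
move=> hx; apply: le_null (null_shift n (E_basis hx)) => m.
apply: le_trans (E_trunc_mono _ (leq_addl m n)) _.
rewrite -{1}[trunc _ x](subrK x) addrC; apply: (banach_normD bE) => //.
by apply: subspaceB => //; exact: E_trunc.
Qed.

(** Truncations of [y] are dominated by those of [x] ([E_le_finite]), which makes
    them Cauchy. *)
Lemma E_le x y : E x -> (forall i, modulus (y i) <= modulus (x i)) -> E y /\ nE y <= nE x.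
Proof.
move=> hx hy.
have tsub m n z : (n <= m)%N -> trunc m z - trunc n z = trunc m (fun i =>
  if (i < n)%N then 0 else z i).
  move=> nm; apply/funext => i; rewrite -[LHS]/(trunc m z i - trunc n z i) /trunc.
  case: (ltnP i n) => [i_n|ni]; first by rewrite (leq_trans i_n nm) subrr.
  by rewrite subr0.
have main m n : (n <= m)%N -> nE (trunc m y - trunc n y) <= nE (trunc m x - trunc n x).
  move=> nm; rewrite !tsub//; apply: E_le_trunc => i.
  by case: ifP => _; rewrite ?modulus0.
have hEy : E y.
  apply: E_cauchy => e e0.
  have e2 : 0 < e / 2 by rewrite divr_gt0.
  have [N hN] := E_basis hx e2; exists N.
  have aux m n : (N <= n)%N -> (n <= m)%N -> nE (trunc m y - trunc n y) < e.
    move=> Nn nm; apply: le_lt_trans (main _ _ nm) _.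
    apply: le_lt_trans (nnorm_tri bE (E_trunc m x) hx (E_trunc n x)) _.
    rewrite (splitr e) ltrD ?hN ?(leq_trans Nn nm)//.
    by rewrite (nnormB bE)// ?hN//; exact: E_trunc.
  move=> m n Nm Nn; have [mn|/ltnW nm] := leqP m n; last exact: aux.
  by rewrite (nnormB bE); [exact: aux|exact: E_trunc|exact: E_trunc].
split => //; apply: (ncv_norm_le bE (fun n => E_trunc n y) hEy (E_basis hEy)) => n.
exact: le_trans (E_le_trunc n hy) (E_trunc_le n hx).
Qed.

Lemma E_modulus_eq x y : E x -> (forall i, modulus (y i) = modulus (x i)) -> E y /\ nE y = nE x.
Proof.
move=> hx h; have [|h1 h2] := @E_le x y hx; first by move=> i; rewrite h.
have [|h3 h4] := @E_le y x h1; first by move=> i; rewrite h.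
by split => //; apply/eqP; rewrite eq_le h2.
Qed.

(** All unit vectors have this norm ([nE_unit]). *)
Definition unit_norm : R := nE (unit_vector 0).

Lemma unit_norm_gt0 : 0 < unit_norm.
Proof.
rewrite lt_def (banach_norm_ge0 bE) ?andbT; last exact: sss_unit_vector.
apply/eqP => /(banach_norm_eq0 bE (sss_unit_vector hE 0%N)) /(congr1 (fun x => x 0%N)).
by rewrite /unit_vector eqxx => /eqP; rewrite oner_eq0.
Qed.

Definition swap (i j : nat) (l : nat) : nat := if l == i then j else if l == j then i else l.

Lemma swapK i j : involutive (swap i j).
Proof. by move=> l; rewrite /swap; do ?case: eqP => //; congruence. Qed.

Lemma swap_bij i j : bijective (swap i j). Proof. exact: inv_bij (swapK i j). Qed.

Lemma nE_unit n : nE (unit_vector n) = unit_norm.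
Proof.
have [_ h] := sss_perm hE (swap_bij 0 n) (sss_unit_vector hE 0%N).
rewrite /unit_norm -h; congr nE; apply/funext => i; rewrite /unit_vector /swap /=.
case: (eqVneq i 0%N) => [->|i0]; first by rewrite eq_sym.
by case: (eqVneq i n) => // _; rewrite (negbTE i0).
Qed.

Lemma E_coord x i : E x -> modulus (x i) * unit_norm <= nE x.
Proof.
move=> hx; rewrite -(nE_unit i) -(banach_normZ bE); last exact: sss_unit_vector.
have [|//] := @E_le x (x i *: unit_vector i) hx.
move=> j; rewrite -[(_ *: _) j]/(x i * (j == i)%:R).
by case: eqP => [->|_]; rewrite ?mulr1// mulr0 modulus0.
Qed.

Lemma E_ncv_coord (u : nat -> nat -> K) x i : (forall n, E (u n)) -> E x ->
  ncv E u x -> cvK (fun n => u n i) (x i).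
Proof.
move=> hu hx h; have k0 := unit_norm_gt0.
have h' : null (fun n => unit_norm^-1 * nE (u n - x)) by apply: nullM h; rewrite invr_ge0 ltW.
apply: null_le h' => n; rewrite mulrC ler_pdivlMr//.
exact: (@E_coord (u n - x) i (subspaceB lE (hu n) hx)).
Qed.

(** The norm limit has the same coordinates, because coordinates are continuous. *)
Lemma E_limit (u : nat -> nat -> K) x : (forall n, E (u n)) -> norm_cauchy E u ->
  (forall i, cvK (fun n => u n i) (x i)) -> E x /\ ncv E u x.
Proof.
move=> hu cu hx; have [z hz h] := banach_cauchy bE hu cu.
suff -> : x = z by [].
apply/funext => i; exact: cvK_uniq (hx i) (E_ncv_coord i hu hz h).
Qed.

Lemma E_null x : E x -> null (fun i => modulus (x i)).
Proof.
move=> hx; have k0 := unit_norm_gt0.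
have h' : null (fun n => unit_norm^-1 * nE (trunc n x - x)).
  by apply: nullM (E_basis hx); rewrite invr_ge0 ltW.
apply: null_le h' => n; rewrite mulrC ler_pdivlMr//.
have := @E_coord (trunc n x - x) n (subspaceB lE (E_trunc n x) hx).
by rewrite -[(_ - _) n]/(trunc n x n - x n) /trunc ltnn sub0r modulusN.
Qed.

Lemma E_bounded x : E x -> bounded_seq x (nE x / unit_norm).
Proof. by move=> hx i; rewrite ler_pdivlMr ?unit_norm_gt0//; exact: E_coord. Qed.

(** The expansion along the unit vectors converges absolutely. *)
Lemma E_summable x (C : R) : (forall n, \sum_(i < n) modulus (x i) <= C) -> E x.
Proof.
move=> hC; apply: E_cauchy => e e0.
have k0 := unit_norm_gt0.
have [N hN] := series_tail (fun i => modulus_ge0 (x i)) hC (divr_gt0 e0 k0).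
have aux m n : (N <= n)%N -> (n <= m)%N -> nE (trunc m x - trunc n x) < e.
  move=> Nn nm.
  have -> : trunc m x - trunc n x = \sum_(n <= i < m) x i *: unit_vector i.
    rewrite !truncE -!(big_mkord xpredT (fun i => x i *: unit_vector i)).
    by rewrite (big_cat_nat (leq0n n) nm) /= addrAC subrr add0r.
  apply: le_lt_trans (nnorm_sum bE _ _) _.
    by move=> i; apply: subspaceZ => //; exact: sss_unit_vector.
  under eq_bigr => i _ do rewrite (banach_normZ bE _ (sss_unit_vector hE i)) nE_unit.
  by rewrite -mulr_suml -ltr_pdivlMr// hN// Nn.
exists N => m n Nm Nn; have [mn|/ltnW nm] := leqP m n; last exact: aux.
by rewrite (nnormB bE); [exact: aux|exact: E_trunc|exact: E_trunc].
Qed.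

End SequenceSpace.

(** * Majorization and diagonals *)

Section Rearrangement.
Context {R : realType}.
Implicit Types (x y c : nat -> R).

Lemma sum_perm (T : nmodType) (F : nat -> T) (p : nat -> nat) n : injective p ->
  (forall i, (p i < n)%N = (i < n)%N) -> \sum_(i < n) F (p i) = \sum_(i < n) F i.
Proof.
move=> ip pn; rewrite -(big_mkord xpredT (fun i => F (p i))) -(big_mkord xpredT F).
rewrite -(big_map p xpredT F); apply: perm_big.
have us : uniq (map p (index_iota 0 n)) by rewrite map_inj_uniq// iota_uniq.
have sub : {subset map p (index_iota 0 n) <= index_iota 0 n}.
  by move=> _ /mapP[i hi ->]; rewrite mem_index_iota /= pn; rewrite mem_index_iota in hi.
have [_ e] := uniq_min_size us sub (eq_leq (esym (size_map _ _))).
by apply: uniq_perm => //; exact: iota_uniq.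
Qed.

Lemma sort_perm x n : exists p : nat -> nat, [/\ bijective p,
  forall i, (p i < n)%N = (i < n)%N &
  forall i j, (i <= j)%N -> (j < n)%N -> x (p j) <= x (p i)].
Proof.
pose le (i j : nat) := x j <= x i.
have tot : total le by move=> i j; exact: le_total.
have tr : transitive le by move=> i j l h1 h2; exact: le_trans h2 h1.
pose s := sort le (iota 0 n).
have ss : size s = n by rewrite size_sort size_iota.
have us : uniq s by rewrite sort_uniq iota_uniq.
have ms i : (i \in s) = (i < n)%N by rewrite mem_sort mem_iota.
pose p i := if (i < n)%N then nth 0%N s i else i.
pose q i := if (i < n)%N then index i s else i.
have hp i : (i < n)%N -> (nth 0%N s i < n)%N by move=> h; rewrite -ms mem_nth// ss.
have hq i : (i < n)%N -> (index i s < n)%N by move=> h; rewrite -[X in (_ < X)%N]ss index_mem ms.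
exists p; split.
- exists q => i; rewrite /p /q; case: (ltnP i n) => h.
  + by rewrite hp// index_uniq// ss.
  + by rewrite ltnNge h.
  + by rewrite hq// nth_index// ms.
  + by rewrite ltnNge h.
- move=> i; rewrite /p; case: (ltnP i n) => h; first by rewrite hp.
  by apply/negbTE; rewrite -leqNgt.
move=> i j ij jn; have in_ := leq_ltn_trans ij jn; rewrite /p jn in_.
have so : sorted le s by apply: sort_sorted.
by apply: (sorted_leq_nth tr _ 0%N so) => //; [move=> l; exact: lexx|rewrite inE ss|rewrite inE ss].
Qed.

(** Shifting weight to the first [l] indices increases the sum, as [x] is
    nonincreasing. *)
Lemma sum_weights c x n l : (forall i, 0 <= c i) -> (forall i, c i <= 1) ->
  \sum_(i < n) c i <= l%:R -> (l <= n)%N -> (forall i, 0 <= x i) ->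
  (forall i j, (i <= j)%N -> x j <= x i) ->
  \sum_(i < n) c i * x i <= \sum_(i < l) x i.
Proof.
move=> c0 c1 cl ln x0 xd.
have e (F : nat -> R) : \sum_(i < l) F i = \sum_(i < n) (i < l)%N%:R * F i.
  rewrite -(big_mkord xpredT F) -(big_mkord xpredT (fun i => (i < l)%N%:R * F i)).
  rewrite (big_cat_nat (leq0n l) ln) /= [X in _ = _ + X]big_nat [X in _ = _ + X]big1 ?addr0.
    by rewrite big_nat [RHS]big_nat; apply: eq_bigr => i /andP[_ ->]; rewrite mul1r.
  by move=> i /andP[li _]; rewrite ltnNge li mul0r.
have el : l%:R = \sum_(i < n) (i < l)%N%:R :> R.
  transitivity (\sum_(i < l) (1 : R)); first by rewrite sumr_const card_ord.
  by rewrite (e (fun=> 1)); apply: eq_bigr => i _; rewrite mulr1.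
rewrite e -subr_ge0 -sumrB.
apply: (@le_trans _ _ (\sum_(i < n) ((i < l)%N%:R - c i) * x l)).
  by rewrite -mulr_suml mulr_ge0// sumrB subr_ge0 -el.
apply: ler_sum => i _; rewrite -mulrBl; case: (ltnP i l) => h.
  by rewrite ler_wpM2l ?subr_ge0// xd// ltnW.
by rewrite sub0r !mulNr lerN2 ler_wpM2l// xd.
Qed.

End Rearrangement.

Section Majorization.
Context {R : realType} {k : scalar_kind}.
Local Notation K := (scalar_field R k).
Variable E : normed_space (nat -> K).
Hypothesis hE : symmetric_sequence_space E.
Local Notation nE := (nnorm E).
Implicit Types (x y r : nat -> R).
Let bE : is_banach E := sss_banach hE.
Let lE : linear_subspace (carrier E) := banach_submod bE.

Definition real_seq r : nat -> K := fun i => of_real (r i).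

Lemma E_real_seq r n : (forall i, (n <= i)%N -> r i = 0) -> E (real_seq r).
Proof.
move=> h; rewrite (_ : real_seq r = trunc n (real_seq r)); first exact: E_trunc.
apply/funext => i; rewrite /trunc; case: ltnP => // ni.
by rewrite /real_seq h// of_real0.
Qed.

(** Moving mass [d] from the coordinate [i] to a smaller coordinate [j]
    replaces [x] by an average of [x] and of a permutation of [x]. *)
Lemma E_transfer x n i j (d : R) : (forall l, (n <= l)%N -> x l = 0) ->
  0 <= d -> d <= x i - x j -> 0 < x i - x j -> i != j ->
  nE (real_seq (fun l => x l - d * (l == i)%:R + d * (l == j)%:R)) <= nE (real_seq x).
Proof.
move=> xn d0 dx xij ij.
have hx := E_real_seq xn.
have [hs ns] := sss_perm hE (swap_bij i j) hx.
pose t := d / (x i - x j).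
have t0 : 0 <= t by rewrite divr_ge0// ltW.
have t1 : t <= 1 by rewrite ler_pdivrMr// mul1r.
have dE : d = t * (x i - x j) by rewrite divfK// lt0r_neq0.
have -> : real_seq (fun l => x l - d * (l == i)%:R + d * (l == j)%:R) =
   of_real (1 - t) *: real_seq x + of_real t *: (real_seq x \o swap i j).
  apply/funext => l; rewrite -[RHS]/(of_real (1 - t) * of_real (x l) +
    of_real t * of_real (x (swap i j l))).
  rewrite -!of_realM -of_realD /real_seq dE /swap; congr of_real.
  case: (eqVneq l i) => [->|li]; first by rewrite (negbTE ij) /=; ring.
  by case: (eqVneq l j) => [->|lj] /=; ring.
apply: le_trans (banach_normD bE _ _) _; try by apply: subspaceZ.
rewrite !(banach_normZ bE)// ns !modulus_of_real !ger0_norm ?subr_ge0//.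
by rewrite -mulrDl subrK mul1r.
Qed.

(** Weak majorization, in the manner of Hardy, Littlewood and Polya. Let [q] be
    the first index with [x q < y q] and [p] a smaller index with [y p < x p].
    Moving mass from [p] to [q] until one of the two coordinates agrees with [y]
    does not increase the norm ([E_transfer]) and decreases the number of indices
    where the sequences differ. When no [q] is left, [y] is dominated
    coordinatewise. *)
Lemma E_majorization x y n : (forall i, (n <= i)%N -> x i = 0) ->
  (forall i, (n <= i)%N -> y i = 0) -> (forall i, 0 <= x i) -> (forall i, 0 <= y i) ->
  (forall i j, (i <= j)%N -> (j < n)%N -> y j <= y i) ->
  (forall l, (l <= n)%N -> \sum_(i < l) y i <= \sum_(i < l) x i) ->
  nE (real_seq y) <= nE (real_seq x).
Proof.
move=> xn yn x0 y0 yd.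
have [m] := ubnP #|[set i : 'I_n | x i != y i]%SET|.
elim: m x xn x0 => // m IH x xn x0; rewrite ltnS => hm hs.
have [hex|hno] := pselect (exists i, x i < y i); last first.
  have [//|_] := @E_le _ _ E hE (real_seq x) (real_seq y) (E_real_seq xn).
    move=> i; rewrite !modulus_of_real !ger0_norm// leNgt; apply/negP => h.
    by apply: hno; exists i.
  by [].
have [/= q hq qmin] := ex_minnP hex.
have qn : (q < n)%N.
  by rewrite ltnNge; apply/negP => /[dup] /xn h /yn h'; rewrite h h' ltxx in hq.
have below i : (i < q)%N -> y i <= x i.
  by move=> iq; rewrite leNgt; apply/negP => /qmin; rewrite leqNgt iq.
have [p pq hp] : exists2 p, (p < q)%N & y p < x p.
  apply: contrapT => hn.
  have := hs q.+1 qn; rewrite !big_ord_recr /= => h.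
  have : \sum_(i < q) x i <= \sum_(i < q) y i.
    apply: ler_sum => i _; rewrite leNgt; apply/negP => hlt; apply: hn; by exists i.
  move: h hq; lra.
have pn : (p < n)%N := ltn_trans pq qn.
have ypq : y q <= y p by apply: yd => //; exact: ltnW.
pose d := Num.min (x p - y p) (y q - x q).
have d0 : 0 < d by rewrite lt_min !subr_gt0 hp hq.
have dp : d <= x p - y p by rewrite ge_min lexx.
have dq : d <= y q - x q by rewrite ge_min lexx orbT.
have npq : p != q by rewrite neq_ltn pq.
pose x' l := x l - d * (l == p)%:R + d * (l == q)%:R.
have x'p : x' p = x p - d by rewrite /x' eqxx (negbTE npq) mulr1 mulr0 addr0.
have x'q : x' q = x q + d by rewrite /x' eqxx eq_sym (negbTE npq) mulr1 mulr0 subr0.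
have x'l l : l != p -> l != q -> x' l = x l.
  by move=> /negbTE h1 /negbTE h2; rewrite /x' h1 h2 !mulr0 subr0 addr0.
apply: (@le_trans _ _ (nE (real_seq x'))); last first.
  apply: E_transfer xn (ltW d0) _ _ npq; lra.
apply: IH.
- by move=> l nl; rewrite x'l ?xn//; apply: contraTneq nl => ->; rewrite -ltnNge.
- move=> l; case: (eqVneq l p) => [->|lp]; first by rewrite x'p; have := y0 p; lra.
  case: (eqVneq l q) => [->|lq]; first by rewrite x'q; have := x0 q; lra.
  by rewrite x'l.
- apply: leq_trans hm; apply: proper_card; apply/properP; split.
    apply/fintype.subsetP => l; rewrite !inE; case: (eqVneq (l : nat) p) => [->|lp].
      by rewrite (gt_eqF hp).
    case: (eqVneq (l : nat) q) => [->|lq]; first by rewrite (lt_eqF hq).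
    by rewrite x'l.
  have [h|h] := leP (x p - y p) (y q - x q).
    exists (Ordinal pn); rewrite !inE /=; first by rewrite (gt_eqF hp).
    by rewrite negbK x'p /d (min_idPl h) subKr.
  exists (Ordinal qn); rewrite !inE /=; first by rewrite (lt_eqF hq).
  by rewrite negbK x'q /d (min_idPr (ltW h)) addrC subrK.
move=> l ln.
have ind (a : nat) : \sum_(i < l) d * (val i == a)%:R = d * (a < l)%N%:R.
  rewrite -mulr_sumr; congr (_ * _); case: (ltnP a l) => al.
    rewrite (bigD1 (Ordinal al))//= eqxx big1 ?addr0// => i.
    by rewrite -val_eqE /= => /negbTE ->.
  rewrite big1// => i _; rewrite [_ == _](_ : _ = false)//.
  by apply/negP => /eqP h; have := ltn_ord i; rewrite h ltnNge al.
have -> : \sum_(i < l) x' i = \sum_(i < l) x i - d * (p < l)%N%:R + d * (q < l)%N%:R.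
  by rewrite -!ind -sumrB -big_split.
case: (ltnP q l) => ql; first by rewrite (ltn_trans pq ql) subrK hs.
case: (ltnP p l) => pl; last by rewrite !mulr0 subr0 addr0 hs.
rewrite mulr1 mulr0 addr0 (bigD1 (Ordinal pl))//= [in leRHS](bigD1 (Ordinal pl))//=.
have : \sum_(i < l | i != Ordinal pl) y i <= \sum_(i < l | i != Ordinal pl) x i.
  by apply: ler_sum => i _; apply: below; exact: leq_trans (ltn_ord i) ql.
lra.
Qed.

End Majorization.

(** * Taking diagonals is a contraction *)
Section Compression.
Context {R : realType} {k : scalar_kind}.
Local Notation K := (scalar_field R k).
Local Notation H := (ell2 R k).
Variable E : normed_space (nat -> K).
Hypothesis hE : symmetric_sequence_space E.
Local Notation nE := (nnorm E).
Implicit Types (e f g h : nat -> H) (a : nat -> K) (T S : H -> H).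
Let bE : is_banach E := sss_banach hE.
Let lE : linear_subspace (carrier E) := banach_submod bE.

Lemma pon_comp e (p : nat -> nat) : pon e -> injective p -> pon (e \o p).
Proof.
move=> [h1 h2] ip; split => [i j ij|i]; last exact: h2.
by apply: h1; apply: contra_neq ij => /ip.
Qed.

(** The diagonal of the matrix of [T] with respect to [g] and [h]. *)
Definition diag_of g h T : nat -> K := fun i => inner (T (g i)) (h i).

Section Fix.
Variables (e f g h : nat -> H).
Hypotheses (pe : pon e) (pf : pon f) (pg : pon g) (ph : pon h).

Let bsum (u : nat -> H) (x : H) n : pon u -> \sum_(i < n) modulus (inner x (u i)) ^+ 2 <= nr x ^+ 2.
Proof.
move=> pu; rewrite -(big_mkord xpredT (fun i => modulus (inner x (u i)) ^+ 2)).
exact: bessel pu (iota_uniq _ _).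
Qed.

Let amgm (a b : K) : modulus a * modulus b <= 2^-1 * modulus a ^+ 2 + 2^-1 * modulus b ^+ 2.
Proof.
have := sqr_ge0 (modulus a - modulus b); move: (modulus a) (modulus b) => u v; nra.
Qed.

(** The inequality of Bessel twice, after the inequality between arithmetic and
    geometric means. *)
Lemma gram_row j n :
  \sum_(i < n) modulus (inner (g j) (e i)) * modulus (inner (f i) (h j)) <= 1.
Proof.
apply: le_trans (ler_sum _ (fun i _ => amgm _ _)) _.
rewrite big_split -!mulr_sumr /=.
have h1 : \sum_(i < n) modulus (inner (g j) (e i)) ^+ 2 <= 1.
  by apply: le_trans (bsum _ _ pe) _; rewrite expr_le1// pon_nr_le1.
have h2 : \sum_(i < n) modulus (inner (f i) (h j)) ^+ 2 <= 1.
  under eq_bigr => i _ do rewrite inner_conj modulus_conj.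
  by apply: le_trans (bsum _ _ pf) _; rewrite expr_le1// pon_nr_le1.
lra.
Qed.

End Fix.

Lemma gram_col e f g h i n : pon e -> pon f -> pon g -> pon h ->
  \sum_(j < n) modulus (inner (g j) (e i)) * modulus (inner (f i) (h j)) <= 1.
Proof.
move=> pe pf pg ph; apply: le_trans (gram_row pg ph pe pf i n).
by apply: ler_sum => j _; rewrite (inner_conj (e i)) (inner_conj (h j)) !modulus_conj.
Qed.

(** The matrix with entries [<g_j, e_k> <f_k, h_j>] is doubly substochastic,
    hence its action on finite sequences does not increase a symmetric norm. *)
Lemma diag_jop_finite e f g h a n m : pon e -> pon f -> pon g -> pon h ->
  (forall i, (n <= i)%N -> a i = 0) ->
  nE (trunc m (diag_of g h (jop e f a))) <= nE a.
Proof.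
move=> pe pf pg ph an.
set y := trunc m _; pose N := maxn m n.
have aN i : (N <= i)%N -> a i = 0 by rewrite geq_max => /andP[_ /an].
have yN i : (N <= i)%N -> y i = 0.
  by rewrite geq_max => /andP[mi _]; rewrite /y /trunc ltnNge mi.
have [s [bs sN sd]] := sort_perm (fun i => modulus (a i)) N.
have [t [bt tN td]] := sort_perm (fun i => modulus (y i)) N.
have [is_ it] := (bij_inj bs, bij_inj bt).
pose x' i := modulus (a (s i)); pose y' i := modulus (y (t i)).
have x'N i : (N <= i)%N -> x' i = 0.
  by move=> Ni; rewrite /x' aN ?modulus0// leqNgt sN -leqNgt.
have y'N i : (N <= i)%N -> y' i = 0.
  by move=> Ni; rewrite /y' yN ?modulus0// leqNgt tN -leqNgt.
have hEa : E a.
  rewrite (_ : a = trunc n a); first exact: E_trunc.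
  by apply/funext => i; rewrite /trunc; case: ltnP => // /an.
have hEy : E y by exact: E_trunc.
have red (b : nat -> K) (p : nat -> nat) : E b -> bijective p ->
    nE (real_seq (k := k) (fun i => modulus (b (p i)))) = nE b.
  move=> hb bp; have [hbp <-] := sss_perm hE bp hb.
  have [|_ //] := @E_modulus_eq _ _ E hE (b \o p) (real_seq (k := k) (fun i =>
    modulus (b (p i)))) hbp.
  by move=> i; rewrite modulus_of_real ger0_norm.
rewrite -(red y t hEy bt) -(red a s hEa bs).
apply: (E_majorization hE (n := N)) => [||i|i|i j ij jN|l lN]; try exact: modulus_ge0.
- exact: x'N.
- exact: y'N.
- exact: td.
pose c i := \sum_(j < l) modulus (inner (g (t j)) (e (s i))) * modulus (inner (f (s i)) (h (t j))).
have pes := pon_comp pe is_; have pfs := pon_comp pf is_.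
have pgt := pon_comp pg it; have pht := pon_comp ph it.
have cx : \sum_(i < N) c i * x' i <= \sum_(i < l) x' i.
  apply: sum_weights => //.
  - by move=> i; apply: sumr_ge0 => j _; exact: mulr_ge0.
  - by move=> i; exact: (gram_col (s i) l pe pf pgt pht).
  - rewrite exchange_big /= -[l in leRHS]card_ord -sumr_const; apply: ler_sum => j _.
    exact: (gram_row pes pfs pgt pht).
  - by move=> i; exact: modulus_ge0.
  - move=> i j ij; have [jN|Nj] := ltnP j N; first exact: sd.
    by rewrite (x'N _ Nj); exact: modulus_ge0.
apply: le_trans cx.
under [leRHS]eq_bigr => i _ do rewrite mulr_suml.
rewrite exchange_big /=; apply: ler_sum => j _; rewrite /y /trunc; case: ifP => _; last first.
  by rewrite modulus0; apply: sumr_ge0 => i _; rewrite !mulr_ge0//; exact: modulus_ge0.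
rewrite /diag_of (jop_fin pe pf (p := N))// inner_suml.
rewrite -(sum_perm (fun i => inner ((a i * inner (g (t j)) (e i)) *: f i) (h (t j))) is_ sN).
apply: le_trans (modulus_sum _ _ _) _; apply: ler_sum => i _.
by rewrite innerZl !modulusM /x' -mulrA mulrC.
Qed.

Lemma jop_sub e f a (b : nat -> K) (M N : R) x : pon e -> pon f -> bounded_seq a M ->
  bounded_seq b N ->
  jop e f (a - b) x = jop e f a x - jop e f b x.
Proof.
move=> pe pf aM bN; have := jop_lin pe pf x bN aM (-1); rewrite scaleN1r addrC => <-.
by congr (jop _ _ _ x); apply/funext => i; rewrite -[LHS]/(a i - b i) mulN1r addrC.
Qed.

(** The case of finite [a] is [diag_jop_finite]. In general the diagonals of the
    truncations of [a] are Cauchy in [E], and converge in each coordinate to the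
    diagonal of [jop e f a]. *)
Lemma diag_jop e f g h a : pon e -> pon f -> pon g -> pon h -> E a ->
  E (diag_of g h (jop e f a)) /\ nE (diag_of g h (jop e f a)) <= nE a.
Proof.
move=> pe pf pg ph.
have fin_case b n : (forall i, (n <= i)%N -> b i = 0) ->
    E (diag_of g h (jop e f b)) /\ nE (diag_of g h (jop e f b)) <= nE b.
  move=> bn; have hb : E (diag_of g h (jop e f b)).
    apply: (E_summable hE (C := \sum_(i < n) modulus (b i))) => m.
    apply: (@le_trans _ _ (\sum_(j < m) \sum_(i < n) modulus (b i) *
        (modulus (inner (g j) (e i)) * modulus (inner (f i) (h j))))).
      apply: ler_sum => j _; rewrite /diag_of (jop_fin pe pf (p := n))// inner_suml.
      apply: le_trans (modulus_sum _ _ _) _; apply: ler_sum => i _.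
      by rewrite innerZl !modulusM mulrA.
    rewrite exchange_big /=; apply: ler_sum => i _.
    by rewrite -mulr_sumr ler_piMr//; exact: gram_col.
  split => //; apply: (ncv_norm_le bE (fun m => E_trunc hE m _) hb (E_basis hE hb)) => m.
  exact: diag_jop_finite bn.
move=> ha; pose u n := diag_of g h (jop e f (trunc n a)).
have tr n i : (n <= i)%N -> trunc n a i = 0 by move=> ni; rewrite /trunc ltnNge ni.
have hu n : E (u n) /\ nE (u n) <= nE (trunc n a) by apply: fin_case; exact: tr.
have bt n := E_bounded hE (E_trunc hE n a).
have ba := E_bounded hE ha.
have du (b c : nat -> K) : E b -> E c ->
    diag_of g h (jop e f b) - diag_of g h (jop e f c) = diag_of g h (jop e f (b - c)).
  move=> hb hc; apply/funext => i; rewrite /diag_of.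
  by rewrite (jop_sub _ pe pf (E_bounded hE hb) (E_bounded hE hc)) innerBl.
have cu : norm_cauchy E u.
  move=> d d0; have d2 : 0 < d / 2 by rewrite divr_gt0.
  have [N hN] := E_basis hE ha d2; exists N => m n Nm Nn.
  rewrite /u du; [|exact: E_trunc|exact: E_trunc].
  have [|_ hle] := @fin_case (trunc m a - trunc n a) (maxn m n).
    by move=> i; rewrite geq_max => /andP[mi ni];
      rewrite -[LHS]/(trunc m a i - trunc n a i) !tr// subrr.
  apply: le_lt_trans hle _.
  apply: le_lt_trans (nnorm_tri bE (E_trunc hE m a) ha (E_trunc hE n a)) _.
  rewrite (splitr d) ltrD ?hN// (nnormB bE)// ?hN//; exact: E_trunc.
have [i|hd hcv] := E_limit hE (x := diag_of g h (jop e f a)) (fun n => (hu n).1) cu.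
  have h' : null (fun n => (unit_norm E)^-1 * nE (trunc n a - a)).
    by apply: nullM (E_basis hE ha); rewrite invr_ge0 ltW ?unit_norm_gt0.
  apply: null_le h' => n; rewrite /u /diag_of -innerBl.
  have hta : E (trunc n a - a) by apply: subspaceB => //; exact: E_trunc.
  rewrite -(jop_sub _ pe pf (bt n) ba); apply: le_trans (cauchy_schwarz _ _) _.
  apply: (@le_trans _ _ (nr (jop e f (trunc n a - a) (g i))));
    first by rewrite ler_piMr ?pon_nr_le1.
  apply: le_trans (nr_jop pe pf _ (E_bounded hE hta)) _.
  rewrite mulrC [leRHS]mulrC ler_piMl ?pon_nr_le1// mulr_ge0 ?invr_ge0 ?(ltW (unit_norm_gt0 hE))//.
  exact: banach_norm_ge0.
split => //; apply: (ncv_norm_le bE (fun n => (hu n).1) hd hcv) => n.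
exact: le_trans (hu n).2 (E_trunc_le hE n ha).
Qed.

End Compression.

(** * Schatten spaces are Banach spaces *)

Section Schatten.
Context {R : realType} {k : scalar_kind}.
Local Notation K := (scalar_field R k).
Local Notation H := (ell2 R k).
Variable E : normed_space (nat -> K).
Hypothesis hE : symmetric_sequence_space E.
Local Notation nE := (nnorm E).
Local Notation C := (schatten E).
Local Notation nC := (nnorm C).
Implicit Types (e f g h : nat -> H) (a : nat -> K) (T S : H -> H).
Let bE : is_banach E := sss_banach hE.
Let lE : linear_subspace (carrier E) := banach_submod bE.
Local Notation kp := (unit_norm E).

Lemma fctE T S (c : K) x : (c *: T + S) x = c *: T x + S x. Proof. by []. Qed.
Lemma fctB T S x : (T - S) x = T x - S x. Proof. by []. Qed.

Definition svals T : nat -> K := fun j => of_real (singular_values T j).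

(** The singular values depend on [T] in a complicated way, but a diagonal is
    linear in [T]; this is what makes the norm of the Schatten space accessible. *)
Lemma svals_diag T : compact_operator T -> svals T = diag_of (rsv T) (lsv T) T.
Proof.
move=> cT; apply/funext => i; rewrite /svals (singular_valuesE cT) /diag_of [X in inner X _]lsvE
  innerZl inner_self.
have [->|li] := (lsv_pon cT).2 i; first by rewrite expr1n of_real1 mulr1.
by rewrite lsvE li scaler0 nr0 of_real0 mul0r.
Qed.

Lemma svals_jop T : compact_operator T -> T = jop (rsv T) (lsv T) (svals T).
Proof.
move=> cT; rewrite {1}(svd_op cT); congr jop; apply/funext => i.
by rewrite /svals (singular_valuesE cT).
Qed.

Lemma sch_compact T : C T -> compact_operator T. Proof. by case. Qed.
Lemma sch_svals T : C T -> E (svals T). Proof. by case. Qed.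
Lemma nCE T : nC T = nE (svals T). Proof. by []. Qed.

(** The singular values of [jop e f a] are its diagonal along its own singular
    vectors, which [diag_jop] bounds by [a]. *)
Lemma jop_schatten e f a : pon e -> pon f -> E a -> C (jop e f a) /\ nC (jop e f a) <= nE a.
Proof.
move=> pe pf ha.
have cT : compact_operator (jop e f a) by apply: jop_compact => //; exact: E_null hE _ ha.
have [h1 h2] := diag_jop hE pe pf (rsv_pon cT) (lsv_pon cT) ha.
by split; [split => //|rewrite nCE]; rewrite -/(svals (jop e f a)) svals_diag.
Qed.

(** By its singular value decomposition, [T] is some [jop e f s], to which
    [diag_jop] applies. *)
Lemma diag_schatten g h T : pon g -> pon h -> C T ->
  E (diag_of g h T) /\ nE (diag_of g h T) <= nC T.
Proof.
move=> pg ph hT; have cT := sch_compact hT.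
have := diag_jop hE (rsv_pon cT) (lsv_pon cT) pg ph (sch_svals hT).
by rewrite -svals_jop.
Qed.

Lemma sch_of_diag T : compact_operator T -> E (diag_of (rsv T) (lsv T) T) -> C T.
Proof. by move=> cT; rewrite -svals_diag// => h; split. Qed.

Lemma sch_sub0 : C 0.
Proof.
have p0 : pon (fun=> 0 : H) by split => *; rewrite ?inner0l//; right.
have := (jop_schatten p0 p0 (subspace0 lE)).1; congr (C _).
by apply/funext => x; apply: jop_eq0 => // i; rewrite inner0r mulr0.
Qed.

(** Along the singular vectors of the combination, its singular values are the
    combination of the diagonals of [T] and [S]; these are bounded by the norms of
    [T] and [S]. *)
Lemma sch_lin (c : K) T S : C T -> C S ->
  C (c *: T + S) /\ nC (c *: T + S) <= modulus c * nC T + nC S.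
Proof.
move=> hT hS; have cTS := compactD c (sch_compact hT) (sch_compact hS).
have [pg ph] := (rsv_pon cTS, lsv_pon cTS).
set g := rsv _ in pg; set h := lsv _ in ph.
have [dT nT] := diag_schatten pg ph hT; have [dS nS] := diag_schatten pg ph hS.
have dE : diag_of g h (c *: T + S) = c *: diag_of g h T + diag_of g h S.
  by apply/funext => i; rewrite /diag_of fctE innerDZl.
have hd : E (diag_of g h (c *: T + S)) by rewrite dE; exact: subspaceL.
split; first exact: sch_of_diag.
rewrite nCE svals_diag// -/g -/h dE.
apply: le_trans (banach_normD bE _ _) _ => //; first exact: subspaceZ.
by rewrite (banach_normZ bE)// lerD// ler_wpM2l.
Qed.

Lemma sch_ge0 T : C T -> 0 <= nC T.
Proof. by move=> hT; apply: (banach_norm_ge0 bE); exact: sch_svals. Qed.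

Lemma sch_op_le T x : C T -> nr (T x) <= nC T / kp * nr x.
Proof.
move=> hT; have cT := sch_compact hT; rewrite {1}(svals_jop cT).
exact: (nr_jop (rsv_pon cT) (lsv_pon cT) x (E_bounded hE (sch_svals hT))).
Qed.

Lemma sch_subspace : linear_subspace (carrier C).
Proof.
apply/linear_subspaceP; split; first exact: sch_sub0.
by move=> c T S hT hS; exact: (sch_lin c hT hS).1.
Qed.

Lemma sch_normZ_le (c : K) T : C T -> nC (c *: T) <= modulus c * nC T.
Proof.
move=> hT; have := (sch_lin c hT sch_sub0).2.
have n0 : nC 0 = 0.
  apply/eqP; rewrite eq_le (sch_ge0 sch_sub0) andbT.
  have p0 : pon (fun=> 0 : H) by split => *; rewrite ?inner0l//; right.
  have := (jop_schatten p0 p0 (subspace0 lE)).2; rewrite (nnorm0 bE).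
  rewrite (_ : jop _ _ _ = 0)//; apply/funext => x.
  by apply: jop_eq0 => // i; rewrite inner0r mulr0.
by rewrite n0 !addr0.
Qed.

(** A Cauchy sequence of operators has a pointwise limit [T], which is compact
    because the operator norm is dominated. For each pair of families the
    diagonals converge in [E]; along the singular vectors of [T] this shows that
    [T] is in [C], and along those of [u n - T] that the distance is small, with a
    bound that does not depend on the families. *)
Lemma sch_complete (u : nat -> H -> H) : (forall n, C (u n)) -> norm_cauchy C u ->
  exists2 T, C T & norm_cvg C u T.
Proof.
move=> hu cu; have k0 := unit_norm_gt0 hE.
have hsub m n : C (u m - u n) by apply: subspaceB => //; exact: sch_subspace.
have /choice[T hT] : forall x, exists y, cvH (fun n => u n x) y.
  move=> x; apply: cvH_complete => d d0.
  have d1 : 0 < d * kp / (nr x + 1) by rewrite divr_gt0 ?mulr_gt0// ltr_wpDl.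
  have [N hN] := cu _ d1; exists N => m n Nm Nn.
  rewrite -fctB; apply: le_lt_trans (sch_op_le _ (hsub m n)) _.
  have x1 : 0 < nr x + 1 by rewrite ltr_wpDl.
  apply: (@le_lt_trans _ _ (nC (u m - u n) / kp * (nr x + 1))).
    by rewrite ler_wpM2l ?lerDl// divr_ge0 ?(ltW k0)// sch_ge0.
  by rewrite -ltr_pdivlMr// ltr_pdivrMr// mulrAC; exact: hN.
have lT : linear T.
  move=> c x y; apply: cvH_uniq (hT _) _.
  apply: cvH_ext (cvHD (cvHZ c (hT x)) (hT y)) => n.
  by have [-> _ _] := (compactP (u n)).1 (sch_compact (hu n)).
have opc (d : R) N : 0 < d -> (forall m n, (N <= m)%N -> (N <= n)%N -> nC (u m - u n) < d) ->
    forall n, (N <= n)%N -> forall x, nr (u n x - T x) <= d / kp * nr x.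
  move=> d0 hN n Nn x.
  have h1 : cvH (fun m => u n x + (-1) *: u (m + N)%N x) (u n x + (-1) *: T x).
    by apply: cvHD (cvH_cst _) (cvHZ _ _); exact: (null_shift N (hT x)).
  rewrite scaleN1r in h1; apply: cvH_nr_le h1 _ => m; rewrite scaleN1r -fctB.
  apply: le_trans (sch_op_le _ (hsub _ _)) _; rewrite ler_wpM2r//.
  by rewrite ler_wpM2r ?invr_ge0 ?(ltW k0)// ltW// hN// leq_addl.
have cT : compact_operator T.
  apply: (@compact_limit _ _ u) => // [n|d d0]; first exact: sch_compact.
  have d1 : 0 < d * kp by rewrite mulr_gt0.
  have [N hN] := cu _ d1; exists N => x.
  by have := opc _ _ d1 hN N (leqnn _) x; rewrite mulfK// lt0r_neq0.
have diag_lim g h : pon g -> pon h ->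
  E (diag_of g h T) /\ ncv E (fun n => diag_of g h (u n)) (diag_of g h T).
  move=> pg ph; apply: (E_limit hE) => [n|d d0|i].
  - exact: (diag_schatten pg ph (hu n)).1.
  - have [N hN] := cu _ d0; exists N => m n Nm Nn.
    have -> : diag_of g h (u m) - diag_of g h (u n) = diag_of g h (u m - u n).
      by apply/funext => i; rewrite /diag_of fctB innerBl.
    apply: le_lt_trans (diag_schatten pg ph (hsub m n)).2 _; exact: hN.
  exact: cvH_inner.
have CT : C T by apply: sch_of_diag => //; exact: (diag_lim _ _ (rsv_pon cT) (lsv_pon cT)).1.
exists T => //; apply/nullP => [n|d d0].
  by apply: sch_ge0; apply: subspaceB => //; exact: sch_subspace.
have d2 : 0 < d / 2 by rewrite divr_gt0.
have [N hN] := cu _ d2; exists N => n Nn; apply: le_lt_trans (_ : d / 2 < d); last lra.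
have CS : C (u n - T) by apply: subspaceB => //; exact: sch_subspace.
have cS := sch_compact CS; have [pg ph] := (rsv_pon cS, lsv_pon cS).
rewrite nCE svals_diag//; set g := rsv _ in pg *; set h := lsv _ in ph *.
have [dT lim] := diag_lim g h pg ph.
have dB S S' : diag_of g h (S - S') = diag_of g h S - diag_of g h S'.
  by apply/funext => i; rewrite /diag_of fctB innerBl.
have h1 : ncv E (fun m => diag_of g h (u n) - diag_of g h (u (m + N)%N)) (diag_of g h (u n - T)).
  apply: null_le (null_shift N lim) => m; rewrite dB.
  rewrite opprD addrACA subrr add0r opprK addrC (nnormB bE)//.
  exact: (diag_schatten pg ph (hu _)).1.
apply: (ncv_norm_le bE _ _ h1) => [m||m].
- by rewrite -dB; exact: (diag_schatten pg ph (hsub _ _)).1.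
- exact: (diag_schatten pg ph CS).1.
rewrite -dB; apply: le_trans (diag_schatten pg ph (hsub _ _)).2 _.
by apply/ltW/hN => //; exact: leq_addl.
Qed.

Lemma schatten_banach : is_banach C.
Proof.
split.
- exact: sch_subspace.
- exact: sch_ge0.
- move=> T hT nT; have cT := sch_compact hT; rewrite (svals_jop cT).
  have -> : svals T = 0 by apply: (banach_norm_eq0 bE) => //; exact: sch_svals.
  by apply/funext => x; apply: jop_eq0 => i; rewrite -[(0 : nat -> K) i]/(0 : K) mul0r.
- move=> c T hT; apply/eqP; rewrite eq_le sch_normZ_le//=.
  have [->|c0] := eqVneq c 0.
    by rewrite modulus0 mul0r; apply: sch_ge0; rewrite scale0r; exact: sch_sub0.
  have hcT : C (c *: T) by apply: subspaceZ => //; exact: sch_subspace.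
  have := sch_normZ_le c^-1 hcT; rewrite scalerA mulVf// scale1r modulusV.
  have mc : 0 < modulus c by rewrite lt_def modulus_ge0 andbT; apply: contra_neq c0 => /modulus_eq0.
  by rewrite mulrC ler_pdivlMr// mulrC.
- by move=> T S hT hS; have := (sch_lin 1 hT hS).2; rewrite scale1r modulus1 mul1r.
- exact: sch_complete.
Qed.

(** * Projections and rank one operators in Schatten spaces *)

Lemma sch_linear T : C T -> linear T. Proof. by move=> [[]]. Qed.
Lemma sch_bounded T : C T -> bounded_op T.
Proof. by move=> hT; exists (nC T / kp) => x; exact: sch_op_le. Qed.

Definition oproj (p : H -> H) : Prop :=
  [/\ linear p, is_adjoint p p & forall x, p (p x) = p x].

Section Oproj.
Variable p : H -> H.
Hypothesis op : oproj p.

(** A projection is the average of the identity and of this reflection.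
    Reflections preserve orthonormality, hence act on [jop e f a] through [e] or
    [f]. *)
Definition refl_of x : H := (2%:R : K) *: p x - x.

Lemma refl_linear : linear refl_of.
Proof.
have [lp _ _] := op; move=> c x y; rewrite /refl_of lp; apply: ell2_eq => i.
by rewrite !(ell2_sub, ell2_add, ell2_scale, ell2_opp); ring.
Qed.

Lemma refl_adj : is_adjoint refl_of refl_of.
Proof.
have [_ ap _] := op; move=> x y; rewrite innerBl innerBr innerZl innerZr ap.
by rewrite mulr2n conjD conj1.
Qed.

Lemma reflK x : refl_of (refl_of x) = x.
Proof.
have [lp _ pp] := op; rewrite /refl_of (linB lp) (linZ lp) pp; apply: ell2_eq => i.
by rewrite !(ell2_sub, ell2_add, ell2_scale, ell2_opp); ring.
Qed.

Lemma pon_refl e : pon e -> pon (refl_of \o e).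
Proof.
move=> [h1 h2]; split => [i j ij|i] /=; first by rewrite refl_adj reflK h1.
have [e1|->] := h2 i; last by right; exact: lin0 refl_linear.
by left; apply: nr_of_self => //; rewrite refl_adj reflK inner_self e1.
Qed.

Lemma refl_bnd : bounded_op refl_of.
Proof.
exists 1 => x; rewrite mul1r; apply: nr_le_sqr => //.
rewrite -(@ler_of_real R k) -!inner_self refl_adj reflK lexx//.
Qed.

Lemma sch_refl_left T : C T -> C (refl_of \o T) /\ nC (refl_of \o T) <= nC T.
Proof.
move=> hT; have cT := sch_compact hT.
have [pe pf] := (rsv_pon cT, lsv_pon cT); have hs := sch_svals hT.
suff -> : refl_of \o T = jop (rsv T) (refl_of \o lsv T) (svals T).
  by apply: jop_schatten => //; exact: pon_refl.
apply/funext => x /=; rewrite {1}(svals_jop cT).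
apply: cvH_uniq (bounded_cvH refl_linear refl_bnd (jop_cvH pe pf x (E_bounded hE hs))) _.
apply: cvH_ext (jop_cvH pe (pon_refl pf) x (E_bounded hE hs)) => n.
rewrite (lin_sum refl_linear); apply: eq_bigr => i _.
by rewrite (linZ refl_linear).
Qed.

Lemma sch_refl_right T : C T -> C (T \o refl_of) /\ nC (T \o refl_of) <= nC T.
Proof.
move=> hT; have cT := sch_compact hT.
have [pe pf] := (rsv_pon cT, lsv_pon cT); have hs := sch_svals hT.
suff -> : T \o refl_of = jop (refl_of \o rsv T) (lsv T) (svals T).
  by apply: jop_schatten => //; exact: pon_refl.
apply/funext => x /=; rewrite {1}(svals_jop cT).
apply: cvH_uniq (jop_cvH pe pf _ (E_bounded hE hs)) _.
apply: cvH_ext (jop_cvH (pon_refl pe) pf x (E_bounded hE hs)) => n.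
by apply: eq_bigr => i _; rewrite refl_adj.
Qed.

Let half : K := of_real 2^-1.
Let half2 : half *+ 2 = 1.
Proof. by rewrite /half mulr2n -of_realD -of_real1; congr of_real; field. Qed.

Let avg T S : C T -> C S -> nC S <= nC T -> C (half *: (T + S)) /\ nC (half *: (T + S)) <= nC T.
Proof.
have bC := schatten_banach; have lC := banach_submod bC.
move=> hT hS h; split; first by apply: subspaceZ => //; exact: subspaceD.
rewrite (banach_normZ bC); last exact: subspaceD.
rewrite /half modulus_of_real ger0_norm ?invr_ge0//.
by have := banach_normD bC hT hS; lra.
Qed.

Lemma sch_proj_left T : C T -> C (p \o T) /\ nC (p \o T) <= nC T.
Proof.
move=> hT; have [h1 h2] := sch_refl_left hT.
suff -> : p \o T = half *: (T + (refl_of \o T)) by exact: (avg hT h1 h2).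
apply/funext => x; rewrite -[RHS]/(half *: (T x + refl_of (T x))) /refl_of addrC subrK.
by rewrite scalerA mulr_natr half2 scale1r.
Qed.

Lemma sch_proj_right T : C T -> C (T \o p) /\ nC (T \o p) <= nC T.
Proof.
move=> hT; have [h1 h2] := sch_refl_right hT; have lT := sch_linear hT.
suff -> : T \o p = half *: (T + (T \o refl_of)) by exact: (avg hT h1 h2).
apply/funext => x; rewrite -[RHS]/(half *: (T x + T (refl_of x))) -(linD lT) /refl_of addrC subrK.
by rewrite (linZ lT) scalerA mulr_natr half2 scale1r.
Qed.

End Oproj.

Definition rank1 (u v : H) : H -> H := fun x => inner x u *: v.

(** Normalizing [u] and [v] gives a [jop] with a single nonzero coefficient. *)
Lemma sch_rank1 u v : C (rank1 u v) /\ nC (rank1 u v) <= kp * (nr u * nr v).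
Proof.
pose nv (w : H) : nat -> H := fun i => if i is 0%N then of_real (nr w)^-1 *: w else 0.
have pv w : pon (nv w).
  split => [[|i] [|j] // _|[|i]] /=; rewrite ?inner0l ?inner0r//; last by right.
  have [w0|w0] := eqVneq (nr w) 0; first by right; rewrite (nr0_eq0 w0) scaler0.
  by left; rewrite nrZ modulus_of_real ger0_norm ?invr_ge0// mulVf.
have hu := sss_unit_vector hE 0%N.
pose a : nat -> K := of_real (nr u * nr v) *: unit_vector 0.
have ha : E a by exact: subspaceZ.
have na : nE a = kp * (nr u * nr v).
  by rewrite (banach_normZ bE)// modulus_of_real ger0_norm ?mulr_ge0// mulrC.
rewrite -na; suff -> : rank1 u v = jop (nv u) (nv v) a by exact: jop_schatten.
apply/funext => x; rewrite (jop_fin (pv u) (pv v) (p := 1)); last first.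
  by move=> [|i] // _; rewrite -[LHS]/(of_real (nr u * nr v) * unit_vector 0 i.+1) /unit_vector
    mulr0.
rewrite big_ord1 /= innerZr conj_of_real -[a 0%N]/(of_real (nr u * nr v) * unit_vector 0 0%N).
rewrite /unit_vector eqxx mulr1 scalerA /rank1.
have [u0|u0] := eqVneq (nr u) 0; first by rewrite (nr0_eq0 u0) inner0r !(mulr0,mul0r) !scale0r.
have [v0|v0] := eqVneq (nr v) 0; first by rewrite (nr0_eq0 v0) !scaler0.
congr (_ *: _); transitivity (of_real ((nr u * nr v) * (nr u)^-1 * (nr v)^-1) * inner x u).
  by rewrite mulrAC mulfK// mulfV// of_real1 mul1r.
by rewrite !of_realM; ring.
Qed.

Lemma oproj_fin m : oproj (fun x => fin m x).
Proof.
split; [exact: fin_linear|move=> x y|by move=> x; apply: ell2_eq => i; rewrite !finE;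
  case: (i < m)%N].
rewrite !fin_sum inner_suml inner_sumr; apply: eq_bigr => i _.
rewrite innerZl innerZr inner_delta mulrC; congr (_ * _).
by rewrite inner_conj inner_delta.
Qed.

Lemma oproj_compl p : oproj p -> oproj (fun x => x - p x).
Proof.
move=> [lp ap pp]; split.
- by move=> c x y; rewrite lp scalerBr opprD addrACA.
- by move=> x y; rewrite innerBl innerBr ap.
by move=> x; rewrite (linB lp) pp subrr subr0.
Qed.

End Schatten.

(** * Complemented subspaces *)

Section LinearOn.
Context {R : realType} {k : scalar_kind}.
Local Notation K := (scalar_field R k).
Context {V W : lmodType K}.
Variables (Y : set V) (f : V -> W).
Hypotheses (lY : linear_subspace Y) (lf : linear_on Y f).

Lemma linear_on0 : f 0 = 0.
Proof.
have Y0 := subspace0 lY; have := lf (-1) Y0 Y0.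
by rewrite scaler0 addr0 => ->; rewrite scaleN1r addNr.
Qed.
Lemma linear_onD x y : Y x -> Y y -> f (x + y) = f x + f y.
Proof. by move=> hx hy; rewrite -[x]scale1r lf// !scale1r. Qed.
Lemma linear_onZ c x : Y x -> f (c *: x) = c *: f x.
Proof. by move=> hx; rewrite -[c *: x]addr0 lf ?linear_on0 ?addr0//; exact: subspace0. Qed.
Lemma linear_onB x y : Y x -> Y y -> f (x - y) = f x - f y.
Proof.
move=> hx hy; have e : f (- y) = - f y by rewrite -scaleN1r linear_onZ// scaleN1r.
by rewrite linear_onD ?e//; exact: subspaceN.
Qed.
Lemma linear_on_sum (I : Type) (r : seq I) (F : I -> V) : (forall i, Y (F i)) ->
  f (\sum_(i <- r) F i) = \sum_(i <- r) f (F i).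
Proof.
move=> hF; elim: r => [|i r IH]; first by rewrite !big_nil linear_on0.
by rewrite !big_cons linear_onD ?IH//; exact: subspace_sum.
Qed.

(** A finite basis of the image lifts to a basis of [Y]. *)
Lemma infinite_dim_image : (forall x, Y x -> f x = 0 -> x = 0) ->
  infinite_dim Y -> infinite_dim (f @` Y).
Proof.
move=> fI iY n hd.
have f0 : (f @` Y) 0 by exists 0; [exact: subspace0|exact: linear_on0].
have [b [bY bI bS]] := hd.
have bYi i : (f @` Y) (b i).
  have := bY (delta_mx ord0 i) I; rewrite (bigD1 i)//= mxE !eqxx scale1r big1 ?addr0//.
  by move=> j ji; rewrite mxE (negbTE ji) andbF scale0r.
have /choice[c hc] : forall i, exists x, Y x /\ f x = b i.
  by move=> i; have [x hx <-] := bYi i; exists x.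
have sumY (u : 'rV[K]_n) : Y (\sum_(i < n) u ord0 i *: c i).
  by apply: subspace_sum => // i; apply: subspaceZ => //; exact: (hc i).1.
have fsum (u : 'rV[K]_n) : f (\sum_(i < n) u ord0 i *: c i) = \sum_(i < n) u ord0 i *: b i.
  rewrite linear_on_sum; last by move=> i; apply: subspaceZ => //; exact: (hc i).1.
  by apply: eq_bigr => i _; rewrite linear_onZ ?(hc i).2//; exact: (hc i).1.
apply: (iY n); exists c; split.
- by move=> u _; exact: sumY.
- by move=> u v _ _ huv; apply: bI; rewrite ?inE// -!fsum huv.
move=> x hx; have [u _ hu] := bS (f x) (ex_intro2 _ _ x hx erefl).
exists u => //; apply/eqP; rewrite -subr_eq0; apply/eqP/fI.
  by apply: subspaceB.
by rewrite linear_onB// fsum hu subrr.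
Qed.
End LinearOn.

Section Projections.
Context {R : realType} {k : scalar_kind}.
Local Notation K := (scalar_field R k).

Lemma bounded_linearP (V W : lmodType K) (X : normed_space V) (Y : normed_space W) f :
  is_banach X -> bounded_linear X Y f ->
  exists2 C : R, 0 <= C & forall x, X x -> nnorm Y (f x) <= C * nnorm X x.
Proof.
move=> bX [_ _ [C hC]]; exists (Num.max C 0); first by rewrite le_max lexx orbT.
move=> x hx; apply: le_trans (hC x hx) _; apply: ler_wpM2r.
  exact: banach_norm_ge0.
by rewrite le_max lexx.
Qed.

Context {V : lmodType K}.
Variable X : normed_space V.
Hypothesis bX : is_banach X.
Let lX : linear_subspace (carrier X) := banach_submod bX.

(** If [P] fixes every [u n], it fixes their limit. *)
Lemma complemented_closed (Z : set V) : complemented X Z -> closed_subspace X Z.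
Proof.
move=> [P [bP PP <-]]; have [C C0 hC] := bounded_linearP bX bP; have [PX lP _] := bP.
split.
- by move=> _ [x hx <-]; exact: PX.
- apply/linear_subspaceP; split; first by exists 0; [exact: subspace0|exact: linear_on0 lX lP].
  move=> c _ _ [x hx <-] [y hy <-]; exists (c *: x + y); last exact: lP.
  exact: subspaceL.
move=> u x hu hx ux; exists x => //.
have uX n : X (u n) by have [y hy <-] := hu n; exact: PX.
have Pu n : P (u n) = u n by have [y hy <-] := hu n; rewrite PP.
have ucv := (norm_cvgP bX uX hx).1 ux.
apply: (ncv_uniq bX uX (PX _ hx) hx _ ucv).
apply: null_le (nullM C0 ucv) => n; rewrite -{1}(Pu n) -(linear_onB lX lP)//.
by apply: hC; exact: subspaceB.
Qed.

Definition bounded_functional (phi : V -> K) : Prop :=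
  (forall (c : K) x y, X x -> X y -> phi (c *: x + y) = c * phi x + phi y) /\
  exists C : R, forall x, X x -> modulus (phi x) <= C * nnorm X x.

(** If [phi] does not vanish on [W], choose [w0] in [W] with [phi w0 = 1]: the map
    [x |-> Q x - phi (Q x) *: w0], where [Q] is the projection onto [W], projects
    onto the kernel. A finite basis of the kernel, with [w0] added, would be a
    basis of [W]. *)
Lemma complemented_ker (W : set V) phi : bounded_functional phi ->
  complemented X W -> infinite_dim W ->
  complemented X [set w | W w /\ phi w = 0] /\ infinite_dim [set w | W w /\ phi w = 0].
Proof.
move=> [lphi [D hD]] cW iW; have [WX lW _] := complemented_closed cW.
have [[w1 [hw1 n1]]|hno] := pselect (exists w, W w /\ phi w <> 0); last first.
  suff -> : [set w | W w /\ phi w = 0] = W by [].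
  apply/seteqP; split => [w []//|w hw]; split => //.
  by apply: contrapT => h; apply: hno; exists w.
have phi0 : phi 0 = 0.
  have X0 := subspace0 lX; have := lphi (-1) 0 0 X0 X0.
  by rewrite scaler0 addr0 => ->; rewrite mulN1r addNr.
have phiZ c x : X x -> phi (c *: x) = c * phi x.
  by move=> hx; rewrite -[c *: x]addr0 lphi// ?phi0 ?addr0//; exact: subspace0.
have phiB x y : X x -> X y -> phi (x - y) = phi x - phi y.
  move=> hx hy; rewrite addrC -scaleN1r lphi// mulN1r addrC//.
pose w0 := (phi w1)^-1 *: w1.
have hw0 : W w0 by exact: subspaceZ.
have pw0 : phi w0 = 1 by rewrite phiZ ?mulVf//; [exact/eqP|exact: WX].
clearbody w0.
split.
  have [Q [bQ QQ QW]] := cW; have [C C0 hC] := bounded_linearP bX bQ.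
  have [QX lQ _] := bQ.
  have QWx x : X x -> W (Q x) by move=> hx; rewrite -QW; exists x.
  have Qid w : W w -> Q w = w by rewrite -QW => -[x hx <-]; rewrite QQ.
  exists (fun x => Q x - phi (Q x) *: w0); split.
  - split.
    + by move=> x hx; apply: subspaceB => //; [exact: QX|apply: subspaceZ => //; exact: WX].
    + move=> c x y hx hy /=; rewrite lQ// lphi; [|exact: QX|exact: QX].
      by rewrite scalerBr scalerA scalerDl opprD addrACA.
    exists (C + Num.max D 0 * C * nnorm X w0) => x hx.
    have Qx := QX _ hx; have w0X := WX _ hw0.
    apply: le_trans (nnorm_tri bX Qx (subspace0 lX) _) _; first exact: subspaceZ.
    rewrite subr0 sub0r (nnormN bX); last exact: subspaceZ.
    rewrite (banach_normZ bX)// mulrDl; apply: lerD; first exact: hC.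
    rewrite mulrAC; apply: ler_wpM2r; first exact: banach_norm_ge0.
    apply: (@le_trans _ _ (Num.max D 0 * nnorm X (Q x))).
      apply: le_trans (hD _ Qx) _; apply: ler_wpM2r; first exact: banach_norm_ge0.
      by rewrite le_max lexx.
    by rewrite -mulrA; apply: ler_wpM2l; [rewrite le_max lexx orbT|exact: hC].
  - move=> x hx.
    have h : W (Q x - phi (Q x) *: w0) by apply: subspaceB => //; [exact: QWx|exact: subspaceZ].
    rewrite (Qid _ h) phiB; [|exact: QX|by apply: subspaceZ => //; exact: WX].
    by rewrite phiZ ?pw0 ?mulr1 ?subrr ?scale0r ?subr0//; exact: WX.
  apply/seteqP; split => [_ [x hx <-]|w [hw pw]].
    split; first by apply: subspaceB => //; [exact: QWx|exact: subspaceZ].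
    rewrite phiB; [|exact: QX|by apply: subspaceZ => //; exact: WX].
    by rewrite phiZ ?pw0 ?mulr1 ?subrr//; exact: WX.
  by exists w; [exact: WX|rewrite (Qid _ hw) pw scale0r subr0].
move=> n [b [bY bI bS]]; apply: (iW n.+1).
have sW (u : 'rV[K]_n) : W (\sum_(i < n) u ord0 i *: b i) /\ phi (\sum_(i < n) u ord0 i *: b i) = 0.
  by have := bY u I.
pose b' (i : 'I_n.+1) := if unlift ord0 i is Some j then b j else w0.
pose tl (u : 'rV[K]_n.+1) : 'rV[K]_n := \row_i u ord0 (lift ord0 i).
have sE (u : 'rV[K]_n.+1) : \sum_(i < n.+1) u ord0 i *: b' i =
    u ord0 ord0 *: w0 + \sum_(i < n) (tl u) ord0 i *: b i.
  rewrite big_ord_recl /b' unlift_none; congr (_ + _); apply: eq_bigr => i _.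
  by rewrite liftK mxE.
have sphi (u : 'rV[K]_n.+1) : phi (\sum_(i < n.+1) u ord0 i *: b' i) = u ord0 ord0.
  rewrite sE lphi; [|exact: WX|exact/WX/(sW _).1].
  by rewrite (sW _).2 pw0 mulr1 addr0.
exists b'; split.
- move=> u _ /=; rewrite sE; apply: subspaceL => //; exact: (sW _).1.
- move=> u v _ _ huv; have h0 : u ord0 ord0 = v ord0 ord0 by rewrite -!sphi huv.
  move: huv; rewrite /= !sE h0 => /addrI/bI; rewrite !inE => /(_ I I) ht.
  apply/rowP => i; case: (unliftP ord0 i) => [j ->|->//].
  by have := congr1 (fun u : 'rV_n => u ord0 j) ht; rewrite !mxE.
move=> w hw; have hwX := WX _ hw; have w0X := WX _ hw0.
have [|u _ hu] := bS (w - phi w *: w0).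
  split; first by apply: subspaceB => //; exact: subspaceZ.
  by rewrite phiB ?phiZ ?pw0 ?mulr1 ?subrr//; exact: subspaceZ.
exists (\row_i (if unlift ord0 i is Some j then u ord0 j else phi w)) => //.
rewrite sE mxE unlift_none.
have -> : tl (\row_i (if unlift ord0 i is Some j then u ord0 j else phi w)) = u.
  by apply/rowP => j; rewrite !mxE liftK.
by rewrite hu addrC subrK.
Qed.

Lemma complemented_kers (W : set V) (phi : nat -> V -> K) M :
  (forall n, bounded_functional (phi n)) -> complemented X W -> infinite_dim W ->
  complemented X [set w | W w /\ forall n, (n < M)%N -> phi n w = 0] /\
  infinite_dim [set w | W w /\ forall n, (n < M)%N -> phi n w = 0].
Proof.
move=> hphi cW iW; elim: M => [|M [IH1 IH2]].
  suff -> : [set w | W w /\ forall n, (n < 0)%N -> phi n w = 0] = W by [].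
  by apply/seteqP; split => [w []|w hw].
have := complemented_ker (hphi M) IH1 IH2.
suff -> : [set w | W w /\ forall n, (n < M.+1)%N -> phi n w = 0] =
  [set w | [set w | W w /\ forall n, (n < M)%N -> phi n w = 0] w /\ phi M w = 0] by [].
apply/seteqP; split => w /=.
  by move=> [hw h]; split; [split => // n hn; apply: h; exact: ltnW|exact: h].
move=> [[hw h] hM]; split => // n; rewrite ltnS leq_eqVlt => /predU1P[->//|]; exact: h.
Qed.

Lemma null_half : null (fun n => (2^-1 : R) ^+ n).
Proof.
apply: null_le (@null_inv R) => n; rewrite exprVn lef_pV2 ?posrE ?exprn_gt0//.
by rewrite -natrX ler_nat; exact: ltn_expl.
Qed.

(** The iteration [u n.+1 = v + G (u n)] converges. *)
Lemma neumann (W : set V) (G : V -> V) : closed_subspace X W ->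
  {homo G : w / W w >-> W w} -> linear_on W G ->
  (forall w, W w -> nnorm X (G w) <= 2^-1 * nnorm X w) ->
  forall v, W v -> exists w, [/\ W w, w = v + G w & nnorm X w <= 2 * nnorm X v].
Proof.
move=> [WX lW cW] GW lG hG v hv.
pose u := fix u n := if n is m.+1 then v + G (u m) else 0.
have uW n : W (u n).
  by elim: n => [|n IH]; [exact: subspace0|apply: subspaceD => //; exact: GW].
have uX n : X (u n) := WX _ (uW n).
have vX := WX _ hv.
have un n : nnorm X (u n) <= 2 * nnorm X v.
  elim: n => [|n IH] /=; first by rewrite (nnorm0 bX) mulr_ge0// (banach_norm_ge0 bX).
  apply: le_trans (banach_normD bX _ _) _ => //; first exact/WX/GW.
  by have := hG _ (uW n); lra.
have ud p n : nnorm X (u (n + p)%N - u n) <= 2^-1 ^+ n * (2 * nnorm X v).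
  elim: n => [|n IH]; first by rewrite expr0 mul1r subr0 un.
  rewrite addSn /= opprD addrACA subrr add0r -(linear_onB lW lG)//.
  apply: le_trans (hG _ _) _; first exact: subspaceB.
  by rewrite exprS -mulrA ler_wpM2l.
have cu : norm_cauchy X u.
  move=> d d0; have v0 := banach_norm_ge0 bX vX.
  have h := nullM (mulr_ge0 (ler0n R 2) v0) null_half.
  have [N hN] := h d d0; exists N.
  have aux m n : (N <= n)%N -> (n <= m)%N -> nnorm X (u m - u n) < d.
    move=> Nn nm; rewrite -(subnKC nm); apply: le_lt_trans (ud _ _) _.
    by rewrite mulrC; exact: hN.
  move=> m n Nm Nn; have [mn|/ltnW nm] := leqP m n; last exact: aux.
  by rewrite (nnormB bX)//; exact: aux.
have [w wX uw] := banach_cauchy bX uX cu.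
have wW : W w by apply: (cW u w uW wX); apply/(norm_cvgP bX).
exists w; split => //; last by apply: (ncv_norm_le bX uX wX uw) => n; exact: un.
have GX x : W x -> X (G x) by move=> hx; exact/WX/GW.
apply: (ncv_uniq bX (fun n => uX n.+1)) => //.
- by apply: subspaceD => //; exact: GX.
- by move=> d /uw[N hN]; exists N => n Nn; apply: hN; exact: leqW.
have half0 : 0 <= 2^-1 :> R by rewrite invr_ge0.
apply: null_le (nullM half0 uw) => n.
rewrite /= opprD addrACA subrr add0r -(linear_onB lW lG)//.
by apply: hG; exact: subspaceB.
Qed.

End Projections.

(** * Left inverses and small perturbations *)
Section Perturbation.
Context {R : realType} {k : scalar_kind}.
Local Notation K := (scalar_field R k).
Context {V V' : lmodType K}.
Variables (X : normed_space V) (E : normed_space V').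
Hypotheses (bX : is_banach X) (bE : is_banach E).

(** The projection is [A \o P]. *)
Lemma retract_complemented (W : set V') (A : V' -> V) (P : V -> V') (B : R) :
  linear_subspace W -> W `<=` carrier E -> {homo A : w / W w >-> X w} -> linear_on W A ->
  (forall w, W w -> nnorm X (A w) <= B * nnorm E w) ->
  bounded_linear X E P -> (forall T, X T -> W (P T)) -> (forall w, W w -> P (A w) = w) ->
  complemented X (A @` W).
Proof.
move=> lW WE AX lA hB bP PW PA; have [C C0 hC] := bounded_linearP bX bP.
have [_ lP _] := bP; exists (A \o P); split.
- split => [T hT|c T S hT hS|] /=; first exact/AX/PW.
    by rewrite lP// lA//; exact: PW.
  exists (Num.max B 0 * C) => T hT; apply: le_trans (hB _ (PW _ hT)) _.
  apply: (@le_trans _ _ (Num.max B 0 * nnorm E (P T))).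
    by apply: ler_wpM2r; [exact/(banach_norm_ge0 bE)/WE/PW|rewrite le_max lexx].
  by rewrite -mulrA; apply: ler_wpM2l; [rewrite le_max lexx orbT|exact: hC].
- by move=> T hT /=; rewrite PA//; exact: PW.
apply/seteqP; split => [_ [T hT <-]|_ [w hw <-]]; first by exists (P T) => //; exact: PW.
by exists (A w); [exact: AX|rewrite /= PA].
Qed.

(** On [W], which is the range of the projection [Q], the operator [Q \o D \o A]
    differs from the identity by at most one half, hence is invertible
    ([neumann]). Following [Q \o D] by this inverse gives the left inverse of [A]. *)
Lemma perturbed_retraction (W : set V') (A : V' -> V) (D : V -> V') (Q : V' -> V') (C th : R) :
  bounded_linear X E D -> (forall T, X T -> nnorm E (D T) <= nnorm X T) ->
  bounded_linear E E Q -> (forall x, E x -> Q (Q x) = Q x) -> Q @` carrier E = W ->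
  0 <= C -> (forall x, E x -> nnorm E (Q x) <= C * nnorm E x) ->
  {homo A : w / W w >-> X w} -> linear_on W A ->
  (forall w, W w -> nnorm E (w - D (A w)) <= th * nnorm E w) -> C * th <= 2^-1 ->
  exists P, [/\ bounded_linear X E P, forall T, X T -> W (P T) & forall w, W w -> P (A w) = w].
Proof.
move=> bD hD bQ QQ QW C0 hC AX lA hth hCth.
have cW : closed_subspace E W by apply: complemented_closed => //; exists Q.
have [WE lW clW] := cW; have [DE lD _] := bD; have [QE lQ _] := bQ.
have lX := banach_submod bX; have lE := banach_submod bE.
have QWx x : E x -> W (Q x) by move=> hx; rewrite -QW; exists x.
have Qid w : W w -> Q w = w by rewrite -QW => -[x hx <-]; rewrite QQ.
pose G w := w - Q (D (A w)).
have DA w : W w -> E (D (A w)) by move=> hw; exact/DE/AX.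
have GW : {homo G : w / W w >-> W w}.
  by move=> w hw; apply: subspaceB => //; exact/QWx/DA.
have lG : linear_on W G.
  move=> c x y hx hy; rewrite /G lA// lD; [|exact: AX|exact: AX].
  by rewrite lQ; [rewrite scalerBr opprD addrACA|exact: DA|exact: DA].
have hG w : W w -> nnorm E (G w) <= 2^-1 * nnorm E w.
  move=> hw; have -> : G w = Q (w - D (A w)).
    by rewrite (linear_onB lE lQ) ?(Qid _ hw)//; [exact: WE|exact: DA].
  have hE' : E (w - D (A w)) by apply: subspaceB => //; [exact: WE|exact: DA].
  apply: le_trans (hC _ hE') _; apply: le_trans (ler_wpM2l C0 (hth _ hw)) _.
  by rewrite mulrA; apply: ler_wpM2r => //; apply: (banach_norm_ge0 bE); exact: WE.
have Guniq w : W w -> w = G w -> w = 0.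
  move=> hw e; apply: (banach_norm_eq0 bE); first exact: WE.
  have h0 := banach_norm_ge0 bE (WE _ hw).
  have h := hG _ hw; rewrite -e in h; lra.
have /choice[sol hsol] : forall v, exists w, W v ->
    [/\ W w, w = v + G w & nnorm E w <= 2 * nnorm E v].
  move=> v; have [hv|nv] := pselect (W v); last by exists 0.
  by have [w hw] := neumann bE cW GW lG hG hv; exists w.
have solE v w : W v -> W w -> Q (D (A w)) = v -> sol v = w.
  move=> hv hw e; have [h1 h2 _] := hsol v hv.
  apply/eqP; rewrite -subr_eq0; apply/eqP/Guniq; first exact: subspaceB.
  have Gw : G w = w - v by rewrite /G e.
  by rewrite (linear_onB lW lG)// Gw opprB addrA [G _ + v]addrC -h2.
have solQ v : W v -> Q (D (A (sol v))) = v.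
  move=> hv; have [h1 h2 _] := hsol v hv.
  move: h2; rewrite /G addrA => /eqP; rewrite eq_sym subr_eq [sol v + _]addrC.
  by move=> /eqP/addIr <-.
exists (fun T => sol (Q (D T))); split.
- split.
  + by move=> T hT; have [h _ _] := hsol _ (QWx _ (DE _ hT)); exact: WE.
  + move=> c T S hT hS /=; have hv := QWx _ (DE _ hT); have hw := QWx _ (DE _ hS).
    have [h1 _ _] := hsol _ hv; have [h2 _ _] := hsol _ hw.
    rewrite (lD _ _ _ hT hS) (lQ _ _ _ (DE _ hT) (DE _ hS)).
    apply: solE; [exact: subspaceL|exact: subspaceL|].
    by rewrite lA// lD; [rewrite lQ ?solQ//; exact: DA|exact: AX|exact: AX].
  exists (2 * C) => T hT; have [_ _ h3] := hsol _ (QWx _ (DE _ hT)).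
  apply: le_trans h3 _; rewrite -mulrA ler_wpM2l//.
  apply: le_trans (hC _ (DE _ hT)) _; apply: ler_wpM2l => //; exact: hD.
- by move=> T hT; have [] := hsol _ (QWx _ (DE _ hT)).
by move=> w hw; apply: solE => //; exact/QWx/DA.
Qed.

End Perturbation.

Lemma sub_sub_same (V : zmodType) (a b c : V) : (a - b) - (a - c) = c - b.
Proof. by rewrite opprB [LHS]addrC addrA subrK. Qed.

(** * Subspaces on which the norm is Hilbertian *)
Section Hilbertian.
Context {R : realType} {k : scalar_kind}.
Local Notation K := (scalar_field R k).
Context {V : lmodType K}.
Variable X : normed_space V.
Hypothesis bX : is_banach X.
Variables (B : V -> V -> K) (q : V -> R).
Hypotheses
  (Bl : forall (c : K) x y z, X x -> X y -> X z -> B (c *: x + y) z = c * B x z + B y z)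
  (Bc : forall x y, X x -> X y -> B y x = scalar_conj (B x y))
  (Bq : forall x, X x -> B x x = of_real (q x))
  (q0 : forall x, X x -> 0 <= q x).
Let lX : linear_subspace (carrier X) := banach_submod bX.

Lemma form0 z : X z -> B 0 z = 0.
Proof.
move=> hz; have X0 := subspace0 lX; have := Bl (-1) X0 X0 hz.
by rewrite scaler0 addr0 => ->; rewrite mulN1r addNr.
Qed.
Lemma formZ c x z : X x -> X z -> B (c *: x) z = c * B x z.
Proof. by move=> hx hz; rewrite -[c *: x]addr0 Bl ?form0 ?addr0//; exact: subspace0. Qed.
Lemma formD x y z : X x -> X y -> X z -> B (x + y) z = B x z + B y z.
Proof. by move=> hx hy hz; rewrite -[x]scale1r Bl// !scale1r mul1r. Qed.
Lemma formB x y z : X x -> X y -> X z -> B (x - y) z = B x z - B y z.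
Proof.
by move=> hx hy hz; rewrite addrC -scaleN1r Bl// mulN1r addrC.
Qed.
Lemma formBr x y z : X x -> X y -> X z -> B z (x - y) = B z x - B z y.
Proof.
move=> hx hy hz; have hxy : X (x - y) by exact: subspaceB.
by rewrite (Bc hxy hz) formB// conjD conjN -!Bc.
Qed.
Lemma formZr c x z : X x -> X z -> B z (c *: x) = scalar_conj c * B z x.
Proof.
move=> hx hz; have hcx : X (c *: x) by exact: subspaceZ.
by rewrite (Bc hcx hz) formZ// conjM -Bc.
Qed.

Lemma form_quadratic u v (t : R) : X u -> X v ->
  q (u - (of_real t * B u v) *: v) = q u - 2 * t * modulus (B u v) ^+ 2 +
    t ^+ 2 * modulus (B u v) ^+ 2 * q v.
Proof.
move=> hu hv; set c := B u v; apply: (@of_real_inj R k).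
have hcv : X ((of_real t * c) *: v) by exact: subspaceZ.
rewrite -Bq; last exact: subspaceB.
rewrite formB//; last exact: subspaceB.
rewrite !formBr// !formZ// !formZr// (Bc hu hv) -/c !Bq// conjM conj_of_real.
rewrite !of_realD of_realN !of_realM.
have e1 : of_real (modulus c) * of_real (modulus c) = c * scalar_conj c.
  by rewrite -of_realM -expr2 mul_conj.
have e2 : of_real 2 = 1 + 1 :> K by rewrite -of_real1 -of_realD.
by rewrite e1 e2; ring.
Qed.

(** Otherwise subtracting a multiple of [v], the same as in the proof of the
    Cauchy-Schwarz inequality, would bring [q] below [d]. *)
Lemma form_near_min u v (d : R) : X u -> X v -> (forall c : K, d <= q (u - c *: v)) ->
  modulus (B u v) ^+ 2 <= (q u - d) * q v.
Proof.
move=> hu hv h; have key t : d <= q u - 2 * t * modulus (B u v) ^+ 2 +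
  t ^+ 2 * modulus (B u v) ^+ 2 * q v.
  by rewrite -form_quadratic.
set m := modulus (B u v) ^+ 2 in key *; have m0 : 0 <= m by rewrite sqr_ge0.
have hqv := q0 hv; have [qv0|qv0] := eqVneq (q v) 0.
  rewrite qv0 mulr0 leNgt; apply/negP => mp.
  have := key ((q u - d + 1) / (2 * m)); rewrite qv0 mulr0 addr0.
  have -> : 2 * ((q u - d + 1) / (2 * m)) * m = q u - d + 1 by field; rewrite lt0r_neq0.
  lra.
have qv1 : 0 < q v by rewrite lt_def qv0.
have := key (q v)^-1.
have -> : q u - 2 * (q v)^-1 * m + (q v)^-1 ^+ 2 * m * q v = q u - m / q v.
  by field; rewrite lt0r_neq0.
by rewrite -ler_pdivrMr//; lra.
Qed.

Lemma form_cs u v : X u -> X v -> modulus (B u v) ^+ 2 <= q u * q v.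
Proof.
move=> hu hv; rewrite -[q u]subr0; apply: form_near_min => // c.
by apply: q0; apply: subspaceB => //; exact: subspaceZ.
Qed.

Lemma form_parallelogram u v : X u -> X v ->
  q (u - v) = 2 * q u + 2 * q v - 4 * q (of_real 2^-1 *: (u + v)).
Proof.
move=> hu hv; apply: (@of_real_inj R k).
have hs : X (u + v) by exact: subspaceD.
have hz : X (of_real 2^-1 *: (u + v)) by exact: subspaceZ.
have hd : X (u - v) by exact: subspaceB.
rewrite -Bq// of_realD of_realN of_realD !of_realM -!Bq//.
rewrite formZ// formZr// conj_of_real.
have fr x y z : X x -> X y -> X z -> B z (x + y) = B z x + B z y.
  by move=> hx hy hz'; rewrite (Bc (subspaceD lX hx hy) hz') formD// conjD -!Bc.
rewrite !formB// !formBr// formD// !fr//.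
have e4 : of_real 4 * (of_real 2^-1 * (of_real 2^-1 * (B u u + B u v + (B v u + B v v)))) =
   B u u + B u v + (B v u + B v v).
  rewrite !mulrA -!of_realM (_ : 4 / 2 / 2 = 1) ?of_real1 ?mul1r//; by field.
have e2 : of_real 2 = 1 + 1 :> K by rewrite -of_real1 -of_realD.
by rewrite e4 e2; ring.
Qed.

(** On [Y] the form [q] is equivalent to the square of the norm, so [Y] is
    complete for it, and the projection theorem applies: a minimizing sequence for
    [q (T - y)] is Cauchy by the parallelogram identity, and its limit is the
    orthogonal projection of [T]. It depends continuously on [T] because [q] is
    bounded on [X]. *)
Lemma hilbertian_complemented (Y : set V) (C C' : R) : closed_subspace X Y ->
  0 <= C -> (forall x, X x -> q x <= C * nnorm X x ^+ 2) ->
  0 < C' -> (forall y, Y y -> nnorm X y ^+ 2 <= C' * q y) -> complemented X Y.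
Proof.
move=> [YX lY cY] C0 qC C'0 Yq.
have orth_ex T : X T -> exists y, Y y /\ forall v, Y v -> B (T - y) v = 0.
  move=> hT; pose S := [set q (T - y) | y in Y].
  have hTy y : Y y -> X (T - y) by move=> hy; apply: subspaceB => //; exact: YX.
  have S0 : has_inf S.
    split; first by exists (q (T - 0)); exists 0 => //; exact: subspace0.
    by exists 0 => _ [y hy <-]; exact/q0/hTy.
  pose d := inf S.
  have dle y : Y y -> d <= q (T - y).
    by move=> hy; apply: ge_inf; [exact: S0.2|exists y].
  have /choice[y hy] : forall n : nat, exists y, Y y /\ q (T - y) < d + n.+1%:R^-1.
    move=> n; have n0 : 0 < n.+1%:R^-1 :> R by rewrite invr_gt0.
    by have [_ [y hy <-] hlt] := inf_adherent n0 S0; exists y.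
  have yY n := (hy n).1; have yX n := YX _ (yY n).
  have dq m n : q (y m - y n) <= 2 * m.+1%:R^-1 + 2 * n.+1%:R^-1.
    have -> : y m - y n = (T - y n) - (T - y m) by rewrite sub_sub_same.
    rewrite (form_parallelogram (hTy _ (yY n)) (hTy _ (yY m))).
    have -> : of_real 2^-1 *: (T - y n + (T - y m)) = T - of_real 2^-1 *: (y n + y m).
      rewrite addrACA -opprD scalerBr; congr (_ - _).
      rewrite -[T in LHS]scale1r -scalerDl scalerA -of_real1 -of_realD -of_realM.
      by rewrite mulVf ?of_real1 ?scale1r.
    have := dle (of_real 2^-1 *: (y n + y m)) (subspaceZ _ lY (subspaceD lY (yY n) (yY m))).
    have := (hy m).2; have := (hy n).2.
    by move: (m.+1%:R^-1 : R) (n.+1%:R^-1 : R) => a b; lra.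
  have cu : norm_cauchy X y.
    move=> e e0; have e2 : 0 < e ^+ 2 / (4 * C') by rewrite divr_gt0 ?exprn_gt0// mulr_gt0.
    have [N hN] := @null_inv R _ e2; exists N => m n Nm Nn.
    rewrite -(@ltr_pXn2r _ 2) ?nnegrE ?(ltW e0)//; last first.
      by apply: (banach_norm_ge0 bX); exact: subspaceB.
    apply: le_lt_trans (Yq _ (subspaceB lY (yY m) (yY n))) _.
    have h1 := dq m n; have h2 := hN m Nm; have h3 := hN n Nn.
    move: h1 h2 h3; move: (m.+1%:R^-1 : R) (n.+1%:R^-1 : R) => r1 r2 h1 h2 h3.
    have : q (y m - y n) < 4 * (e ^+ 2 / (4 * C')) by lra.
    have -> : 4 * (e ^+ 2 / (4 * C')) = e ^+ 2 / C' by field; rewrite lt0r_neq0.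
    by rewrite ltr_pdivlMr// mulrC.
  have [z zX yz] := banach_cauchy bX yX cu.
  have zY : Y z by apply: (cY y z yY zX); apply/(norm_cvgP bX).
  exists z; split => // v hv; have vX := YX _ hv.
  have lim : cvK (fun n => B (T - y n) v) (B (T - z) v).
    have h : null (fun n => Num.sqrt (C * q v) * nnorm X (y n - z)).
      by apply: nullM => //; exact: sqrtr_ge0.
    apply: null_le h => n; have yzX : X (y n - z) by exact: subspaceB.
    rewrite -formB//; [|exact: hTy|exact: hTy].
    have -> : T - y n - (T - z) = - 1 *: (y n - z).
      by rewrite scaleN1r sub_sub_same opprB.
    rewrite formZ// modulusM modulusN modulus1 mul1r.
    have nn := banach_norm_ge0 bX yzX.
    rewrite -(@ler_pXn2r _ 2) ?nnegrE ?mulr_ge0 ?sqrtr_ge0//.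
    rewrite exprMn sqr_sqrtr ?mulr_ge0 ?q0//; apply: le_trans (form_cs yzX vX) _.
    by rewrite mulrAC; apply: ler_wpM2r; [exact: q0|exact: qC].
  apply: cvK_uniq lim _.
  have h : null (fun n => n.+1%:R^-1 * q v).
    by apply: null_le (nullM (q0 vX) (@null_inv R)) => n; rewrite mulrC.
  move=> e e0; have [N hN] := h _ (exprn_gt0 2 e0); exists N => n /hN hn.
  rewrite subr0 -(@ltr_pXn2r _ 2) ?nnegrE ?(ltW e0)//; apply: le_lt_trans hn.
  apply: le_trans (form_near_min (d := d) (hTy _ (yY n)) vX _) _.
    by move=> c; rewrite -addrA -opprD; apply: dle; rewrite addrC; exact: subspaceL.
  apply: ler_wpM2r; first exact: q0.
  by have := (hy n).2; move: (n.+1%:R^-1 : R) => r1; lra.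
have Yuniq y : Y y -> (forall v, Y v -> B y v = 0) -> y = 0.
  move=> hy h; apply: (banach_norm_eq0 bX (YX _ hy)).
  have := Yq _ hy; have := h _ hy; rewrite Bq; last exact: YX.
  rewrite -of_real0 => /of_real_inj ->; rewrite mulr0 => h'.
  by apply/eqP; rewrite -sqrf_eq0 eq_le h' sqr_ge0.
have /choice[P hP] : forall T, exists y, X T -> Y y /\ forall v, Y v -> B (T - y) v = 0.
  by move=> T; have [/orth_ex[y hy]|n] := pselect (X T); [exists y|exists 0].
have PE T y : X T -> Y y -> (forall v, Y v -> B (T - y) v = 0) -> P T = y.
  move=> hT hy h; have [h1 h2] := hP T hT.
  apply/eqP; rewrite -subr_eq0; apply/eqP/Yuniq; first exact: subspaceB.
  move=> v hv; have -> : P T - y = (T - y) - (T - P T) by rewrite sub_sub_same.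
  rewrite formB ?h ?h2 ?subrr//; try exact: YX.
    by apply: subspaceB => //; exact: YX.
  by apply: subspaceB => //; exact: YX.
exists P; split.
- split.
  + by move=> T hT; apply/YX; exact: (hP T hT).1.
  + move=> c T S hT hS; have [h1 h2] := hP T hT; have [h3 h4] := hP S hS.
    have tX : X (T - P T) by apply: subspaceB => //; exact: YX.
    have sX : X (S - P S) by apply: subspaceB => //; exact: YX.
    apply: PE; [exact: subspaceL|exact: subspaceL|].
    move=> v hv; have -> : c *: T + S - (c *: P T + P S) = c *: (T - P T) + (S - P S).
      by rewrite scalerBr opprD addrACA.
    by rewrite Bl ?h2 ?h4 ?mulr0 ?addr0//; exact: YX.
  exists (Num.sqrt (C' * C)) => T hT; have [h1 h2] := hP T hT.
  have pX := YX _ h1; have n0 := banach_norm_ge0 bX hT.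
  have e : B T (P T) = of_real (q (P T)).
    rewrite -Bq//; have := h2 _ h1; rewrite formB// => /eqP; rewrite subr_eq0 => /eqP //.
  have hcs := form_cs hT pX; rewrite e modulus_of_real real_normK ?num_real// in hcs.
  have qp : q (P T) <= q T.
    have [->|h] := eqVneq (q (P T)) 0; first exact: q0.
    have hpos : 0 < q (P T) by rewrite lt_def h q0.
    by rewrite expr2 ler_pM2r in hcs.
  rewrite -(@ler_pXn2r _ 2) ?nnegrE ?mulr_ge0 ?sqrtr_ge0//; last exact: (banach_norm_ge0 bX pX).
  rewrite exprMn sqr_sqrtr ?mulr_ge0 ?(ltW C'0)//.
  apply: le_trans (Yq _ h1) _; rewrite -mulrA ler_wpM2l ?(ltW C'0)//.
  exact: le_trans qp (qC _ hT).
- move=> T hT; have h1 := (hP T hT).1; apply: PE => //; first exact: YX.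
  by move=> v hv; rewrite subrr form0//; exact: YX.
apply/seteqP; split => [_ [T hT <-]|y hy]; first exact: (hP T hT).1.
exists y; first exact: YX.
apply: PE => //; first exact: YX.
by move=> v hv; rewrite subrr form0//; exact: YX.
Qed.

End Hilbertian.

(** * Rows, columns and corners *)

Section Approximation.
Context {R : realType} {k : scalar_kind}.
Local Notation K := (scalar_field R k).
Local Notation H := (ell2 R k).
Variable E : normed_space (nat -> K).
Hypothesis hE : symmetric_sequence_space E.
Local Notation nE := (nnorm E).
Local Notation C := (schatten E).
Local Notation nC := (nnorm C).
Implicit Types (e f g h : nat -> H) (a : nat -> K) (T S : H -> H) (x y : H).
Let bE : is_banach E := sss_banach hE.
Let lE : linear_subspace (carrier E) := banach_submod bE.
Let bC : is_banach C := schatten_banach hE.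
Let lC : linear_subspace (carrier C) := banach_submod bC.
Local Notation kp := (unit_norm E).

(** Elements of the Schatten space have an adjoint ([adjP]); for operators without
    one the value is the zero map. *)
Definition adj T : H -> H := xget (fun=> 0) [set S | is_adjoint T S].

Lemma adjP T : C T -> is_adjoint T (adj T).
Proof.
move=> hT; have [S hS] := adj_exists (sch_linear hT) (sch_bounded hE hT).
exact: (xgetI (fun=> 0) hS).
Qed.

Lemma adj_semilinear (c : K) T S y : C T -> C S ->
  adj (c *: T + S) y = scalar_conj c *: adj T y + adj S y.
Proof.
move=> hT hS; have hTS : C (c *: T + S) by exact: subspaceL.
apply: inner_inj => z; rewrite innerDZl !(adj_sym (adjP _))//.
by rewrite fctE innerDr innerZr.
Qed.

(** The semi-inner product of the first [m] columns and the first [m] rows; [rc_sqr]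
    is its quadratic form. *)
Definition rc_form m T S : K :=
  \sum_(i < m) (inner (T (delta i)) (S (delta i)) + inner (adj S (delta i)) (adj T (delta i))).
Definition rc_sqr m T : R := \sum_(i < m) (nr (T (delta i)) ^+ 2 + nr (adj T (delta i)) ^+ 2).

Lemma nr_col_le T i : C T -> nr (T (delta i)) <= nC T / kp.
Proof. by move=> hT; have := sch_op_le hE (delta i) hT; rewrite nr_delta mulr1. Qed.

Lemma nr_row_le T i : C T -> nr (adj T (delta i)) <= nC T / kp.
Proof.
move=> hT; have k0 := unit_norm_gt0 hE.
have h0 : 0 <= nC T / kp by rewrite divr_ge0 ?(ltW k0)// sch_ge0.
by have := adj_bounded h0 (fun x => sch_op_le hE x hT) (adjP hT) (delta i); rewrite nr_delta mulr1.
Qed.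

Lemma rc_sqr_le m T : C T -> rc_sqr m T <= (2 * m%:R / kp ^+ 2) * nC T ^+ 2.
Proof.
move=> hT; have k0 := unit_norm_gt0 hE.
have h0 : 0 <= nC T / kp by rewrite divr_ge0 ?(ltW k0)// sch_ge0.
apply: (@le_trans _ _ (\sum_(i < m) 2 * (nC T / kp) ^+ 2)).
  apply: ler_sum => i _; rewrite mulr2n mulrDl mul1r.
  by apply: lerD; rewrite ler_pXn2r ?nnegrE//; [exact: nr_col_le|exact: nr_row_le].
rewrite sumr_const card_ord -mulr_natl exprMn exprVn le_eqVlt; apply/orP; left; apply/eqP; ring.
Qed.

(** The form [rc_sqr m] is bounded by the square of the norm, and by hypothesis it
    dominates it on [Y]: [hilbertian_complemented] applies. *)
Lemma rows_columns_complemented (Y : set (H -> H)) m (M : R) : closed_subspace C Y -> 0 < M ->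
  (forall T, Y T -> nC T ^+ 2 <= M * rc_sqr m T) -> complemented C Y.
Proof.
move=> cY M0 hY; have k0 := unit_norm_gt0 hE.
apply: (hilbertian_complemented bC (B := rc_form m) (q := rc_sqr m) _ _ _ _ cY _ _ M0 hY
  (C := 2 * m%:R / kp ^+ 2)).
- move=> c T S U hT hS hU; rewrite /rc_form mulr_sumr -big_split /=; apply: eq_bigr => i _.
  rewrite adj_semilinear// fctE innerDZl innerDr innerZr conjK; ring.
- move=> T S hT hS; rewrite /rc_form conj_sum; apply: eq_bigr => i _.
  by rewrite conjD -!inner_conj.
- move=> T hT; rewrite /rc_form /rc_sqr of_real_sum; apply: eq_bigr => i _.
  by rewrite !inner_self of_realD.
- by move=> T hT; apply: sumr_ge0 => i _; rewrite addr_ge0// sqr_ge0.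
- by rewrite divr_ge0 ?exprn_ge0 ?(ltW k0)// mulr_ge0.
by move=> T hT; exact: rc_sqr_le.
Qed.

Lemma sch_sum (I : Type) (r : seq I) (F : I -> H -> H) : (forall i, C (F i)) ->
  C (\sum_(i <- r) F i) /\ nC (\sum_(i <- r) F i) <= \sum_(i <- r) nC (F i).
Proof. by move=> hF; split; [exact: subspace_sum|exact: nnorm_sum]. Qed.

Lemma fct_sum (I : Type) (r : seq I) (F : I -> H -> H) x :
  (\sum_(i <- r) F i) x = \sum_(i <- r) F i x.
Proof. by elim: r => [|i r IH]; rewrite ?big_nil// !big_cons -IH. Qed.

Lemma sch_rows m T : C T ->
  nC ((fun x => fin m x) \o T) <= kp * \sum_(i < m) nr (adj T (delta i)).
Proof.
move=> hT.
have -> : (fun x : H => fin m x) \o T = \sum_(i < m) rank1 (adj T (delta i)) (delta i).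
  apply/funext => x; rewrite fct_sum /= fin_sum; apply: eq_bigr => i _.
  by rewrite /rank1 -(adjP hT) inner_delta.
apply: le_trans (sch_sum _ (fun i => (sch_rank1 hE _ _).1)).2 _.
rewrite mulr_sumr; apply: ler_sum => i _; apply: le_trans (sch_rank1 hE _ _).2 _.
by rewrite nr_delta mulr1.
Qed.

Lemma sch_cols m T : C T ->
  nC (T \o (fun x => fin m x)) <= kp * \sum_(i < m) nr (T (delta i)).
Proof.
move=> hT.
have -> : T \o (fun x : H => fin m x) = \sum_(i < m) rank1 (delta i) (T (delta i)).
  apply/funext => x; rewrite fct_sum /= fin_sum (lin_sum (sch_linear hT)); apply: eq_bigr => i _.
  by rewrite /rank1 inner_delta (linZ (sch_linear hT)).
apply: le_trans (sch_sum _ (fun i => (sch_rank1 hE _ _).1)).2 _.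
rewrite mulr_sumr; apply: ler_sum => i _; apply: le_trans (sch_rank1 hE _ _).2 _.
by rewrite nr_delta mul1r.
Qed.

Definition cut m x : H := x - fin m x.

Lemma oproj_cut m : oproj (cut m : H -> H).
Proof. exact: oproj_compl (oproj_fin m). Qed.

(** What is removed is the sum of [m] rows and of [m] columns, that is of [2 * m]
    operators of rank one, each of norm at most the square root of [rc_sqr m T] up to
    the factor [kp]. *)
Lemma sch_corner m T : C T ->
  C (T - (cut m \o T \o cut m)) /\
  nC (T - (cut m \o T \o cut m)) <= kp * (2 * m%:R * Num.sqrt (rc_sqr m T)).
Proof.
move=> hT; have k0 := unit_norm_gt0 hE; have lT := sch_linear hT.
have [h1 n1] := sch_proj_left hE (oproj_fin m) hT.
have [h2 n2] := sch_proj_right hE (oproj_fin m) hT.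
have [h3 n3] := sch_proj_left hE (oproj_cut m) h2.
have -> : T - (cut m \o T \o cut m) = ((fun x : H =>
  fin m x) \o T) + (cut m \o (T \o (fun x : H => fin m x))).
  apply/funext => x; rewrite -[LHS]/(T x - cut m (T (cut m x))).
  rewrite -[RHS]/(fin m (T x) + cut m (T (fin m x))).
  rewrite {2}/cut (linB lT) (linB (let: And3 l _ _ := oproj_cut m in l)) opprB addrA.
  apply: ell2_eq => i; rewrite /cut !(ell2_sub, ell2_add, ell2_opp); ring.
split; first exact: subspaceD.
apply: le_trans (banach_normD bC h1 h3) _.
apply: le_trans (lerD (sch_rows m hT) (le_trans n3 (sch_cols m hT))) _.
rewrite -mulrDr ler_pM2l// -big_split /=.
have h (i : 'I_m) : nr (adj T (delta i)) <= Num.sqrt (rc_sqr m T) /\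
  nr (T (delta i)) <= Num.sqrt (rc_sqr m T).
  have hi : nr (T (delta i)) ^+ 2 + nr (adj T (delta i)) ^+ 2 <= rc_sqr m T.
    rewrite /rc_sqr (bigD1 i)//= lerDl; apply: sumr_ge0 => j _; by rewrite addr_ge0// sqr_ge0.
  have s1 := sqr_ge0 (nr (T (delta i))); have s2 := sqr_ge0 (nr (adj T (delta i))).
  split; rewrite -[leLHS]ger0_norm// -sqrtr_sqr ler_wsqrtr//; lra.
apply: (@le_trans _ _ (\sum_(i < m) 2 * Num.sqrt (rc_sqr m T))).
  by apply: ler_sum => i _; have [] := h i; lra.
rewrite sumr_const card_ord -mulr_natr le_eqVlt; apply/orP; left; apply/eqP; ring.
Qed.

Lemma rank1_compress m u v : C (rank1 u v - (fun x => fin m (rank1 u v (fin m x)))) /\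
  nC (rank1 u v - (fun x => fin m (rank1 u v (fin m x)))) <=
  kp * (nr (fin m u - u) * nr v + nr u * nr (fin m v - v)).
Proof.
have k0 := unit_norm_gt0 hE; have [_ ap _] := @oproj_fin R k m.
have -> : rank1 u v - (fun x => fin m (rank1 u v (fin m x))) =
    rank1 (u - fin m u) v + rank1 (fin m u) (v - fin m v).
  apply/funext => x; rewrite -[LHS]/(rank1 u v x - fin m (rank1 u v (fin m x))).
  rewrite -[RHS]/(rank1 (u - fin m u) v x + rank1 (fin m u) (v - fin m v) x) /rank1.
  by rewrite fin_scale ap innerBr scalerBl scalerBr addrA subrK.
have [h1 n1] := sch_rank1 hE (u - fin m u) v.
have [h2 n2] := sch_rank1 hE (fin m u) (v - fin m v).
split; first exact: subspaceD.
apply: le_trans (banach_normD bC h1 h2) _; apply: le_trans (lerD n1 n2) _.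
rewrite -mulrDr ler_pM2l// [nr (u - _)]nrB [nr (v - _)]nrB lerD2l ler_wpM2r//.
exact: fin_le.
Qed.

(** This is clear for operators of rank one, hence for the truncations of a
    singular value decomposition. These are dense, and compression to a corner
    does not increase the norm. *)
Lemma sch_compress T : C T ->
  (forall m, C (T - (fun x => fin m (T (fin m x))))) /\
  null (fun m => nC (T - (fun x => fin m (T (fin m x))))).
Proof.
move=> hT; have cT := sch_compact hT; have [pe pf] := (rsv_pon cT, lsv_pon cT).
set e := rsv T in pe; set f := lsv T in pf; set s := svals T.
have hs : E s := sch_svals hT.
have fc S m : C S -> C (fun x => fin m (S (fin m x))) /\ nC (fun x => fin m (S (fin m x))) <= nC S.
  move=> hS; have [h1 n1] := sch_proj_right hE (oproj_fin m) hS.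
  have [h2 n2] := sch_proj_left hE (oproj_fin m) h1.
  by split; [exact: h2|exact: le_trans n2 n1].
split => [m|d d0]; first by apply: subspaceB => //; exact: (fc T m hT).1.
have d4 : 0 < d / 4 by rewrite divr_gt0.
have [p hp] := E_basis hE hs d4; pose s' := trunc p s.
have hs' : E s' by exact: E_trunc.
have [c1 n1] := jop_schatten hE pe pf hs'.
have hds : E (s - s') by exact: subspaceB.
have [c2 n2] := jop_schatten hE pe pf hds.
have nds : nE (s - s') < d / 4 by rewrite (nnormB bE)//; exact: hp.
have TE : T = jop e f s' + jop e f (s - s').
  apply/funext => x; rewrite -[RHS]/(jop e f s' x + jop e f (s - s') x).
  rewrite (jop_sub x pe pf (E_bounded hE hs) (E_bounded hE hs')) addrC subrK.
  by rewrite {1}(svals_jop cT).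
pose S i := (s' i) *: rank1 (e i) (f i).
have S1E : jop e f s' = \sum_(i < p) S i.
  apply/funext => x; rewrite fct_sum (jop_fin pe pf (p := p)); last first.
    by move=> i pi; rewrite /s' /trunc ltnNge pi.
  by apply: eq_bigr => i _; rewrite -[RHS]/(s' i *: (inner x (e i) *: f i)) scalerA.
have hn : null (fun m => \sum_(i < p) modulus (s' i) * (kp * (nr (fin m (e i) - e i) +
  nr (fin m (f i) - f i)))).
  apply: null_sum => i; apply: nullM => //; apply: nullM; first exact/ltW/unit_norm_gt0.
  by apply: nullD; exact: fin_cvH.
have [N hN] := hn _ (divr_gt0 d0 (ltr0n R 2)); exists N => m Nm.
have small1 : nC (jop e f s' - (fun x => fin m (jop e f s' (fin m x)))) < d / 2.
  apply: le_lt_trans (hN m Nm).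
  have -> : jop e f s' - (fun x => fin m (jop e f s' (fin m x))) =
      \sum_(i < p) s' i *: (rank1 (e i) (f i) - (fun x => fin m (rank1 (e i) (f i) (fin m x)))).
    apply/funext => x; rewrite fct_sum S1E -[LHS]/((\sum_(i < p) S i) x - fin m ((\sum_(i < p) S
      i) (fin m x))).
    rewrite !fct_sum (lin_sum (fin_linear m)) -sumrB; apply: eq_bigr => i _.
    rewrite -[LHS]/(s' i *: rank1 (e i) (f i) x - fin m (s' i *: rank1 (e i) (f i) (fin m x))).
    by rewrite fin_scale -scalerBr.
  apply: le_trans (sch_sum _ _).2 _ => [i|].
    by apply: subspaceZ => //; exact: (rank1_compress _ _ _).1.
  apply: ler_sum => i _; have [h1 h2] := rank1_compress m (e i) (f i).
  rewrite (banach_normZ bC)//; apply: ler_wpM2l => //; apply: le_trans h2 _.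
  rewrite ler_pM2l ?unit_norm_gt0//; apply: lerD.
    by rewrite ler_piMr// pon_nr_le1.
  by rewrite ler_piMl// pon_nr_le1.
have [c3 n3] := fc _ m c2.
have -> : T - (fun x => fin m (T (fin m x))) =
   (jop e f s' - (fun x => fin m (jop e f s' (fin m x)))) + (jop e f (s - s') - (fun x =>
     fin m (jop e f (s - s') (fin m x)))).
  rewrite {1}TE [in LHS](_ : (fun x => fin m (T (fin m x))) =
    (fun x => fin m (jop e f s' (fin m x))) + (fun x => fin m (jop e f (s - s') (fin m x)))).
    by rewrite opprD addrACA.
  by apply/funext => x; rewrite {1}TE; exact: fin_add.
have c4 : C (jop e f s' - (fun x =>
  fin m (jop e f s' (fin m x)))) by exact (subspaceB lC c1 (fc _ m c1).1).
have c5 : C (jop e f (s - s') - (fun x =>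
  fin m (jop e f (s - s') (fin m x)))) by exact (subspaceB lC c2 c3).
apply: le_lt_trans (banach_normD bC c4 c5) _.
have h5 : nC (jop e f (s - s') - (fun x => fin m (jop e f (s - s') (fin m x)))) <= d / 4 + d / 4.
  apply: le_trans (nnorm_tri bC c2 (subspace0 lC) c3) _.
  rewrite subr0 sub0r (nnormN bC)//; apply: lerD; last apply: le_trans n3 _;
    exact: le_trans n2 (ltW nds).
have -> : d = d / 2 + (d / 4 + d / 4) by field.
exact: ltr_leD small1 h5.
Qed.

End Approximation.

(** * Copies of a block sequence *)

Section GeometricSeries.
Context {R : realType} {k : scalar_kind}.
Local Notation K := (scalar_field R k).

Lemma geom_tail m p : \sum_(m <= n < p) (2^-1 : R) ^+ n.+1 <= 2^-1 ^+ m.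
Proof.
have [pm|mp] := leqP p m; first by rewrite big_geq ?exprn_ge0// invr_ge0.
apply: (@le_trans _ _ (2^-1 ^+ m - 2^-1 ^+ p)); last by rewrite gerBl exprn_ge0// invr_ge0.
rewrite (@telescope_sumr_eq _ m p (fun n => - 2^-1 ^+ n) _ (ltnW mp)); first by rewrite opprK addrC.
by move=> n _; rewrite exprS; field.
Qed.

Context {V : lmodType K}.
Variable X : normed_space V.
Hypothesis bX : is_banach X.

Lemma ncv_ext (u v : nat -> V) x : u =1 v -> ncv X u x -> ncv X v x.
Proof. by move=> /funext ->. Qed.

(** The partial sums are Cauchy, with geometric tails. *)
Lemma geom_series (v : nat -> V) (c : R) M : 0 <= c -> (forall n, X (v n)) ->
  (forall n, nnorm X (v n) <= 2^-1 ^+ n.+1 * c) ->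
  exists T, [/\ X T, ncv X (fun p => \sum_(M <= n < p) v n) T & nnorm X T <= 2^-1 ^+ M * c].
Proof.
move=> c0 hv nv; have lX := banach_submod bX.
have sX m p : X (\sum_(m <= n < p) v n) by exact: subspace_sum.
have ns m p : nnorm X (\sum_(m <= n < p) v n) <= 2^-1 ^+ m * c.
  apply: le_trans (nnorm_sum bX _ hv) _.
  apply: (@le_trans _ _ (\sum_(m <= n < p) 2^-1 ^+ n.+1 * c)); first by apply: ler_sum => n _;
    exact: nv.
  by rewrite -mulr_suml; apply: ler_wpM2r => //; exact: geom_tail.
have [|T XT hT] := banach_cauchy bX (sX M).
  move=> d d0; have [N hN] := nullM c0 (@null_half R) d0; exists (maxn N M).
  have aux m n : (maxn N M <= n)%N -> (n <= m)%N ->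
      nnorm X (\sum_(M <= i < m) v i - \sum_(M <= i < n) v i) < d.
    rewrite geq_max => /andP[Nn Mn] nm.
    rewrite (big_cat_nat Mn nm) /= addrAC subrr add0r.
    by apply: le_lt_trans (ns _ _) _; rewrite mulrC; exact: hN.
  move=> m n Nm Nn; have [mn|/ltnW nm] := leqP m n; last exact: aux.
  by rewrite (nnormB bX)//; exact: aux.
by exists T; split => //; apply: (ncv_norm_le bX (sX M) XT hT) => n.
Qed.

End GeometricSeries.

Section Blocks.
Context {R : realType} {k : scalar_kind}.
Local Notation K := (scalar_field R k).
Local Notation H := (ell2 R k).
Variable E : normed_space (nat -> K).
Hypothesis hE : symmetric_sequence_space E.
Local Notation nE := (nnorm E).
Local Notation C := (schatten E).
Local Notation nC := (nnorm C).
Let bE : is_banach E := sss_banach hE.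
Let lE : linear_subspace (carrier E) := banach_submod bE.
Let bC : is_banach C := schatten_banach hE.
Let lC : linear_subspace (carrier C) := banach_submod bC.

(** [al n] is a sequence carried by the [n]-th block of a partition of the
    indices, [b] sends an index to its block, and [q n] is an index of the
    [n]-th block. *)
Variables (al : nat -> nat -> K) (b q : nat -> nat).
Hypotheses (Eal : forall n, E (al n)) (albq : forall n i, b i != n -> al n i = 0)
  (alq : forall n, al n (q n) != 0).

Lemma block_of_lead n : b (q n) = n.
Proof. by apply/eqP; apply: contraTT (alq n) => h; rewrite albq ?eqxx. Qed.

(** The sequences [\sum_n c_n *: al n] of [E]. *)
Definition block_span : set (nat -> K) :=
  [set w | E w /\ forall i, w i = al (b i) i / al (b i) (q (b i)) * w (q (b i))].

Definition coef n (w : nat -> K) : K := w (q n) / al n (q n).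

Lemma block_spanE w : block_span w -> forall i, w i = coef (b i) w * al (b i) i.
Proof. by move=> [_ h] i; rewrite {1}h /coef; ring. Qed.

Lemma block_span_closed : closed_subspace E block_span.
Proof.
split; first by move=> w [].
- apply/linear_subspaceP; split.
    by split; [exact: subspace0|move=> i; rewrite -[LHS]/(0 : K) -[X in _ * X]/(0 : K) mulr0].
  move=> c x y [Ex hx] [Ey hy]; split; first exact: subspaceL.
  move=> i; rewrite -[LHS]/(c * x i + y i) -[X in _ = _ * X]/(c * x (q (b i)) + y (q (b i))).
  by rewrite {1}hx {1}hy; ring.
move=> u x hu Ex ux; have Eu n : E (u n) by have [] := hu n.
have ucv := (norm_cvgP bE Eu Ex).1 ux; split => // i.
apply: cvK_uniq (E_ncv_coord hE i Eu Ex ucv) _.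
apply: cvK_ext (cvKM _ (E_ncv_coord hE (q (b i)) Eu Ex ucv)) => n.
by have [_ h] := hu n; rewrite -h.
Qed.

Lemma block_span_al n : block_span (al n).
Proof.
split => // i; have [e|e] := eqVneq (b i) n; first by rewrite e divfK.
by rewrite albq// [X in _ * X]albq ?mulr0// block_of_lead.
Qed.

Lemma coef_sum_al m (u : 'I_m -> K) n : coef n (\sum_(i < m) u i *: al i) =
  \sum_(i < m | i == n :> nat) u i.
Proof.
have -> : (\sum_(i < m) u i *: al i) = (fun j => \sum_(i < m) u i * al i j).
  by apply/funext => j; elim/big_rec2: _ => // i y1 y2 _ <-.
rewrite /coef mulr_suml [RHS]big_mkcond /=; apply: eq_bigr => i _; case: eqP => [->|/eqP h].
  by rewrite mulfK.
by rewrite albq ?mulr0 ?mul0r// block_of_lead eq_sym.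
Qed.

(** The [al n] are free, as their supports are disjoint and nonempty. *)
Lemma block_span_infinite : infinite_dim block_span.
Proof.
move=> n hd; suff : (n.+1 <= n)%N by rewrite ltnn.
apply: (has_dim_leq (v := fun i : 'I_n.+1 => al i) hd) => [i|u hu]; first exact: block_span_al.
apply/rowP => i; rewrite mxE; have := coef_sum_al (fun i => u ord0 i) i.
rewrite hu /coef -[X in X / _]/(0 : K) mul0r => ->.
by rewrite (bigD1 i)//= big1 ?addr0// => j /andP[/eqP/val_inj -> /eqP].
Qed.

Lemma coef_functional n : bounded_functional E (coef n).
Proof.
split=> [c x y _ _|].
  by rewrite /coef -[(c *: x + y) (q n)]/(c * x (q n) + y (q n)); ring.
exists ((unit_norm E)^-1 * modulus (al n (q n))^-1) => x hx.
rewrite modulusM [leRHS]mulrAC; apply: ler_wpM2r => //.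
by rewrite mulrC ler_pdivlMr ?unit_norm_gt0//; exact: E_coord.
Qed.

Lemma sum_coef_al w p : block_span w ->
  \sum_(n < p) coef n w *: al n = (fun i => if (b i < p)%N then w i else 0).
Proof.
move=> hw; apply/funext => i.
have -> : (\sum_(n < p) coef n w *: al n) i = \sum_(n < p) coef n w * al n i.
  by elim/big_rec2: _ => // n y1 y2 _ <-.
case: ltnP => bp; last first.
  by rewrite big1// => n _; rewrite albq ?mulr0// gtn_eqF// (leq_trans _ bp).
rewrite (bigD1 (Ordinal bp))//= -block_spanE// big1 ?addr0// => n hn.
by rewrite albq ?mulr0//; apply: contra_neq hn => e; exact/val_inj.
Qed.

(** Restricting [w] to one block does not increase the norm. *)
Lemma coef_al_le w n : block_span w -> nE (coef n w *: al n) <= nE w.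
Proof.
move=> hw; have [Ew _] := hw; apply: (E_le hE Ew _).2 => i.
rewrite -[(_ *: _) i]/(coef n w * al n i); have [e|e] := eqVneq (b i) n.
  by rewrite -e -block_spanE.
by rewrite albq// mulr0 modulus0 modulus_ge0.
Qed.

Lemma block_sums_cvg w : block_span w -> ncv E (fun p => \sum_(n < p) coef n w *: al n) w.
Proof.
move=> hw; have [Ew _] := hw; move=> d d0; have [N hN] := E_basis hE Ew d0.
exists (\sum_(i < N) b i).+1 => p hp; apply: le_lt_trans (hN N (leqnn N)).
have Et : E (trunc N w - w) by apply: subspaceB => //; exact: E_trunc.
apply: (E_le hE Et _).2 => i; rewrite sum_coef_al//.
rewrite -[(_ - _) i]/((if (b i < p)%N then w i else 0) - w i) -[(trunc N w - w) i]/(trunc N w i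
  - w i) /trunc.
case: (ltnP i N) => iN; last by case: ifP => _; rewrite ?lexx// subrr modulus0 modulus_ge0.
suff -> : (b i < p)%N by [].
by apply: leq_ltn_trans hp; rewrite (bigD1 (Ordinal iN))//= leq_addr.
Qed.

Variables (e f : nat -> H) (z : nat -> H -> H) (Y : set (H -> H)).
Hypotheses (pe : pon e) (pf : pon f) (Yc : closed_subspace C Y) (Yz : forall n, Y (z n)).
Hypothesis unit_al : forall n i, al n i * of_real (nr (e i) ^+ 2 * nr (f i) ^+ 2) = al n i.
Local Notation J := (jop e f).
Local Notation D := (diag_of e f).
Hypothesis near : forall n, nC (z n - J (al n)) <= 2^-1 ^+ n.+1 * nC (J (al n)).

Let Cz n : C (z n). Proof. by have [YC _ _] := Yc; exact: YC. Qed.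
Let CJ w : E w -> C (J w). Proof. by move=> Ew; exact: (jop_schatten hE pe pf Ew).1. Qed.
Let JL c w w' : E w -> E w' -> J (c *: w + w') = c *: J w + J w'.
Proof.
move=> Ew Ew'; apply/funext => x.
exact: (jop_lin pe pf x (E_bounded hE Ew) (E_bounded hE Ew') c).
Qed.
Let d n := z n - J (al n).
Let Cd n : C (d n). Proof. exact: subspaceB lC (Cz n) (CJ (Eal n)). Qed.

Let coef_d_le w n : block_span w -> nC (coef n w *: d n) <= 2^-1 ^+ n.+1 * nE w.
Proof.
move=> hw; rewrite (banach_normZ bC _ (Cd n)).
apply: le_trans (ler_wpM2l (modulus_ge0 _) (near n)) _.
rewrite mulrCA; apply: ler_wpM2l; first by rewrite exprn_ge0// invr_ge0.
apply: le_trans (coef_al_le n hw); rewrite (banach_normZ bE _ (Eal n)).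
apply: ler_wpM2l; first exact: modulus_ge0.
exact: (jop_schatten hE pe pf (Eal n)).2.
Qed.

Lemma diag_jop_block w : block_span w -> D (J w) = w.
Proof.
move=> hw; have [Ew _] := hw; apply/funext => i.
rewrite /diag_of (jop_basis pe pf i (E_bounded hE Ew)) innerZl inner_self.
by rewrite -mulrA -of_realM block_spanE// -mulrA unit_al.
Qed.

Variable M : nat.

(** The operator [w |-> \sum_(n >= M) coef n w *: (z n - J (al n))]. *)
Definition defect (w : nat -> K) : H -> H :=
  xget 0 [set T | [/\ C T, ncv C (fun p => \sum_(M <= n < p) coef n w *: d n) T &
                       nC T <= 2^-1 ^+ M * nE w]].

Lemma defectP w : block_span w ->
  [/\ C (defect w), ncv C (fun p => \sum_(M <= n < p) coef n w *: d n) (defect w) &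
      nC (defect w) <= 2^-1 ^+ M * nE w].
Proof.
move=> hw; have [Ew _] := hw.
have [T hT] := geom_series bC M (banach_norm_ge0 bE Ew)
  (fun n => subspaceZ (coef n w) lC (Cd n)) (fun n => coef_d_le n hw).
exact: (@xgetI _ _ (fun T : H -> H => [/\ C T, ncv C (fun p =>
  \sum_(M <= n < p) coef n w *: d n) T &
  nC T <= 2^-1 ^+ M * nE w]) _ hT).
Qed.

Let Csum w p : C (\sum_(M <= n < p) coef n w *: d n).
Proof. by apply: subspace_sum => // n; exact: subspaceZ lC (Cd n). Qed.

Lemma defect_linear : linear_on block_span defect.
Proof.
move=> c x y hx hy; have [_ lB _] := block_span_closed.
have [h1 l1 _] := defectP hx; have [h2 l2 _] := defectP hy.
have [h3 l3 _] := defectP (subspaceL c lB hx hy).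
have h4 : C (c *: defect x + defect y) by exact: subspaceL.
apply: (ncv_uniq bC (Csum (c *: x + y)) h3 h4 l3).
have l5 := ncvD bC (fun p => subspaceZ c lC (Csum x p)) (Csum y) (subspaceZ c lC h1) h2
  (ncvZ bC c (Csum x) h1 l1) l2.
apply: ncv_ext l5 => p.
rewrite scaler_sumr -big_split /=; apply: eq_bigr => n _.
rewrite scalerA -scalerDl; congr (_ *: _); have [[Ex _] [Ey _]] := (hx, hy).
symmetry; exact: (coef_functional n).1.
Qed.

Definition embed w : H -> H := J w + defect w.

Lemma embed_sch w : block_span w -> C (embed w).
Proof. by move=> hw; have [h _ _] := defectP hw; have [Ew _] := hw;
  exact: subspaceD lC (CJ Ew) h. Qed.

Lemma embed_linear : linear_on block_span embed.
Proof.
move=> c x y hx hy; rewrite /embed defect_linear//.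
by have [[Ex _] [Ey _]] := (hx, hy); rewrite (JL c Ex Ey) scalerDr addrACA.
Qed.

Lemma embed_le w : block_span w -> nC (embed w) <= 2 * nE w.
Proof.
move=> hw; have [Ew _] := hw; have [h1 _ n1] := defectP hw;
  have [h2 n2] := jop_schatten hE pe pf Ew.
apply: le_trans (banach_normD bC h2 h1) _; rewrite mulr2n mulrDl mul1r; apply: lerD n2 _.
apply: le_trans n1 _; apply: ler_piMl; first exact: banach_norm_ge0.
by rewrite exprn_ile1 ?invr_ge0// invf_le1// ler1n.
Qed.

Lemma embed_diag w : block_span w -> nE (w - D (embed w)) <= 2^-1 ^+ M * nE w.
Proof.
move=> hw; have [Ew _] := hw; have [h1 _ n1] := defectP hw.
have -> : w - D (embed w) = - D (defect w).
  have -> : D (embed w) = D (J w) + D (defect w).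
    by apply/funext => i; exact: innerDl.
  by rewrite diag_jop_block// opprD addrA subrr sub0r.
have [h2 n2] := diag_schatten hE pe pf h1.
by rewrite (nnormN bE h2); exact: le_trans n2 n1.
Qed.

(** If the first [M] coefficients vanish, [embed w] is the limit of finite sums of
    the [coef n w *: z n]: the terms [J (al n)] of [J w] are replaced by [z n] for
    all [n] with a nonzero coefficient. *)
Lemma embed_sub w : block_span w -> (forall n, (n < M)%N -> coef n w = 0) -> Y (embed w).
Proof.
move=> hw h0; have [Ew _] := hw; have [YC lY clY] := Yc; have [h1 l1 _] := defectP hw.
pose S p := \sum_(M <= n < p + M) coef n w *: z n.
have YS p : Y (S p) by apply: subspace_sum => // n; exact: subspaceZ lY (Yz n).
apply: (clY S _ YS (embed_sch hw)); apply/(norm_cvgP bC) => [p|//|]; [exact/YC|exact: embed_sch|].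
have Ea p : E (\sum_(n < p) coef n w *: al n).
  by apply: subspace_sum => // n; exact: subspaceZ.
have l2 : ncv C (fun p => J (\sum_(n < p) coef n w *: al n)) (J w).
  apply: null_le (block_sums_cvg hw) => p.
  have -> : J (\sum_(n < p) coef n w *: al n) - J w = J (\sum_(n < p) coef n w *: al n - w).
    by apply/funext => x; rewrite (jop_sub x pe pf (E_bounded hE (Ea p)) (E_bounded hE Ew)).
  exact: (jop_schatten hE pe pf (subspaceB lE (Ea p) Ew)).2.
have l3 := null_shift M (ncvD bC (fun p => CJ (Ea p)) (Csum w) (CJ Ew) h1 l2 l1).
apply: (ncv_ext (u := fun p => J (\sum_(n < p + M) coef n w *: al n) + \sum_(M <= n < p +
  M) coef n w *: d n)) l3 => p.
have -> : J (\sum_(n < p + M) coef n w *: al n) = \sum_(M <= n < p + M) coef n w *: J (al n).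
  have JS q' : J (\sum_(n < q') coef n w *: al n) = \sum_(n < q') coef n w *: J (al n).
    elim: q' => [|q' IH]; last first.
      by rewrite [X in J X]big_ord_recr /= [X in J X]addrC (JL _ (Eal _) (Ea _)) IH addrC
        [RHS]big_ord_recr.
    rewrite !big_ord0; apply/funext => x; apply: jop_eq0 => i.
    by rewrite -[(0 : nat -> K) i]/(0 : K) mul0r.
  rewrite JS -(big_mkord xpredT (fun n => coef n w *: J (al n))).
  rewrite (big_cat_nat (leq0n M) (leq_addl p M)) /= big_nat big1 ?add0r// => n /andP[_ nM].
  by rewrite h0// scale0r.
rewrite /S -big_split /=; apply: eq_bigr => n _.
by rewrite -scalerDr /d addrC subrK.
Qed.

End Blocks.

Section BlockSequence.
Context {R : realType} {k : scalar_kind}.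
Local Notation K := (scalar_field R k).
Local Notation H := (ell2 R k).
Variable E : normed_space (nat -> K).
Hypothesis hE : symmetric_sequence_space E.
Local Notation nE := (nnorm E).
Local Notation C := (schatten E).
Local Notation nC := (nnorm C).

(** Take a complemented infinite dimensional subspace [W] of the block span, with
    projection [Q], and [M] such that [2 ^- M] times the norm of [Q] is at most
    one half. Then [embed] with this [M] has a left inverse on [W] by
    [perturbed_retraction], so its image is complemented, and [embed_sub] applies
    to the elements of the image that are annihilated by the first [M]
    coefficients. *)
Lemma block_sequence_complemented (al : nat -> nat -> K) (b q : nat -> nat) (e f : nat -> H)
    (z : nat -> H -> H) (Y : set (H -> H)) :
  subprojective E ->
  (forall n, E (al n)) -> (forall n i, b i != n -> al n i = 0) ->
  (forall n, al n (q n) != 0) -> pon e -> pon f -> closed_subspace C Y ->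
  (forall n, Y (z n)) ->
  (forall n i, al n i * of_real (nr (e i) ^+ 2 * nr (f i) ^+ 2) = al n i) ->
  (forall n, nC (z n - jop e f (al n)) <= 2^-1 ^+ n.+1 * nC (jop e f (al n))) ->
  exists Z, [/\ Z `<=` Y, closed_subspace C Z, infinite_dim Z & complemented C Z].
Proof.
move=> sE Eal albq alq pe pf Yc Yz unit_al near.
have bE := sss_banach hE; have lE := banach_submod bE.
have bC := schatten_banach hE; have lC := banach_submod bC.
have [W [WY Wc Wi [Q [bQ QQ QW]]]] := sE _ (block_span_closed hE al b q) (block_span_infinite
  Eal albq alq).
have [c c0 hc] := bounded_linearP bE bQ.
have half : 0 < 2^-1 :> R by rewrite invr_gt0.
have [M hM] := nullM c0 (@null_half R) half.
have {}hM := ltW (hM M (leqnn M)).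
pose A := embed E al q e f z M.
have dD : bounded_linear C E (diag_of e f).
  split=> [T hT|g T S _ _|]; first exact: (diag_schatten hE pe pf hT).1.
    by apply/funext => i; rewrite /diag_of fctE innerDZl.
  by exists 1 => T hT; rewrite mul1r; exact: (diag_schatten hE pe pf hT).2.
have nD T : C T -> nE (diag_of e f T) <= nC T by move=> hT; exact: (diag_schatten hE pe pf hT).2.
have [WE lW _] := Wc.
have AC : {homo A : w / W w >-> C w}.
  by move=> w /WY hw; exact: (embed_sch hE Eal albq pe pf Yc Yz near M hw).
have lA : linear_on W A.
  move=> g x y /WY hx /WY hy.
  have h := embed_linear hE Eal albq pe pf Yc Yz near M (q := q).
  exact (h g x y hx hy).
have nA w : W w -> nC (A w) <= 2 * nE w.
  by move=> /WY hw; exact: (embed_le hE Eal albq pe pf Yc Yz near M hw).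
have DA w : W w -> nE (w - diag_of e f (A w)) <= 2^-1 ^+ M * nE w.
  by move=> /WY hw; exact: (embed_diag hE Eal albq pe pf Yc Yz unit_al near M hw).
have [P [bP PW PA]] := perturbed_retraction bC bE dD nD bQ QQ QW c0 hc AC lA DA hM.
have cA := retract_complemented bC bE lW WE AC lA nA bP PW PA.
have iA : infinite_dim (A @` W).
  apply: (infinite_dim_image lW lA) => // w hw h; rewrite -(PA w hw) h.
  by have [_ lP _] := bP; exact: linear_on0 lC lP.
have fP n : bounded_functional C (fun T => coef al q n (P T)).
  have [lc [B hB]] := coef_functional hE al q n; have [PE lP _] := bP.
  split=> [g T S hT hS|]; first by rewrite (lP g T S hT hS) (lc g _ _ (PE _ hT) (PE _ hS)).
  have [B' B'0 hB'] := bounded_linearP bC bP.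
  exists (Num.max B 0 * B') => T hT; apply: le_trans (hB _ (PE _ hT)) _.
  apply: (@le_trans _ _ (Num.max B 0 * nE (P T))).
    by apply: ler_wpM2r; [exact/(banach_norm_ge0 bE)/PE|rewrite le_max lexx].
  by rewrite -mulrA; apply: ler_wpM2l; [rewrite le_max lexx orbT|exact: hB'].
have [cZ iZ] := complemented_kers bC M fP cA iA.
exists [set T | (A @` W) T /\ forall n, (n < M)%N -> coef al q n (P T) = 0].
split => //; last exact: complemented_closed.
move=> _ [[w hw <-] h0]; apply: (embed_sub hE Eal albq pe pf Yc Yz near).
  exact: WY.
by move=> n nM; rewrite -(PA w hw); exact: h0.
Qed.

End BlockSequence.

(** * Gliding hump *)

Section Bands.
Context {R : realType} {k : scalar_kind}.
Local Notation K := (scalar_field R k).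
Local Notation H := (ell2 R k).
Implicit Types (x y u : H) (m n M : nat).

Definition supported m M x : Prop := forall i, ~~ (m <= i < M)%N -> x i = 0.

Lemma supported_inner m M m' M' x y : (M <= m')%N ->
  supported m M x -> supported m' M' y -> inner x y = 0.
Proof.
move=> Mm hx hy; apply: cvK_uniq (inner_cvK x y) _.
apply: cvK_ext (cvK_cst 0) => n; rewrite big1// => i _.
have [iM|Mi] := ltnP i M; last by rewrite hx ?mul0r// negb_and -leqNgt Mi orbT.
by rewrite hy ?conj0 ?mulr0// negb_and -ltnNge (leq_trans iM Mm).
Qed.

Definition band m M x : H := fin M x - fin m x.

Lemma bandE m M x i : (m <= M)%N -> band m M x i = if (m <= i < M)%N then x i else 0.
Proof.
move=> mM; rewrite ell2_sub !finE; case: (ltnP i m) => im /=; last by rewrite subr0.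
by rewrite (leq_trans im mM) subrr.
Qed.

Lemma band_supported m M x : (m <= M)%N -> supported m M (band m M x).
Proof. by move=> mM i /negbTE h; rewrite bandE// h. Qed.

Lemma band_idem m M x : (m <= M)%N -> band m M (band m M x) = band m M x.
Proof. by move=> mM; apply: ell2_eq => i; rewrite !bandE//; case: ifP => // ->. Qed.

Lemma band_linear m M : linear (band m M : H -> H).
Proof. by move=> c x y; rewrite /band !fin_linear scalerBr opprD addrACA. Qed.

Lemma oproj_band m M : (m <= M)%N -> oproj (band m M : H -> H).
Proof.
move=> mM; split; [exact: band_linear| |by move=> x; exact: band_idem].
have [_ aM _] := @oproj_fin R k M; have [_ am _] := @oproj_fin R k m.
by move=> x y; rewrite innerBl innerBr aM am.
Qed.

Lemma cut_fin m M x : (m <= M)%N -> cut m (fin M x) = band m M x.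
Proof.
move=> mM; apply: ell2_eq => i; rewrite bandE// ell2_sub !finE.
case: (ltnP i m) => im /=; last by rewrite subr0.
by rewrite (leq_trans im mM) subrr.
Qed.

Lemma fin_cut m M x : (m <= M)%N -> fin M (cut m x) = band m M x.
Proof.
move=> mM; apply: ell2_eq => i; rewrite bandE// finE ell2_sub finE.
case: (ltnP i m) => im /=; last by rewrite subr0.
by rewrite (leq_trans im mM) subrr.
Qed.

End Bands.

Section GlidingHump.
Context {R : realType} {k : scalar_kind}.
Local Notation K := (scalar_field R k).
Local Notation H := (ell2 R k).
Variable E : normed_space (nat -> K).
Hypothesis hE : symmetric_sequence_space E.
Local Notation nE := (nnorm E).
Local Notation C := (schatten E).
Local Notation nC := (nnorm C).
Let bE : is_banach E := sss_banach hE.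
Let lE : linear_subspace (carrier E) := banach_submod bE.
Let bC : is_banach C := schatten_banach hE.
Let lC : linear_subspace (carrier C) := banach_submod bC.
Local Notation kp := (unit_norm E).

(** Finite data [\sum_(j < len) wt j <., dom j> cod j] for an operator living on
    the coordinates [lo <= i < hi]. *)
Record block := Block {
  lo : nat; hi : nat; dom : nat -> H; cod : nat -> H; len : nat; wt : nat -> K }.

Definition block_op B : H -> H := jop (dom B) (cod B) (wt B).

Record is_block B : Prop := {
  block_dom_pon : pon (dom B);
  block_cod_pon : pon (cod B);
  block_dom_supp : forall i, supported (lo B) (hi B) (dom B i);
  block_cod_supp : forall i, supported (lo B) (hi B) (cod B i);
  block_len : forall i, (len B <= i)%N -> wt B i = 0;
  block_unit : forall i, wt B i * of_real (nr (dom B i) ^+ 2 * nr (cod B i) ^+ 2) = wt B i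
}.

(** Singular vectors for nonzero singular values are images of each other under
    [T] and its adjoint, and [T] is unchanged by composition with the projection
    to the band on either side. *)
Lemma band_singular_vectors m M (T : H -> H) i : (m <= M)%N -> C T ->
  (forall u, T u = band m M (T (band m M u))) -> nr (T (rsv T i)) != 0 ->
  supported m M (rsv T i) /\ supported m M (lsv T i).
Proof.
move=> mM hT TE n0; have cT := sch_compact hT; have [pe pf] := (rsv_pon cT, lsv_pon cT).
split=> j hj; last first.
  by rewrite /lsv ell2_scale TE (band_supported _ mM hj) mulr0.
have s0 : svals T i != 0.
  by rewrite /svals (singular_valuesE cT) -of_real0; apply: contra_neq n0 => /of_real_inj.
have f1 : nr (lsv T i) = 1.
  by rewrite nrZ modulus_of_real ger0_norm ?invr_ge0// mulVf.
have key u : inner (T u) (lsv T i) = svals T i * inner u (rsv T i).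
  rewrite {1}(svals_jop cT) (jop_adj_ext (b := svals T) _ _ pe pf (E_bounded hE (sch_svals
    hT))); last first.
    by move=> l; rewrite /svals conj_of_real.
  rewrite (jop_basis pf pe i (E_bounded hE (sch_svals hT))) f1 expr1n of_real1 mulr1 innerZr.
  by rewrite /svals conj_of_real.
have h : inner (band m M (delta j)) (rsv T i) = inner (delta j) (rsv T i).
  by apply: (mulfI s0); rewrite -!key [in RHS]TE [in LHS]TE band_idem.
have b0 : band m M (delta j) = 0 :> H.
  apply: ell2_eq => l; rewrite bandE// deltaE ell2_0; case: ifP => // hl.
  by case: eqP => // lj; rewrite -lj hl in hj.
by rewrite -inner_delta inner_conj -h b0 inner0l conj0.
Qed.

(** A truncated singular value decomposition. The singular vectors whose weight is
    zero are replaced by zero, because they need not live on the band. *)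
Lemma band_operator_block m M (T : H -> H) (d : R) : (m <= M)%N -> C T ->
  (forall u, T u = band m M (T (band m M u))) -> 0 < d ->
  exists B, [/\ is_block B, lo B = m, hi B = M, wt B 0%N = 0 -> forall i, wt B i = 0 &
    C (block_op B) /\ nC (T - block_op B) < d].
Proof.
move=> mM hT TE d0; have cT := sch_compact hT; have [pe pf] := (rsv_pon cT, lsv_pon cT).
have hs := sch_svals hT; have [p hp] := E_basis hE hs d0.
pose a := trunc p (svals T).
have ha : E a by exact: E_trunc.
have ap i : (p <= i)%N -> a i = 0 by move=> pi; rewrite /a /trunc ltnNge pi.
have aE i : a i != 0 -> nr (T (rsv T i)) != 0.
  rewrite /a /trunc; case: ifP => _; last by rewrite eqxx.
  by rewrite /svals (singular_valuesE cT); apply: contra_neq => ->; rewrite of_real0.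
have f1 i : a i != 0 -> nr (lsv T i) = 1.
  by move=> /aE h; rewrite nrZ modulus_of_real ger0_norm ?invr_ge0// mulVf.
have e1 i : nr (rsv T i) = 1 by have [] := rsvP cT i.
pose e i := if a i == 0 then 0 else rsv T i.
pose f i := if a i == 0 then 0 else lsv T i.
have ponr (g : nat -> H) : pon g -> pon (fun i => if a i == 0 then 0 else g i).
  move=> [g1 g2]; split=> [i j ij|i].
    by case: eqP => _; rewrite ?inner0l//; case: eqP => _; rewrite ?inner0r// g1.
  by case: eqP => _; [right|exact: g2].
have pe' : pon e by exact: ponr.
have pf' : pon f by exact: ponr.
have JE : jop e f a = jop (rsv T) (lsv T) a.
  apply/funext => x; rewrite (jop_fin pe' pf' x ap) (jop_fin pe pf x ap).
  apply: eq_bigr => i _; rewrite /e /f; case: (eqVneq (a i) 0) => // ->.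
  by rewrite !mul0r !scale0r.
have supp i : a i != 0 -> supported m M (rsv T i) /\ supported m M (lsv T i).
  by move=> h; exact: band_singular_vectors mM hT TE (aE i h).
have a0 : a 0%N = 0 -> forall i, a i = 0.
  have [p0|p0] := ltnP 0 p; last by move=> _ i; rewrite (ap i (leq_trans p0 (leq0n i))).
  rewrite {1}/a /trunc p0 {1}/svals (singular_valuesE cT) -of_real0 => /of_real_inj z0 i.
  rewrite /a /trunc /svals (singular_valuesE cT); case: ifP => [_|_]; last exact/esym/of_real0.
  congr of_real; apply/eqP; rewrite eq_le nr_ge0 andbT -z0.
  elim: i => [|i IH]; [exact: lexx|exact: (le_trans (rsv_noninc cT i) IH)].
exists (Block m M e f p a); split; [|exact: erefl|exact: erefl|exact: a0|].
- split; [exact: pe'|exact: pf'|move=> i|move=> i|exact: ap|move=> i] => /=.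
  + by rewrite /e; case: (eqVneq (a i) 0) => [_ j _|/supp[]].
  + by rewrite /f; case: (eqVneq (a i) 0) => [_ j _|/supp[]].
  rewrite /e /f; case: (eqVneq (a i) 0) => [->|h]; first by rewrite mul0r.
  by rewrite e1 (f1 i h) expr1n mulr1 of_real1 mulr1.
rewrite /block_op /= JE; have [hJ _] := jop_schatten hE pe pf ha; split; first exact: hJ.
have -> : T - jop (rsv T) (lsv T) a = jop (rsv T) (lsv T) (svals T - a).
  apply/funext => x; rewrite (jop_sub x pe pf (E_bounded hE hs) (E_bounded hE ha)).
  by rewrite fctB {1}(svals_jop cT).
have hsa : E (svals T - a) := subspaceB lE hs ha.
apply: le_lt_trans (jop_schatten hE pe pf hsa).2 _.
by rewrite (nnormB bE hs ha); exact: hp.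
Qed.

(** Choose [T] in [Y] with very small first [m] rows and columns. Removing them
    changes [T] little ([sch_corner]), as does compressing the rest to a finite
    corner [M] ([sch_compress]). What is left lives on the band from [m] to [M],
    where [band_operator_block] applies. *)
Lemma block_step (Y : set (H -> H)) m (d : R) : closed_subspace C Y ->
  (forall M : R, 0 < M -> exists T, Y T /\ M * rc_sqr m T < nC T ^+ 2) -> 0 < d -> d <= 1 ->
  exists B T, [/\ is_block B, lo B = m, (m <= hi B)%N, wt B 0%N != 0 & Y T /\
    nC (T - block_op B) <= d * nC (block_op B)].
Proof.
move=> [YC lY clY] hY d0 d1; have k0 := unit_norm_gt0 hE.
pose G := kp * (2 * m%:R) : R.
have G0 : 0 <= G by rewrite mulr_ge0 ?(ltW k0)// mulr_ge0.
have G1 : 0 < G + 1 by rewrite ltr_wpDl.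
have [r r0 rE] : exists2 r, 0 < r & r * (G + 1) = d / 6.
  exists (d / 6 / (G + 1)); first by rewrite divr_gt0// divr_gt0.
  by rewrite divfK// lt0r_neq0.
have [|T [YT hT]] := hY (r ^+ 2)^-1; first by rewrite invr_gt0 exprn_gt0.
have CT := YC _ YT; have T0 := sch_ge0 hE CT.
set t := nC T in hT T0.
have wq0 : 0 <= rc_sqr m T by apply: sumr_ge0 => i _; rewrite addr_ge0 ?sqr_ge0.
have t0 : 0 < t.
  rewrite lt_def T0 andbT; apply/eqP => e; move: hT; rewrite e expr0n /= ltNge => /negP; apply.
  by rewrite mulr_ge0// invr_ge0 exprn_ge0// ltW.
have d6 : 0 < d / 6 * t by rewrite mulr_gt0// divr_gt0.
have [c1 n1] := sch_corner hE m CT.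
have {}n1 : nC (T - (cut m \o T \o cut m)) <= d / 6 * t.
  apply: le_trans n1 _; rewrite mulrA -/G.
  have s1 : Num.sqrt (rc_sqr m T) <= r * t.
    rewrite -(@ler_pXn2r _ 2) ?nnegrE ?sqrtr_ge0 ?mulr_ge0 ?(ltW r0)//.
    rewrite sqr_sqrtr// exprMn; move: (ltW hT).
    by rewrite mulrC ler_pdivrMr ?exprn_gt0// mulrC.
  apply: le_trans (ler_wpM2l G0 s1) _; rewrite mulrA -rE; apply: (ler_wpM2r T0).
  by rewrite mulrC; apply: (ler_wpM2l (ltW r0)); rewrite lerDl.
have [c2 n2] := sch_compress hE CT; have [N hN] := n2 _ d6.
pose M := maxn m N; have mM : (m <= M)%N by exact: leq_maxl.
have {}n2 := hN M (leq_maxr _ _); have {}c2 := c2 M.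
pose S : H -> H := fun u => band m M (T (band m M u)).
have [c3 _] := sch_proj_right hE (oproj_band mM) CT.
have [CS _] := sch_proj_left hE (oproj_band mM) c3.
have {}CS : C S := CS.
have [c4 n4] := sch_proj_right hE (oproj_cut m) c2.
have [c5 n5] := sch_proj_left hE (oproj_cut m) c4.
have cE : cut m \o ((T - (fun x => fin M (T (fin M x)))) \o cut m) = (cut m \o T \o cut m) - S.
  apply/funext => x; rewrite -[LHS]/(cut m (T (cut m x) - fin M (T (fin M (cut m x))))).
  rewrite -[RHS]/(cut m (T (cut m x)) - S x) fin_cut//.
  by rewrite (linB (let: And3 l _ _ := oproj_cut m in l)) cut_fin.
have {}n5 : nC ((cut m \o T \o cut m) - S) <= d / 6 * t.
  by rewrite -cE; exact: le_trans n5 (le_trans n4 (ltW n2)).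
rewrite cE in c5.
have SE u : S u = band m M (S (band m M u)) by rewrite /S !band_idem.
have [B [hB hlo hhi wB [CB nB]]] := band_operator_block mM CS SE d6.
(* Three errors of at most [d / 6 * t] add up to half of what is allowed; since
   [d <= 1], the norm of the block is then at least [t / 2]. *)
have nTB : nC (T - block_op B) <= d / 2 * t.
  have -> : T - block_op B = (T - (cut m \o T \o cut m)) + (((cut m \o T \o cut m) - S) +
    (S - block_op B)).
    by rewrite addrA subrKA subrKA.
  have c6 : C (S - block_op B) := subspaceB lC CS CB.
  apply: le_trans (banach_normD bC c1 (subspaceD lC c5 c6)) _.
  have -> : d / 2 * t = d / 6 * t + (d / 6 * t + d / 6 * t) by field.
  by apply: lerD n1 _; apply: le_trans (banach_normD bC c5 c6) _; exact: lerD n5 (ltW nB).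
have tB : t <= d / 2 * t + nC (block_op B).
  have := nnorm_tri bC CT CB (subspace0 lC); rewrite !subr0 => h.
  by apply: le_trans h _; rewrite lerD2r.
have d2 : d / 2 <= 2^-1 by rewrite ler_pdivrMr// mulVf.
have dt : d / 2 * t <= 2^-1 * t by exact: ler_wpM2r.
exists B, T; split => //; first by rewrite hhi.
  apply/eqP => /wB w0; have B0 : block_op B = 0.
    by apply/funext => x; apply: jop_eq0 => i; rewrite w0 mul0r.
  move: tB; rewrite B0 (nnorm0 bC) addr0 => h.
  have := le_trans h dt; rewrite ler_pMl ?invr_gt0//.
  by rewrite leNgt invf_lt1 ?ltr1n.
split => //; apply: le_trans nTB _; rewrite -mulrA; apply: ler_wpM2l; first exact: ltW.
have : 2^-1 * t + 2^-1 * t <= 2^-1 * t + nC (block_op B).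
  have -> : 2^-1 * t + 2^-1 * t = t by field.
  by apply: le_trans tB _; rewrite lerD2r.
by rewrite lerD2l.
Qed.

Lemma jop_support e f (a : nat -> K) (s : seq nat) x : pon e -> pon f -> uniq s ->
  (forall i, i \notin s -> a i = 0) ->
  jop e f a x = \sum_(i <- s) (a i * inner x (e i)) *: f i.
Proof.
move=> pe pf us hs; pose p := (\sum_(i <- s) i).+1.
have sp i : i \in s -> (i < p)%N by move=> hi; rewrite ltnS (big_rem i)//= leq_addr.
rewrite (jop_fin (p := p) pe pf) => [|i pi]; last first.
  by apply: hs; apply: contraL pi => /sp; rewrite -ltnNge.
rewrite -(big_mkord xpredT (fun i => (a i * inner x (e i)) *: f i)).
rewrite (bigID (mem s)) /= [X in _ + X]big1 ?addr0; last first.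
  by move=> i /hs ->; rewrite mul0r scale0r.
rewrite -big_filter; apply: perm_big; apply: uniq_perm => //.
  by rewrite filter_uniq// iota_uniq.
move=> i; rewrite mem_filter mem_index_iota /=; case: (boolP (i \in s)) => //= /sp; exact.
Qed.

Lemma nat_pairs : exists (phi : nat -> nat * nat) (psi : nat * nat ->
  nat), cancel phi psi /\ cancel psi phi.
Proof.
have : ([set: nat] #= [set: nat * nat])%card by rewrite card_eq_sym; exact: card_nat2.
move=> /card_set_bijP[phi]; rewrite setTT_bijective => -[psi h1 h2]; by exists phi, psi.
Qed.

(** Choose blocks one after the other, each beyond the previous one. Blocks on
    disjoint bands have mutually orthogonal singular vectors, which a bijection of
    [nat] with [nat * nat] arranges in two single families:
    [block_sequence_complemented] applies. *)
Lemma gliding_hump (Y : set (H -> H)) : subprojective E -> closed_subspace C Y ->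
  (forall m (M : R), 0 < M -> exists T, Y T /\ M * rc_sqr m T < nC T ^+ 2) ->
  exists Z, [/\ Z `<=` Y, closed_subspace C Z, infinite_dim Z & complemented C Z].
Proof.
move=> sE Yc hY.
have /choice[G hG] : forall mn : nat * nat, exists BT : block * (H -> H),
    [/\ is_block BT.1, lo BT.1 = mn.1, (mn.1 <= hi BT.1)%N, wt BT.1 0%N != 0 & Y BT.2 /\
    nC (BT.2 - block_op BT.1) <= 2^-1 ^+ mn.2.+1 * nC (block_op BT.1)].
  move=> [m n]; have [||B [T h]] := @block_step Y m (2^-1 ^+ n.+1) Yc (hY m).
  - by rewrite exprn_gt0// invr_gt0.
  - by rewrite exprn_ile1 ?invr_ge0// invf_le1// ler1n.
  by exists (B, T).
pose F := fix F n := if n is n'.+1 then G (hi (F n').1, n) else G (0, 0)%N.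
pose B n := (F n).1; pose z n := (F n).2.
have hF n : [/\ is_block (B n), (lo (B n) <= hi (B n))%N, wt (B n) 0%N != 0, Y (z n) &
    nC (z n - block_op (B n)) <= 2^-1 ^+ n.+1 * nC (block_op (B n))].
  have aux mn : [/\ is_block (G mn).1, (lo (G mn).1 <= hi (G mn).1)%N, wt (G mn).1 0%N != 0,
    Y (G mn).2 &
    nC ((G mn).2 - block_op (G mn).1) <= 2^-1 ^+ mn.2.+1 * nC (block_op (G mn).1)].
    by have [h1 h2 h3 h4 [h5 h6]] := hG mn; rewrite h2.
  by case: n => [|n]; [exact: (aux (0, 0)%N)|exact: (aux (hi (F n).1, n.+1))].
have hB n : is_block (B n) by have [] := hF n.
have loS n : lo (B n.+1) = hi (B n) by have [] := hG (hi (F n).1, n.+1).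
have order m n : (m < n)%N -> (hi (B m) <= lo (B n))%N.
  elim: n => // n IH; rewrite ltnS leq_eqVlt loS => /predU1P[->//|/IH h].
  by apply: leq_trans h _; have [] := hF n.
have [phi [psi [phiK psiK]]] := nat_pairs.
pose e i := dom (B (phi i).1) (phi i).2; pose f i := cod (B (phi i).1) (phi i).2.
pose al n i := if (phi i).1 == n then wt (B n) (phi i).2 else 0.
have pon_blocks (g : block -> nat -> H) : (forall n, pon (g (B n))) ->
    (forall n i, supported (lo (B n)) (hi (B n)) (g (B n) i)) ->
    pon (fun i => g (B (phi i).1) (phi i).2).
  move=> h1 h2; split=> [i j ij|i]; last exact: (h1 _).2.
  have [e1|e1] := eqVneq (phi i).1 (phi j).1.
    rewrite e1; apply: (h1 _).1; apply: contra_neq ij => e2.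
    by apply: (can_inj phiK); rewrite [phi i]surjective_pairing [phi j]surjective_pairing e1 e2.
  move: e1; rewrite neq_ltn => /orP[] h.
    exact: supported_inner (order _ _ h) (h2 _ _) (h2 _ _).
  by rewrite inner_conj (supported_inner (order _ _ h) (h2 _ _) (h2 _ _)) conj0.
have pe : pon e by apply: (pon_blocks dom) => n; [exact: block_dom_pon|exact: block_dom_supp].
have pf : pon f by apply: (pon_blocks cod) => n; [exact: block_cod_pon|exact: block_cod_supp].
(* The indices at which [al n] may be nonzero. *)
pose s n := [seq psi (n, j) | j <- iota 0 (len (B n))].
have als n i : i \notin s n -> al n i = 0.
  rewrite /al; case: eqP => // en; case: (ltnP (phi i).2 (len (B n))) => h; last first.
    by move=> _; exact: block_len.
  case/negP; apply/mapP; exists (phi i).2; first by rewrite mem_iota.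
  by rewrite -en -surjective_pairing phiK.
have us n : uniq (s n).
  rewrite map_inj_in_uniq ?iota_uniq// => i j _ _ /(can_inj psiK)[]//.
have Jal n : jop e f (al n) = block_op (B n).
  apply/funext => x; rewrite (jop_support x pe pf (us n) (als n)) big_map.
  rewrite /block_op (jop_fin (block_dom_pon (hB n)) (block_cod_pon (hB n)) x (block_len (hB n))).
  rewrite -(big_mkord xpredT (fun i => (wt (B n) i * inner x (dom (B n) i)) *: cod (B n) i)).
  rewrite /index_iota subn0; apply: eq_bigr => j _.
  by rewrite /al /e /f psiK /= eqxx.
apply: (@block_sequence_complemented R k E hE al (fun i => (phi i).1) (fun n =>
  psi (n, 0%N)) e f z Y) => //.
- move=> n; have sp i : i \in s n -> (i < (\sum_(i <- s n) i).+1)%N.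
    by move=> hi'; rewrite ltnS (big_rem i)//= leq_addr.
  have -> : al n = trunc (\sum_(i <- s n) i).+1 (al n); last exact: E_trunc.
  apply/funext => i; rewrite /trunc; case: ifP => // h.
  by apply: als; apply: contraFN h; exact: sp.
- by move=> n i h; rewrite /al (negbTE h).
- by move=> n; rewrite /al psiK /= eqxx; have [] := hF n.
- by move=> n; have [] := hF n.
- move=> n i; rewrite /al; case: eqP => [en|]; last by rewrite mul0r.
  by rewrite /e /f en block_unit.
by move=> n; rewrite Jal; have [] := hF n.
Qed.

End GlidingHump.

(** * Diagonal operators *)

Section Diagonal.
Context {R : realType} {k : scalar_kind}.
Local Notation K := (scalar_field R k).
Local Notation H := (ell2 R k).
Variable E : normed_space (nat -> K).
Hypothesis hE : symmetric_sequence_space E.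
Local Notation nE := (nnorm E).
Local Notation C := (schatten E).
Local Notation nC := (nnorm C).

Lemma delta_pon : pon (delta : nat -> H).
Proof.
split=> [i j ij|i]; first by rewrite inner_delta deltaE eq_sym (negbTE ij).
by left; exact: nr_delta.
Qed.

(** Either finitely many rows and columns control the norm on [Y], and [Y] itself
    is complemented; or there is a gliding hump. *)
Lemma subprojective_schatten : subprojective E -> subprojective C.
Proof.
move=> sE Y Yc Yi.
have [[m [M [M0 hM]]]|hno] :=
  pselect (exists m (M : R), 0 < M /\ forall T, Y T -> nC T ^+ 2 <= M * rc_sqr m T).
  by exists Y; split => //; exact: (rows_columns_complemented hE Yc M0 hM).
apply: (gliding_hump hE sE Yc) => m M M0; apply: contrapT => h; apply: hno.
exists m, M; split => // T YT; rewrite leNgt; apply/negP => hlt.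
by apply: h; exists T.
Qed.

(** The diagonal operators form a copy of [E] in the Schatten space, onto which
    taking diagonals projects. *)
Lemma subprojective_diagonal : subprojective C -> subprojective E.
Proof.
move=> sC Y [YE lY clY] Yi.
have bE := sss_banach hE; have lE := banach_submod bE.
have bC := schatten_banach hE; have lC := banach_submod bC.
have pd := delta_pon.
pose J : (nat -> K) -> H -> H := jop delta delta; pose D := diag_of (delta : nat -> H) delta.
have JC w : E w -> C (J w) by move=> Ew; exact: (jop_schatten hE pd pd Ew).1.
have nJ w : E w -> nC (J w) <= nE w by move=> Ew; exact: (jop_schatten hE pd pd Ew).2.
have DE T : C T -> E (D T) by move=> hT; exact: (diag_schatten hE pd pd hT).1.
have nD T : C T -> nE (D T) <= nC T by move=> hT; exact: (diag_schatten hE pd pd hT).2.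
have lJ : linear_on (carrier E) J.
  move=> c v w Ev Ew; apply/funext => x.
  exact: (jop_lin pd pd x (E_bounded hE Ev) (E_bounded hE Ew) c).
have lD : linear_on (carrier C) D.
  by move=> c T S _ _; apply/funext => i; rewrite /D /diag_of fctE innerDZl.
have DJ w : E w -> D (J w) = w.
  move=> Ew; apply/funext => i; rewrite /D /diag_of /J (jop_basis pd pd i (E_bounded hE Ew)).
  by rewrite innerZl inner_self nr_delta expr1n of_real1 !mulr1.
have lJY : linear_on Y J by move=> c v w /YE Ev /YE Ew; exact: lJ.
have JYc : closed_subspace C (J @` Y).
  split; first by move=> _ [w /YE Ew <-]; exact: JC.
  - apply/linear_subspaceP; split; first by exists 0; [exact: subspace0|exact: linear_on0 lY lJY].
    move=> c _ _ [v hv <-] [w hw <-]; exists (c *: v + w); first exact: subspaceL.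
    exact: lJY.
  move=> u T hu CT uT.
  have uC n : C (u n) by have [w /YE Ew <-] := hu n; exact: JC.
  have ucv := (norm_cvgP bC uC CT).1 uT.
  have DuY n : Y (D (u n)) by have [w hw <-] := hu n; rewrite DJ//; exact: YE.
  have Dcv : ncv E (fun n => D (u n)) (D T).
    apply: null_le ucv => n; rewrite -(linear_onB lC lD (uC n) CT).
    exact: nD (subspaceB lC (uC n) CT).
  have DTY : Y (D T).
    by apply: (clY _ _ DuY (DE _ CT)); apply/(norm_cvgP bE) => // [n|]; [exact/YE|exact: DE].
  exists (D T) => //; apply: (ncv_uniq bC uC (JC _ (DE _ CT)) CT _ ucv).
  apply: null_le Dcv => n; have ED : E (D (u n) - D T).
    exact: subspaceB lE (DE _ (uC n)) (DE _ CT).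
  have -> : u n - J (D T) = J (D (u n) - D T).
    rewrite (linear_onB lE lJ (DE _ (uC n)) (DE _ CT)); congr (_ - _).
    by have [w hw <-] := hu n; rewrite DJ//; exact: YE.
  exact: nJ.
have JYi : infinite_dim (J @` Y).
  apply: (infinite_dim_image lY lJY) => // w /YE Ew h; rewrite -(DJ w Ew) h.
  exact: linear_on0 lC lD.
have [Z [ZY Zc Zi [P [bP PP PZ]]]] := sC _ JYc JYi.
have [ZC lZ _] := Zc; have [PC lP _] := bP.
have JD T : Z T -> J (D T) = T.
  by move=> /ZY[w hw <-]; rewrite DJ//; exact: YE.
have lDZ : linear_on Z D by move=> c T S /ZC hT /ZC hS; exact: lD.
have cZ : complemented E (D @` Z).
  have [c c0 hc] := bounded_linearP bC bP.
  apply: (@retract_complemented R k _ _ E C bE bC Z D (P \o J) 1 lZ ZC) =>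
    [T /ZC|//|T /ZC hT||w Ew|T hT].
  - exact: DE.
  - by rewrite mul1r; exact: nD.
  - split=> [w Ew|g v w Ev Ew|] /=; first exact/PC/JC.
      by rewrite (lJ g v w Ev Ew); apply: lP; exact: JC.
    exists c => w Ew; apply: le_trans (hc _ (JC _ Ew)) _.
    by apply: (ler_wpM2l c0); exact: nJ.
  - by rewrite -PZ; exists (J w) => //; exact: JC.
  by rewrite /= (JD T hT); move: hT; rewrite -PZ => -[S hS <-]; exact: PP.
exists (D @` Z); split => //.
- by move=> _ [T /ZY[w hw <-] <-]; rewrite DJ//; exact: YE.
- exact: complemented_closed cZ.
apply: (infinite_dim_image lZ lDZ) => // T hT h; rewrite -(JD T hT) h.
exact: linear_on0 lE lJ.
Qed.

End Diagonal.

Theorem proposition5p1 (R : realType) (k : scalar_kind)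
    (E : normed_space (nat -> scalar_field R k)) :
  symmetric_sequence_space E ->
  ~ contains_copy E c0 ->
  (subprojective (schatten E) <-> subprojective E).
Proof.
move=> hE _; split; [exact: subprojective_diagonal|exact: subprojective_schatten].
Qed.
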